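(* There is an absolute constant $C>0$ and, for every $K>0$, there are constants $c_K,C_K>0$ depending only on $K$ such that the following holds. Let $n,d\ge 1$ be integers and let $X=(X_1,\ldots,X_n)$ have independent coordinates with $$\mathbb{E}X_i=0,\qquad \mathbb{E}X_i^2=1,\qquad \|X_i\|_{\psi_2}\le K\qquad(1\le i\le n).$$ Let $L>0$, let $f:H_d\to\mathbb{R}$ be convex and $L$-Lipschitz, and put $Z=f(X^{\otimes d})$. (Tail bound) For every real $u$ with $1\le u\le c_K\,n/d^2$, $$\mathbb{P}\left\{|Z-\mathbb{E}Z|>C_KL\,n^{(d-1)/2}\left(d\sqrt u+\sqrt{d\,u\log\left(e+\frac nu\right)}\right)\right\}\le C e^{-c_Ku}.$$ (Moment bound) If $d\le c_K\sqrt n$, then for every real $p$ with $1\le p\le c_K\,n/d^2$, $$\|Z-\mathbb{E}Z\|_{L_p}\le C_KL\,n^{(d-1)/2}\left(d\sqrt p+\sqrt{d\,p\log\left(e+\frac np\right)}\right).$$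
   Context: $H_d=(\mathbb{R}^n)^{\otimes d}$ is the Hilbert-space tensor product of $d$ copies of Euclidean $\mathbb{R}^n$, with its Hilbert norm (for which $\|x_1\otimes\cdots\otimes x_d\|=\prod_j\|x_j\|$); Lipschitz is with respect to this norm. $X^{\otimes d}=X\otimes\cdots\otimes X$ ($d$ factors). For a real random variable $W$ and $p\ge1$, $\|W\|_{L_p}=(\mathbb{E}|W|^p)^{1/p}$ and $\|W\|_{\psi_2}=\inf\{a>0:\mathbb{E}\exp(W^2/a^2)\le 2\}$. *)

(* Defs.v *)
From HB Require Import structures.
From mathcomp Require Import all_boot all_order all_algebra.
From mathcomp Require Import all_classical all_reals all_analysis.

Set Implicit Arguments.
Unset Strict Implicit.
Unset Printing Implicit Defensive.

Import Order.TTheory GRing.Theory Num.Theory.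

Local Open Scope classical_set_scope.
Local Open Scope ring_scope.

(* (R^n)^{(x) d} in coordinates with respect to the orthonormal basis
   e_{i_1} (x) ... (x) e_{i_d}; a multi-index is a map from 'I_d to 'I_n.
   The codomain R^o makes this an R-module, with pointwise operations.  The
   Hilbert structure is identified by the lemma tensor_dot_pure below. *)
Definition tensor_space (R : realType) (n d : nat) : lmodType R :=
  {ffun {ffun 'I_d -> 'I_n} -> R^o}.

Definition tensor_dot (R : realType) (n d : nat) (x y : tensor_space R n d) : R :=
  \sum_i x i * y i.

Definition tensor_norm (R : realType) (n d : nat) (x : tensor_space R n d) : R :=
  Num.sqrt (tensor_dot x x).

Definition tensor_pure (R : realType) (n d : nat) (x : 'I_d -> 'rV[R]_n) :
    tensor_space R n d :=
  [ffun i : {ffun 'I_d -> 'I_n} => \prod_(j < d) x j ord0 (i j)].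

Definition tensor_power (R : realType) (n d : nat) (x : 'rV[R]_n) :
    tensor_space R n d :=
  tensor_pure (fun=> x).

Lemma tensor_dot_pure (R : realType) (n d : nat) (x y : 'I_d -> 'rV[R]_n) :
  tensor_dot (tensor_pure x) (tensor_pure y) =
  \prod_(j < d) \sum_(k < n) x j ord0 k * y j ord0 k.
Proof.
rewrite bigA_distr_bigA; apply: eq_bigr => i _.
by rewrite !ffunE -big_split.
Qed.

Lemma tensor_norm_pure (R : realType) (n d : nat) (x : 'I_d -> 'rV[R]_n) :
  tensor_norm (tensor_pure x) =
  \prod_(j < d) Num.sqrt (\sum_(k < n) x j ord0 k ^+ 2).
Proof.
rewrite /tensor_norm tensor_dot_pure.
suff [_ ->] : 0 <= \prod_(j < d) \sum_(k < n) x j ord0 k * x j ord0 k /\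
    Num.sqrt (\prod_(j < d) \sum_(k < n) x j ord0 k * x j ord0 k) =
    \prod_(j < d) Num.sqrt (\sum_(k < n) x j ord0 k * x j ord0 k) by [].
elim/big_ind2: _ => [|a b a' b' [b0 <-] [b'0 <-]|j _].
- by rewrite ler01 sqrtr1.
- by rewrite mulr_ge0// sqrtrM.
- by split=> //; apply: sumr_ge0 => k _; rewrite -expr2 sqr_ge0.
Qed.

Definition tensor_lipschitz (R : realType) (n d : nat) (L : R)
    (f : tensor_space R n d -> R) : Prop :=
  forall x y, `|f x - f y| <= L * tensor_norm (x - y).

Definition mutually_independent (disp : measure_display)
    (T : measurableType disp) (R : realType) (P : probability T R)
    (I : finType) (X : I -> {RV P >-> R}) : Prop :=
  forall (J : {set I}) (A : I -> set R), (forall i, measurable (A i)) ->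
    P (\bigcap_(i in [set` J]) (X i @^-1` A i)) =
    (\prod_(i in J) P (X i @^-1` A i))%E.

(* An extended real, +oo when no a is admissible. *)
Definition psi2_norm (disp : measure_display) (T : measurableType disp)
    (R : realType) (P : probability T R) (W : T -> R) : \bar R :=
  ereal_inf [set a%:E | a in
    [set a : R | 0 < a /\
      ('E_P[fun w => expR (W w ^+ 2 / a ^+ 2)] <= 2%:E)%E]].

(* Main.v *)
Require Import Defs.
From HB Require Import structures.
From mathcomp Require Import all_boot all_order all_algebra.
From mathcomp Require Import all_classical all_reals all_analysis.
From mathcomp Require Import measurable_realfun.
From mathcomp Require Import ring lra.

Set Implicit Arguments.
Unset Strict Implicit.
Unset Printing Implicit Defensive.

Import Order.TTheory GRing.Theory Num.Theory.

Local Open Scope classical_set_scope.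
Local Open Scope ring_scope.


(** Both bounds follow from one moment estimate: for an integer [k] with
   [p <= k <= 2 p], the [k]-th moment of [Z - E Z] is at most [(C S)^k], where
   [S^2 = k L^2 n^(d-1) (d M^2 + d^2)] and [M^2] is of the order of
   [ln (e + n/k)].  Markov's inequality turns it into the tail bound, and the
   monotonicity of Lebesgue norms into the moment bound.

   The function [x |-> f (x^(x)d)] is not convex, but it is a difference of two
   functions that behave like convex ones.  The second-order Taylor remainder of
   [x |-> x^(x)d] is bounded in norm by three times the one of the convex
   function [x |-> |x|^d] ([tensor_taylor2_le]).  Hence, for vectors [x_h] with
   weights [nu h] and for one of them, [x_e], Jensen's inequality for the tensors
   [x_h^(x)d] shows that [F x = f (x^(x)d) + 3 L |x|^d] exceeds its average by at
   most a first-order term in the mean displacement from [x_e]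
   ([graded_convex]), and so does [3 L |x|^d] ([graded_norm]).

   Take for the [x_h] the [2^n] vectors obtained by mixing the coordinates of two
   given vectors.  The first-order term is then at most a weight [w e] times the
   Euclidean norm of the vector of masses that [nu] gives to the flips of each
   coordinate.  This is exactly the situation of Talagrand's convex distance: the
   functional form [cube_hull_ineq] of his inequality bounds the moments of
   [F e - F h] over pairs of points of the cube by those of [w^2] ([cube_moment]),
   and then those of the difference of [f (x^(x)d)] at antipodal points
   ([mixv_moment]).

   Let [X'] be an independent copy of [X].  Exchanging any set of coordinates of
   [X] with those of [X'] preserves the joint law ([integral_swapped]), and the two
   vectors obtained are antipodal mixtures.  So the moments of [Z - Z'] are
   averages over the cube of the above and are governed by the moments of the
   weight, which involves [|X|], the sum of the fourth powers of the coordinates,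
   and a bound [M] on all the coordinates.  For the last one the coordinates
   larger than [M] are first replaced by [0].  This is the origin of the
   logarithm: [M^2] has to be of the order of [ln (e + n/k)] for the removed part
   to be harmless ([mean_clip_error]).  The condition [k d^2 <= c n] gives all
   these quantities [k]-th moments of the expected size. *)

(** * Talagrand's convex-hull inequality on the discrete cube *)

(** Recursive, so that the two halves of a cube are cubes definitionally. *)
Fixpoint cube (n : nat) : finType :=
  if n is n'.+1 then (bool * cube n')%type : finType else (unit : finType).

Fixpoint bit (n : nat) : cube n -> nat -> bool :=
  match n return cube n -> nat -> bool with
  | 0 => fun _ _ => false
  | n'.+1 => fun e i => if i is i'.+1 then bit e.2 i' else e.1
  end.

Definition weights (R : realType) (I : finType) (nu : I -> R) : Prop :=
  (forall e, 0 <= nu e) /\ \sum_e nu e = 1.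

Definition flip_mass (R : realType) n (nu : cube n -> R) (e : cube n) (i : nat) : R :=
  \sum_h nu h * (bit h i != bit e i)%:R.

Definition hull_cost (R : realType) n (F : cube n -> R) (e : cube n)
    (nu : cube n -> R) : R :=
  \sum_h nu h * F h + 16^-1 * \sum_(i < n) flip_mass nu e i ^+ 2.

(** When [F] vanishes on a set and is infinite outside, [hull_inf F] is [1/16]
   of the square of Talagrand's convex distance to that set. *)
Definition hull_inf (R : realType) n (F : cube n -> R) (e : cube n) : R :=
  inf [set hull_cost F e nu | nu in @weights R (cube n)].

Section cube.
Variable R : realType.

Lemma sum_cubeS n (f : cube n.+1 -> R) (s : bool) :
  \sum_e f e = \sum_e f (s, e) + \sum_e f (~~ s, e).
Proof.
transitivity (\sum_b \sum_(e : cube n) f (b, e)).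
  by rewrite pair_bigA; apply: eq_bigr => -[].
by rewrite big_bool /=; case: s => //=; rewrite addrC.
Qed.

Lemma ler_weighted_sum (I : finType) (nu : I -> R) (F : I -> R) (c : R) :
  weights nu -> (forall e, c <= F e) -> c <= \sum_h nu h * F h.
Proof.
move=> [nu0 nu1] cF; rewrite -[c]mul1r -nu1 mulr_suml.
by apply: ler_sum => h _; rewrite ler_wpM2l.
Qed.

Lemma weights_dirac (I : finType) (e : I) :
  weights (fun h => (h == e)%:R : R).
Proof.
split=> [h|]; first by rewrite ler0n.
by rewrite (bigD1 e)//= eqxx big1 ?addr0// => h /negbTE ->.
Qed.

Lemma hull_cost_lb n (F : cube n -> R) e nu :
  weights nu -> - \sum_h `|F h| <= hull_cost F e nu.
Proof.
move=> wnu; rewrite -[X in X <= _]addr0 lerD//; last first.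
  by rewrite mulr_ge0 ?invr_ge0// sumr_ge0// => i _; rewrite sqr_ge0.
apply: ler_weighted_sum => // h; rewrite lerNl.
by rewrite (le_trans (ler_norm _))// normrN (bigD1 h)//= lerDl sumr_ge0.
Qed.

Lemma has_inf_hull n (F : cube n -> R) e :
  has_inf [set hull_cost F e nu | nu in @weights R (cube n)].
Proof.
split.
  exists (hull_cost F e (fun h => (h == e)%:R)).
  by exists (fun h => (h == e)%:R) => //; exact: weights_dirac.
by exists (- \sum_h `|F h|) => _ [nu wnu <-]; exact: hull_cost_lb.
Qed.

Lemma hull_inf_le n (F : cube n -> R) e nu :
  weights nu -> hull_inf F e <= hull_cost F e nu.
Proof.
by move=> wnu; apply: ge_inf; [case: (has_inf_hull F e)|exists nu].
Qed.

Lemma le_hull_inf n (F : cube n -> R) e c :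
  (forall nu, weights nu -> c <= hull_cost F e nu) -> c <= hull_inf F e.
Proof.
move=> H; apply: lb_le_inf; first by case: (has_inf_hull F e).
by move=> _ [nu wnu <-]; exact: H.
Qed.

Lemma sqr_mix (t p q : R) : 0 <= t <= 1 ->
  ((1 - t) * p + t * q) ^+ 2 <= (1 - t) * p ^+ 2 + t * q ^+ 2.
Proof.
move=> /andP[t0 t1]; rewrite -subr_ge0.
rewrite (_ : _ - _ = t * (1 - t) * (p - q) ^+ 2); last by ring.
by rewrite mulr_ge0 ?sqr_ge0// mulr_ge0// subr_ge0.
Qed.

(** Weights on the two halves of the cube are joined with total masses [1 - t]
   and [t].  The split coordinate alone pays [t^2]; the flip masses of the
   others are averaged, and the square is convex. *)
Lemma hull_cost_mix n (F : cube n.+1 -> R) (s : bool) (e : cube n)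
    (nu0 nu1 : cube n -> R) (t : R) :
  weights nu0 -> weights nu1 -> 0 <= t <= 1 ->
  exists2 nu : cube n.+1 -> R, weights nu &
  hull_cost F (s, e) nu <=
  (1 - t) * hull_cost (fun h => F (s, h)) e nu0 +
  t * hull_cost (fun h => F (~~ s, h)) e nu1 + 16^-1 * t ^+ 2.
Proof.
move=> [n00 n01] [n10 n11] /[dup] t01 /andP[t0 t1].
pose nu (h : cube n.+1) : R :=
  if h.1 == s then (1 - t) * nu0 h.2 else t * nu1 h.2.
have nus h : nu (s, h) = (1 - t) * nu0 h by rewrite /nu /= eqxx.
have nuc h : nu (~~ s, h) = t * nu1 h by rewrite /nu /=; case: (s).
exists nu.
  split=> [h|].
    by rewrite /nu; case: ifP => _; rewrite mulr_ge0// subr_ge0.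
  rewrite (sum_cubeS nu s).
  under eq_bigr do rewrite nus.
  under [X in _ + X]eq_bigr do rewrite nuc.
  by rewrite -!mulr_sumr n01 n11; ring.
rewrite /hull_cost (sum_cubeS _ s) big_ord_recl /=.
have -> : flip_mass nu (s, e) 0 = t.
  rewrite /flip_mass (sum_cubeS _ s) /=.
  rewrite big1 ?add0r; last by move=> h _; rewrite eqxx mulr0.
  have ns : ~~ s != s by case: (s).
  under eq_bigr do rewrite nuc ns mulr1.
  by rewrite -mulr_sumr n11 mulr1.
have flS (i : 'I_n) : flip_mass nu (s, e) (lift ord0 i) =
    (1 - t) * flip_mass nu0 e i + t * flip_mass nu1 e i.
  rewrite /flip_mass (sum_cubeS _ s); congr (_ + _); rewrite mulr_sumr.
    by apply: eq_bigr => h _; rewrite nus mulrA.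
  by apply: eq_bigr => h _; rewrite nuc mulrA.
rewrite (eq_bigr _ (fun i _ => congr1 (fun x => x ^+ 2) (flS i))).
have -> : \sum_h nu (s, h) * F (s, h) = (1 - t) * \sum_h nu0 h * F (s, h).
  by rewrite mulr_sumr; apply: eq_bigr => h _; rewrite nus mulrA.
have -> : \sum_h nu (~~ s, h) * F (~~ s, h) = t * \sum_h nu1 h * F (~~ s, h).
  by rewrite mulr_sumr; apply: eq_bigr => h _; rewrite nuc mulrA.
have le : \sum_(i < n) ((1 - t) * flip_mass nu0 e i + t * flip_mass nu1 e i) ^+ 2
  <= (1 - t) * \sum_(i < n) flip_mass nu0 e i ^+ 2 +
     t * \sum_(i < n) flip_mass nu1 e i ^+ 2.
  rewrite !mulr_sumr -big_split; apply: ler_sum => i _; exact: sqr_mix.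
lra.
Qed.

Lemma hull_inf_mix n (F : cube n.+1 -> R) (s : bool) (e : cube n) (t : R) :
  0 <= t <= 1 ->
  hull_inf F (s, e) <= (1 - t) * hull_inf (fun h => F (s, h)) e +
    t * hull_inf (fun h => F (~~ s, h)) e + 16^-1 * t ^+ 2.
Proof.
move=> t01; apply/ler_addgt0Pr => d d0.
have [_ [nu0 w0 <-] h0] := inf_adherent d0 (has_inf_hull (fun h => F (s, h)) e).
have [_ [nu1 w1 <-] h1] := inf_adherent d0 (has_inf_hull (fun h => F (~~ s, h)) e).
have [nu wnu le] := hull_cost_mix F s e w0 w1 t01.
apply: (le_trans (hull_inf_le F (s, e) wnu)); apply: (le_trans le).
move: h0 h1; rewrite -!/(hull_inf _ _) => h0 h1.
have /andP[t0 t1] := t01.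
have := ler_wpM2l t0 (ltW h1).
have t1' : 0 <= 1 - t by rewrite subr_ge0.
have := ler_wpM2l t1' (ltW h0).
nra.
Qed.

Lemma ln_bounds (r : R) : 0 < r -> 1 - r^-1 <= ln r <= r - 1.
Proof.
move=> r0; apply/andP; split; last first.
  have := expR_ge1Dx (ln r); rewrite lnK// => h; lra.
have ri0 : 0 < r^-1 by rewrite invr_gt0.
have := expR_ge1Dx (ln r^-1); rewrite lnK//; rewrite lnV// => h; lra.
Qed.

(** The choice of the moved mass in the induction, where [r] is the ratio of the
   sums over the two halves.  Moving [t] keeps the fraction [1 - t] of the loss
   [- ln r] and costs [t^2 / 16].  For [1 - r <= 1/3] a mass [3 (1 - r)] is
   enough; otherwise everything is moved, at the price [1/16]. *)
Lemma two_point_tradeoff (r : R) : 0 < r -> r <= 1 ->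
  exists2 t : R, 0 <= t <= 1 &
    (1 - t) * - ln r + 16^-1 * t ^+ 2 <= ln (2 - r).
Proof.
move=> r0 r1; pose t := 1 - r.
have t0 : 0 <= t by rewrite /t subr_ge0.
have /andP[lr _] := ln_bounds r0.
have h2 : 0 < 2 - r by lra.
have /andP[l2 _] := ln_bounds h2.
have e2 : 1 - (2 - r)^-1 = t / (1 + t).
  rewrite /t; field; lra.
have er : 1 - r^-1 = - (t / (1 - t)) by rewrite /t; field; lra.
have t1 : t < 1 by rewrite /t; lra.
have [t3|t3] := leP t (3^-1); last first.
  exists 1; first by rewrite lexx ler01.
  rewrite subrr mul0r add0r expr1n mulr1; apply: le_trans l2.
  rewrite e2 ler_pdivlMr; lra.
exists (3 * t); first by apply/andP; split; lra.
apply: le_trans l2; rewrite e2.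
have le1 : (1 - 3 * t) * - ln r <= (1 - 3 * t) * (t / (1 - t)).
  by rewrite ler_wpM2l//; lra.
have le2 : (1 - 3 * t) * (t / (1 - t)) <= t - 2 * t ^+ 2.
  rewrite mulrA ler_pdivrMr; last by lra.
  nra.
have le3 : t - t ^+ 2 <= t / (1 + t).
  rewrite ler_pdivlMr; last by lra.
  nra.
nra.
Qed.

(** Hoelder's inequality with exponents [1/(1-t)] and [1/t] in logarithmic form:
   once both sums are normalised, it is the convexity of the exponential. *)
Lemma sum_expR_hoelder (I : finType) (F G : I -> R) (a b t : R) :
  0 <= t <= 1 -> \sum_e expR (F e) <= expR a -> \sum_e expR (G e) <= expR b ->
  \sum_e expR ((1 - t) * F e + t * G e) <= expR ((1 - t) * a + t * b).
Proof.
move=> /andP[t0 t1] Fa Gb.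
have pt e : expR ((1 - t) * F e + t * G e) <=
    expR ((1 - t) * a + t * b) *
    ((1 - t) * (expR (F e) / expR a) + t * (expR (G e) / expR b)).
  rewrite -2!expRB.
  pose z := (1 - t) * (F e - a) + t * (G e - b).
  rewrite (_ : (1 - t) * F e + t * G e = (1 - t) * a + t * b + z); last first.
    by rewrite /z; ring.
  rewrite [leLHS]expRD ler_wpM2l ?expR_ge0//.
  have cv x : expR x >= expR z * (1 + (x - z)).
    have -> : expR x = expR z * expR (x - z) by rewrite -expRD; congr expR; ring.
    rewrite ler_wpM2l ?expR_ge0//.
    exact: expR_ge1Dx.
  have t1' : 0 <= 1 - t by lra.
  have c1 := ler_wpM2l t1' (cv (F e - a)).
  have c2 := ler_wpM2l t0 (cv (G e - b)).
  apply: le_trans (lerD c1 c2).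
  rewrite le_eqVlt; apply/orP; left; apply/eqP.
  rewrite /z; ring.
apply: (le_trans (ler_sum _ (fun e _ => pt e))).
rewrite -mulr_sumr ler_piMr ?expR_ge0//.
rewrite big_split /= -!mulr_sumr -!mulr_suml.
have h1 : (\sum_e expR (F e)) / expR a <= 1 by rewrite ler_pdivrMr ?expR_gt0// mul1r.
have h2 : (\sum_e expR (G e)) / expR b <= 1 by rewrite ler_pdivrMr ?expR_gt0// mul1r.
nra.
Qed.

Lemma card_cube n : #|cube n| = (2 ^ n)%N.
Proof.
by elim: n => [|n IH]; rewrite ?card_unit//= card_prod card_bool IH expnS.
Qed.

Lemma sum_expR_gt0 n (F : cube n -> R) : 0 < \sum_e expR (F e).
Proof.
suff [e] : exists e : cube n, true.
  by rewrite (bigD1 e)//= => _; rewrite ltr_pwDl ?expR_gt0// sumr_ge0// => h _; exact: expR_ge0.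
have /card_gt0P[e _] : (0 < #|cube n|)%N by rewrite card_cube expn_gt0.
by exists e.
Qed.

(** By induction on the dimension.  A point of the half [s] where the sum of
   [exp (- F)] is larger is compared with weights on its own half; from a point of
   the other half a mass [t] is moved across, with [t] from
   [two_point_tradeoff].  For [r] the ratio of the two sums this leaves the factor
   [(3 - r) (1 + r) <= 4]. *)
Theorem cube_hull_ineq n (F : cube n -> R) :
  (\sum_e expR (hull_inf F e)) * (\sum_e expR (- F e)) <= 4 ^+ n.
Proof.
elim: n => [|n IH] in F *.
  rewrite (bigD1 tt)//= big1 ?addr0; last by case.
  rewrite [X in _ * X](bigD1 tt)//= [X in _ * (_ + X)]big1 ?addr0; last by case.
  rewrite -expRD expr0 -[leRHS]expR0 ler_expR subr_le0.
  apply: le_trans (hull_inf_le F tt (weights_dirac tt)) _.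
  rewrite /hull_cost big_ord0 mulr0 addr0 (bigD1 tt)//= big1 ?addr0 ?mul1r//.
pose A b := \sum_e expR (- F (b, e)).
have A0 b : 0 < A b by exact: sum_expR_gt0.
have [s As] : exists s, A (~~ s) <= A s.
  by case: (leP (A false) (A true)) => h; [exists true|exists false; exact: ltW].
pose Q b e := hull_inf (fun h => F (b, h)) e.
have p4 : (0 : R) < 4 ^+ n by rewrite exprn_gt0.
pose l b := ln (4 ^+ n / A b).
have el b : expR (l b) = 4 ^+ n / A b.
  by rewrite lnK// posrE divr_gt0.
have SQ b : \sum_e expR (Q b e) <= expR (l b).
  by rewrite el ler_pdivlMr//; exact: IH.
rewrite (sum_cubeS _ s) [X in _ * X](sum_cubeS _ s) -/(A s) -/(A (~~ s)).
have big : \sum_e expR (hull_inf F (s, e)) <= 4 ^+ n / A s.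
  rewrite -el; apply: le_trans (SQ s); apply: ler_sum => e _; rewrite ler_expR.
  have h01 : 0 <= (0 : R) <= 1 by rewrite lexx ler01.
  have := hull_inf_mix F s e h01.
  by rewrite subr0 mul1r mul0r expr0n mulr0 !addr0.
pose r := A (~~ s) / A s.
have r0 : 0 < r by rewrite divr_gt0.
have r1 : r <= 1 by rewrite ler_pdivrMr// mul1r.
have [t t01 ht] := two_point_tradeoff r0 r1.
have small : \sum_e expR (hull_inf F (~~ s, e)) <= 4 ^+ n / A s * (2 - r).
  have := sum_expR_hoelder t01 (SQ (~~ s)) (SQ s) => hh.
  have le1 : \sum_e expR (hull_inf F (~~ s, e)) <=
      expR (16^-1 * t ^+ 2) * \sum_e expR ((1 - t) * Q (~~ s) e + t * Q s e).
    rewrite mulr_sumr; apply: ler_sum => e _; rewrite -expRD ler_expR addrC.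
    by have := hull_inf_mix F (~~ s) e t01; rewrite negbK.
  apply: (le_trans le1).
  apply: le_trans (ler_wpM2l (expR_ge0 _) hh) _.
  have r2 : 0 < 2 - r by lra.
  rewrite -el -[2 - r]lnK ?posrE// -!expRD ler_expR.
  have -> : l (~~ s) = l s - ln r.
    rewrite /l -ln_div ?posrE ?divr_gt0//; congr ln.
    rewrite /r; field.
    by rewrite !gt_eqF.
  by move: ht; nra.
have -> : A (~~ s) = r * A s by rewrite /r mulfVK// gt_eqF.
have tot := lerD big small.
have pos : 0 <= A s + r * A s by apply: addr_ge0; [|apply: mulr_ge0]; apply: ltW => //; exact: A0.
apply: le_trans (ler_wpM2r pos tot) _.
rewrite (_ : _ * _ = 4 ^+ n * ((3 - r) * (1 + r))); last first.
  by field; rewrite gt_eqF.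
by rewrite exprSr ler_wpM2l//; nra.
Qed.

End cube.

(** * Moments of subgraded functions on the cube *)
Section cube_moments.
Variable R : realType.

Fixpoint cubeN (n : nat) : cube n -> cube n :=
  match n return cube n -> cube n with
  | 0 => fun e => e
  | n'.+1 => fun e => (~~ e.1, cubeN e.2)
  end.

Lemma cubeNK n : involutive (@cubeN n).
Proof. by elim: n => [[]|n IH [b e]]//=; rewrite negbK IH. Qed.

Lemma bit_cubeN n (e : cube n) (i : 'I_n) : bit (cubeN e) i = ~~ bit e i.
Proof.
elim: n => [|n IH] in e i *; first by case: i.
by case: i => -[//|i] /= ilt; exact: (IH e.2 (Ordinal (ilt : (i < n)%N))).
Qed.

Lemma exprD_le (k : nat) (a b : R) : 0 <= a -> 0 <= b ->
  (a + b) ^+ k <= 2 ^+ k * (a ^+ k + b ^+ k).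
Proof.
move=> a0 b0; wlog ab : a b a0 b0 / a <= b.
  move=> H; have [/H|/ltW/H] := leP a b; first exact.
  by rewrite addrC [b ^+ k + _]addrC; exact.
have : (a + b) ^+ k <= (2 * b) ^+ k by rewrite lerXn2r ?nnegrE//; lra.
move=> /le_trans; apply; rewrite exprMn ler_wpM2l ?exprn_ge0//.
by rewrite lerDr exprn_ge0.
Qed.

Lemma expR_geX (k : nat) (x : R) : 0 <= x -> x ^+ k <= k%:R ^+ k * expR x.
Proof.
move=> x0; case: k => [|k]; first by rewrite !expr0 mul1r -expR0 ler_expR.
have k0 : (0 : R) < k.+1%:R by rewrite ltr0n.
have -> : expR x = expR (x / k.+1%:R) ^+ k.+1.
  by rewrite -expRM_natr divfK// gt_eqF.
rewrite -exprMn lerXn2r ?nnegrE ?mulr_ge0 ?expR_ge0//.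
have := expR_ge1Dx (x / k.+1%:R) => h.
apply: (@le_trans _ _ (k.+1%:R * (x / k.+1%:R))).
  by rewrite mulrCA divff ?mulr1// gt_eqF.
by rewrite ler_pM2l//; apply: le_trans h; rewrite lerDr.
Qed.

(** A convex function lies above its tangents, so it exceeds an average by at most
   a gradient times the mean displacement.  Here [w e] stands for the norm of the
   gradient at [e], and the flip masses for the displacement. *)
Definition subgraded n (F w : cube n -> R) : Prop :=
  (forall e, 0 <= w e) /\
  forall (nu : cube n -> R) (e : cube n), weights nu ->
  F e - w e * Num.sqrt (\sum_(i < n) flip_mass nu e i ^+ 2) <=
  \sum_h nu h * F h.

(** The linear term of [subgraded] is absorbed by the quadratic one of
   [hull_cost]: [lam w m <= m^2 / 16 + 4 (lam w)^2]. *)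
Lemma cube_mgf n (F w : cube n -> R) (lam : R) : 0 <= lam -> subgraded F w ->
  \sum_e \sum_h expR (lam * (F e - F h - 4 * lam * w e ^+ 2)) <= 4 ^+ n.
Proof.
move=> l0 [w0 Fw].
apply: le_trans (cube_hull_ineq (fun e => lam * F e)).
rewrite mulr_suml; apply: ler_sum => e _; rewrite mulr_sumr.
apply: ler_sum => h _; rewrite -expRD ler_expR.
have : lam * F e - 4 * (lam * w e) ^+ 2 <= hull_inf (fun e => lam * F e) e.
  apply: le_hull_inf => nu wnu; rewrite /hull_cost.
  under eq_bigr do rewrite mulrCA.
  rewrite -mulr_sumr.
  have := ler_wpM2l l0 (Fw nu e wnu).
  set s := \sum_(i < n) _; set S := \sum_h _.
  have s0 : 0 <= s by rewrite sumr_ge0// => i _; exact: sqr_ge0.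
  have := sqr_ge0 (Num.sqrt s / 4 - 2 * (lam * w e)).
  rewrite -[in X in _ -> _ -> X](sqr_sqrtr s0).
  move: (Num.sqrt s) => m; nra.
lra.
Qed.

(** Only the excess of [s] over [v] is controlled exponentially, so that powers of
   [v], in place of exponentials, enter the bound. *)
Lemma pos_part_moment (k : nat) (lam s v : R) : (0 < k)%N -> 0 < lam -> 0 <= v ->
  Num.max s 0 ^+ k <=
  2 ^+ k * ((k%:R / lam) ^+ k * expR (lam * (s - v)) + v ^+ k).
Proof.
move=> k0 l0 v0; set u := Num.max (s - v) 0.
have u0 : 0 <= u by rewrite le_max lexx orbT.
have m0 : 0 <= Num.max s 0 by rewrite le_max lexx orbT.
have : Num.max s 0 ^+ k <= (u + v) ^+ k.
  rewrite lerXn2r ?nnegrE ?addr_ge0//.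
  rewrite ge_max addr_ge0// andbT -lerBlDr.
  by rewrite le_max lexx.
move=> /le_trans; apply; apply: (le_trans (exprD_le k u0 v0)).
rewrite ler_wpM2l ?exprn_ge0// lerD2r.
rewrite /u; have [sv|sv] := leP (s - v) 0.
  by rewrite expr0n gtn_eqF// mulr_ge0 ?expR_ge0// exprn_ge0// divr_ge0// ltW.
have sv0 : 0 <= lam * (s - v) by rewrite mulr_ge0// ltW.
have := expR_geX k sv0.
rewrite exprMn exprMn exprVn mulrAC ler_pdivlMr ?exprn_gt0//.
by rewrite [X in X <= _]mulrC.
Qed.

Lemma cube_moment n (F w : cube n -> R) (k : nat) (lam : R) :
  (0 < k)%N -> 0 < lam -> subgraded F w ->
  \sum_e \sum_h `|F e - F h| ^+ k <=
  4 ^+ k * ((k%:R / lam) ^+ k * 4 ^+ n +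
            2 ^+ n * \sum_e (4 * lam * w e ^+ 2) ^+ k).
Proof.
move=> k0 l0 Fw; pose p (x : R) := Num.max x 0 ^+ k.
have absE (x : R) : `|x| ^+ k <= p x + p (- x).
  rewrite /p; have [x0|x0] := leP 0 x.
    rewrite ger0_norm// max_r ?oppr_le0// lerDl expr0n.
    by rewrite gtn_eqF.
  rewrite ltr0_norm// max_l; last by rewrite oppr_ge0 ltW.
  by rewrite lerDr expr0n gtn_eqF.
have : \sum_e \sum_h `|F e - F h| ^+ k <= 2 * \sum_e \sum_h p (F e - F h).
  apply: (@le_trans _ _ (\sum_e \sum_h (p (F e - F h) + p (F h - F e)))).
    apply: ler_sum => e _; apply: ler_sum => h _.
    by have := absE (F e - F h); rewrite opprB.
  rewrite (eq_bigr _ (fun e _ => big_split _ _ _ _ _))/= big_split /=.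
  by rewrite [X in _ + X]exchange_big /= mulr2n mulrDl mul1r.
move=> /le_trans; apply.
have pt e h : p (F e - F h) <= 2 ^+ k * ((k%:R / lam) ^+ k *
    expR (lam * (F e - F h - 4 * lam * w e ^+ 2)) + (4 * lam * w e ^+ 2) ^+ k).
  apply: pos_part_moment => //.
  by rewrite mulr_ge0 ?sqr_ge0// mulr_ge0// ltW.
have : \sum_e \sum_h p (F e - F h) <= 2 ^+ k * ((k%:R / lam) ^+ k *
    (\sum_e \sum_h expR (lam * (F e - F h - 4 * lam * w e ^+ 2))) +
    2 ^+ n * \sum_e (4 * lam * w e ^+ 2) ^+ k).
  rewrite mulrDr !mulr_sumr -big_split /=; apply: ler_sum => e _.
  apply: (le_trans (ler_sum _ (fun h _ => pt e h))).
  rewrite -mulr_sumr big_split /= mulrDr sumr_const -mulr_sumr.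
  by rewrite card_cube -[X in _ + _ * X <= _]mulr_natl natrX.
set S := \sum_e \sum_h expR _ => le1.
have SS : S <= 4 ^+ n by apply: cube_mgf => //; exact: ltW.
set T := 2 ^+ n * _ in le1 *.
have T0 : 0 <= T.
  rewrite mulr_ge0 ?exprn_ge0// sumr_ge0// => e _.
  by rewrite exprn_ge0// mulr_ge0 ?sqr_ge0// mulr_ge0// ltW.
have c0 : 0 <= (k%:R / lam) ^+ k by rewrite exprn_ge0// divr_ge0// ltW.
apply: (le_trans (ler_wpM2l _ le1)) => //.
rewrite mulrA ler_pM//.
- rewrite addr_ge0// mulr_ge0// sumr_ge0// => e _.
  by rewrite sumr_ge0// => h _; exact: expR_ge0.
- rewrite (_ : 4 = 2 * 2 :> R); last by ring.
  rewrite exprMn ler_wpM2r ?exprn_ge0//.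
  by rewrite -[leLHS]expr1 ler_eXn2l ?ltr1n.
- by rewrite lerD2r ler_wpM2l.
Qed.

(** The antipode of a point is not independent of it, and a difference of
   subgraded functions is not subgraded: both values of the difference are
   compared with the one at an independent point, where [cube_moment] applies to
   each function. *)
Lemma cube_antipodal_moment n (F1 F2 w : cube n -> R) (k : nat) (lam : R) :
  (0 < k)%N -> 0 < lam -> subgraded F1 w -> subgraded F2 w ->
  \sum_e `|(F1 e - F2 e) - (F1 (cubeN e) - F2 (cubeN e))| ^+ k <=
  64 ^+ k * ((k%:R / lam) ^+ k * 2 ^+ n + \sum_e (4 * lam * w e ^+ 2) ^+ k).
Proof.
move=> k0 l0 F1w F2w; pose g e := F1 e - F2 e.
have le1 e h : `|g e - g (cubeN e)| ^+ k <=
    2 ^+ k * (`|g e - g h| ^+ k + `|g (cubeN e) - g h| ^+ k).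
  apply: le_trans (exprD_le _ _ _) => //.
  rewrite lerXn2r ?nnegrE ?addr_ge0//.
  rewrite (_ : g e - _ = (g e - g h) - (g (cubeN e) - g h)); last by ring.
  exact: ler_normB.
have le2 e h : `|g e - g h| ^+ k <=
    2 ^+ k * (`|F1 e - F1 h| ^+ k + `|F2 e - F2 h| ^+ k).
  apply: le_trans (exprD_le _ _ _) => //.
  rewrite lerXn2r ?nnegrE ?addr_ge0//.
  by rewrite /g (_ : _ - _ = (F1 e - F1 h) - (F2 e - F2 h)) ?ler_normB//; ring.
have p2 : (0 : R) < 2 ^+ n by rewrite exprn_gt0.
rewrite -(ler_pM2l p2).
have -> : 2 ^+ n * (\sum_e `|g e - g (cubeN e)| ^+ k) =
    \sum_e \sum_(h : cube n) `|g e - g (cubeN e)| ^+ k.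
  rewrite mulr_sumr; apply: eq_bigr => e _.
  by rewrite sumr_const card_cube -[RHS]mulr_natl natrX.
apply: (@le_trans _ _ (2 ^+ k * (\sum_e \sum_h `|g e - g h| ^+ k +
    \sum_e \sum_h `|g e - g h| ^+ k))).
  rewrite [X in _ * (_ + X)](reindex_inj (inv_inj (@cubeNK n)))/=.
  rewrite -big_split mulr_sumr; apply: ler_sum => e _.
  by rewrite -big_split mulr_sumr; apply: ler_sum => h _; exact: le1.
set B := (X in _ <= 2 ^+ n * (64 ^+ k * X)).
have B4 : \sum_e \sum_h `|g e - g h| ^+ k <= 2 ^+ k * (2 * (4 ^+ k * (2 ^+ n * B))).
  apply: (@le_trans _ _ (2 ^+ k * (\sum_e \sum_h `|F1 e - F1 h| ^+ k +
      \sum_e \sum_h `|F2 e - F2 h| ^+ k))).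
    rewrite -big_split mulr_sumr; apply: ler_sum => e _.
    by rewrite -big_split mulr_sumr; apply: ler_sum => h _; exact: le2.
  rewrite ler_wpM2l ?exprn_ge0// mulr2n mulrDl mul1r.
  have E : 2 ^+ n * B = (k%:R / lam) ^+ k * 4 ^+ n +
            2 ^+ n * \sum_e (4 * lam * w e ^+ 2) ^+ k.
    rewrite /B mulrDr mulrCA -exprMn; congr (_ * _ ^+ _ + _); ring.
  by rewrite E lerD//; exact: cube_moment.
have B0 : 0 <= 2 ^+ n * B.
  rewrite mulr_ge0 ?exprn_ge0// addr_ge0//.
    by rewrite mulr_ge0 ?exprn_ge0// divr_ge0// ltW.
  rewrite sumr_ge0// => e _.
  by rewrite exprn_ge0// mulr_ge0 ?sqr_ge0// mulr_ge0// ltW.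
apply: (@le_trans _ _ (2 ^+ k * (2 * (2 ^+ k * (2 * (4 ^+ k * (2 ^+ n * B))))))).
  by rewrite ler_wpM2l ?exprn_ge0//; lra.
rewrite [leRHS]mulrCA; move: (2 ^+ n * B) B0 => Y Y0.
have -> : 2 ^+ k * (2 * (2 ^+ k * (2 * (4 ^+ k * Y)))) = 4 * (2 * 2 * 4) ^+ k * Y.
  by rewrite !exprMn; ring.
rewrite ler_wpM2r// (_ : 64 = 4 * (2 * 2 * 4) :> R); last by ring.
by rewrite [leRHS]exprMn ler_wpM2r ?exprn_ge0// -[leLHS]expr1 ler_eXn2l ?ltr1n.
Qed.

End cube_moments.

(** * The Taylor remainder of a power: scalar inequalities *)
Section scalar.
Variable R : realType.
Implicit Types (c r : R) (m d : nat).

Lemma natr1S m : m.+1%:R = m%:R + 1 :> R.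
Proof. by rewrite -natr1. Qed.

(** The secant inequality for [t |-> t^((m+2)/2)] between [c^2] and [r^2], free
   of fractional exponents. *)
Lemma exprB_ge_quadratic c r m : 0 <= c -> 0 <= r ->
  m.+2%:R / 2 * (r ^+ 2 - c ^+ 2) * c ^+ m <= r ^+ m.+2 - c ^+ m.+2.
Proof.
move=> c0 r0; elim: m => [|m IH].
  by rewrite expr0 divff ?mul1r ?mulr1// pnatr_eq0.
have q0 : 0 <= c ^+ m by rewrite exprn_ge0.
have := ler_wpM2l r0 IH.
rewrite ![_ ^+ m.+3]exprS ![_ ^+ m.+2]exprS ![_ ^+ m.+1]exprS => {}IH.
have m0 : (1 : R) <= m.+2%:R by rewrite ler1n.
move: IH; rewrite [m.+3%:R]natr1S.
move: (c ^+ m) (r ^+ m) (m.+2%:R : R) q0 m0 => q s M q0 M0 IH.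
have : 0 <= (r - c) ^+ 2 * (M * (r + c) - c) * q.
  by rewrite mulr_ge0// mulr_ge0 ?sqr_ge0//; nra.
lra.
Qed.

(** Equivalently, [r^(2D) - c^(2D)] exceeds [2 D (r - c) c^(2D-1)] by at most
   [2 (r^D - c^D)^2], for [D = d + 1]. *)
Lemma exprB_sqr_ge c r d : 0 <= c -> c <= r ->
  2 * c ^+ d.+1 * (r ^+ d.+1 - c ^+ d.+1) <=
  (r ^+ d.+1 - c ^+ d.+1) ^+ 2 + 2 * d.+1%:R * (r - c) * c ^+ d * c ^+ d.+1.
Proof.
move=> c0 cr; elim: d => [|d IH].
  by rewrite expr0 !expr1; have := sqr_ge0 (r - c); lra.
have q0 : 0 <= c ^+ d.+1 by rewrite exprn_ge0.
have s0 : c ^+ d.+1 <= r ^+ d.+1.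
  by rewrite lerXn2r ?nnegrE// (le_trans c0).
have c20 : 0 <= c ^+ 2 by exact: sqr_ge0.
have := ler_wpM2l c20 IH.
have -> : c ^+ 2 * ((r ^+ d.+1 - c ^+ d.+1) ^+ 2 +
    2 * d.+1%:R * (r - c) * c ^+ d * c ^+ d.+1) =
  c ^+ 2 * (r ^+ d.+1 - c ^+ d.+1) ^+ 2 +
    2 * d.+1%:R * (r - c) * c * (c ^+ d.+1) ^+ 2 by rewrite [c ^+ d.+1]exprS; ring.
rewrite ![_ ^+ d.+2]exprS [d.+2%:R]natr1S.
move: (c ^+ d.+1) (r ^+ d.+1) (d.+1%:R : R) q0 s0 => q s M q0 s0.
rewrite -subr_ge0 => {}IH.
rewrite -subr_ge0.
have : 0 <= 2 * c * (s - q) ^+ 2 * (r - c) + ((r - c) * s) ^+ 2.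
  by rewrite addr_ge0 ?sqr_ge0// mulr_ge0 ?subr_ge0// mulr_ge0 ?sqr_ge0// mulr_ge0.
move: IH => /addr_ge0 /[apply]; congr (0 <= _); ring.
Qed.

(** If [g >= 0] is convex with a zero at [1] and [g'' <= B], then
   [g'^2 <= 2 B g].  Here [g] is the Bregman divergence of [c^(m+2)] at [1], and
   [c^m] measures its second derivative when [1 <= c]. *)
Lemma bregman_power_ge1 c m : 1 <= c ->
  (c ^+ m.+1 - 1) ^+ 2 <= 2 * c ^+ m * (c ^+ m.+2 - m.+2%:R * c + m.+1%:R).
Proof.
move=> c1; have c0 : 0 <= c by rewrite (le_trans ler01).
have aux j : c * (c ^+ j - 1) <= j%:R * (c - 1) * c ^+ j.
  elim: j => [|j IH]; first by rewrite expr0 subrr mulr0 mul0r mul0r.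
  have := ler_wpM2l c0 IH.
  have q1 : 1 <= c ^+ j by rewrite exprn_ege1.
  rewrite exprS natr1S; move: (c ^+ j) (j%:R : R) q1 => q J q1 h.
  have : 0 <= c * (c - 1) * (q - 1) by rewrite mulr_ge0 ?mulr_ge0 ?subr_ge0.
  lra.
elim: m => [|m IH].
  by rewrite expr0 expr1; have := sqr_ge0 (c - 1); nra.
have c20 : 0 <= c ^+ 2 by exact: sqr_ge0.
have := ler_wpM2l c20 IH.
have := aux m.+1.
have q1 : 1 <= c ^+ m.+1 by rewrite exprn_ege1.
have -> : c ^+ 2 * (2 * c ^+ m * (c ^+ m.+2 - m.+2%:R * c + m.+1%:R)) =
   2 * c * c ^+ m.+1 * (c * c ^+ m.+1 - (m.+1%:R + 1) * c + m.+1%:R).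
  rewrite [m.+2%:R]natr1S [c ^+ m.+2]exprS [c ^+ m.+1]exprS; ring.
rewrite ![m.+3%:R]natr1S ![m.+2%:R]natr1S ![_ ^+ m.+3]exprS ![_ ^+ m.+2]exprS.
move: (c ^+ m.+1) (m.+1%:R : R) q1 => q M q1 A {}IH.
have h0 : 0 <= c - 1 by lra.
have := ler_wpM2r h0 A.
have : 0 <= (c - 1) ^+ 2 * (q - 1) by rewrite mulr_ge0 ?sqr_ge0//; lra.
nra.
Qed.

Lemma bregman_power_le1 c m : 0 <= c -> c <= 1 ->
  (1 - c ^+ m.+1) ^+ 2 <= 2 * (c ^+ m.+2 - m.+2%:R * c + m.+1%:R).
Proof.
move=> c0 c1.
have aux j : 1 - c ^+ j <= j%:R * (1 - c).
  elim: j => [|j IH]; first by rewrite expr0 subrr mul0r.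
  have q1 : c ^+ j <= 1 by rewrite exprn_ile1.
  rewrite exprS natr1S; move: (c ^+ j) q1 IH => q q1 h; nra.
elim: m => [|m IH].
  by rewrite expr1; have := sqr_ge0 (c - 1); nra.
have q0 : 0 <= c ^+ m.+1 by rewrite exprn_ge0.
have q1 : c ^+ m.+1 <= 1 by rewrite exprn_ile1.
have := aux m.+1; move: IH.
rewrite ![m.+3%:R]natr1S ![m.+2%:R]natr1S ![_ ^+ m.+3]exprS ![_ ^+ m.+2]exprS.
have M0 : (0 : R) <= m.+1%:R by rewrite ler0n.
move: (c ^+ m.+1) (m.+1%:R : R) q0 q1 M0 => q M q0 q1 M0 IH A.
have b0 := le_trans (sqr_ge0 _) IH.
have h0 : 0 <= 2 * c * (1 - c) by nra.
have h1 := ler_wpM2l h0 A.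
have h2 : 0 <= (1 - c) * c by nra.
have h3 := ler_wpM2l h2 (sqr_ge0 (1 - q)).
have h4 : 0 <= M * (1 - c) ^+ 3 by rewrite mulr_ge0// exprn_ge0; lra.
have h5 := ler_wpM2l c0 IH.
have h6 := sqr_ge0 (1 - c).
have h7 : 0 <= M * (1 - c) ^+ 2 by rewrite mulr_ge0.
nra.
Qed.

Lemma exprB_ge_linear (a b : R) d : 0 <= a -> a <= b ->
  d.+1%:R * (b - a) * a ^+ d <= b ^+ d.+1 - a ^+ d.+1.
Proof.
move=> a0 ab; elim: d => [|d IH]; first by rewrite expr0 !expr1 mulr1 mul1r.
have b0 : 0 <= b by exact: le_trans ab.
have := ler_wpM2l b0 IH.
have q0 : 0 <= a ^+ d by rewrite exprn_ge0.
rewrite [d.+2%:R]natr1S ![_ ^+ d.+2]exprS [a ^+ d.+1]exprS.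
have M0 : (0 : R) <= d.+1%:R by rewrite ler0n.
move: (a ^+ d) (b ^+ d.+1) (d.+1%:R : R) q0 M0 => q s M q0 M0 h.
have : 0 <= M * (b - a) ^+ 2 * q by rewrite mulr_ge0// mulr_ge0// sqr_ge0.
nra.
Qed.

(** The left-hand side is the squared norm of the second-order Taylor remainder of
   [x |-> x^(x)d] between a unit vector and a vector of norm [r] whose inner
   product with it is [c]; the square on the right is the one of the remainder
   of [x |-> |x|^d].  With [b = c^d - d c + d - 1], [dl = r^2 - c^2] and
   [U = r^d - c^d] the remainder on the right is [b + U], and the left-hand side
   splits orthogonally into [b^2], [d dl (c^(d-1) - 1)^2] and
   [T = r^(2d) - c^(2d) - d dl c^(2d-2)].  For [0 <= c] one has [T <= 2 U^2], and
   the middle term is at most [4 b (b + U)] by the Bregman inequalities; for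
   [c < 0] one has [b + U >= 1] and rough bounds are enough. *)
Lemma taylor_remainder_unit d c r : (0 < d)%N -> `|c| <= r ->
  (r ^+ d) ^+ 2 + (d%:R - 1) ^+ 2 + d%:R * r ^+ 2 + d%:R * (d%:R - 1) * c ^+ 2 +
  2 * (d%:R - 1) * c ^+ d - 2 * d%:R * r ^+ 2 * c ^+ d.-1
  - 2 * d%:R * (d%:R - 1) * c
  <= 9 * (r ^+ d + d%:R - 1 - d%:R * c) ^+ 2.
Proof.
case: d => [//|[_|m _]] cr.
  rewrite !expr1 expr0 /= [leLHS](_ : _ = 0); last by ring.
  by rewrite mulr_ge0 ?sqr_ge0.
have r0 : 0 <= r by exact: le_trans (normr_ge0 _) cr.
set D : R := m.+2%:R.
have D2 : 2 <= D by rewrite /D ler_nat.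
have dl0 : 0 <= r ^+ 2 - c ^+ 2.
  rewrite subr_ge0 -(real_normK (num_real c)).
  by rewrite lerXn2r ?nnegrE.
pose dl := r ^+ 2 - c ^+ 2.
pose b := c ^+ m.+2 - D * c + (D - 1).
pose U := r ^+ m.+2 - c ^+ m.+2.
pose T := (r ^+ m.+2) ^+ 2 - (c ^+ m.+2) ^+ 2 - D * dl * (c ^+ m.+1) ^+ 2.
have -> : r ^+ m.+2 + D - 1 - D * c = b + U by rewrite /b /U; ring.
rewrite [leLHS](_ : _ = b ^+ 2 + D * dl * (c ^+ m.+1 - 1) ^+ 2 + T); last first.
  rewrite /b /T /dl /=; rewrite [c ^+ m.+2]exprS; ring.
have h1 : D * dl <= 2 * (b + U).
  have := @exprB_ge_quadratic 1 r m ler01 r0.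
  rewrite !expr1n mulr1 -/D => h.
  rewrite /b /U /dl.
  have := sqr_ge0 (c - 1); nra.
have Db : D - 1 = m.+1%:R by rewrite /D natr1S; ring.
have [c0|c0] := leP 0 c; last first.
  have rd0 : 0 <= r ^+ m.+2 by rewrite exprn_ge0.
  have cd : `|c ^+ m.+2| <= r ^+ m.+2 by rewrite normrX lerXn2r ?nnegrE.
  have T0 : 0 <= T.
    have := @exprB_ge_linear (c ^+ 2) (r ^+ 2) m.+1 (sqr_ge0 _).
    rewrite -subr_ge0 => /(_ dl0).
    rewrite -/D -/dl -!exprM ![(2 * _)%N]mulnC !exprM.
    by rewrite /T; lra.
  move: cd; rewrite ler_norml => /andP[cd1 cd2].
  have B1 : 1 <= b + U by rewrite /b /U; nra.
  have Br : r ^+ m.+2 <= b + U by rewrite /b /U; nra.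
  have bB : b ^+ 2 <= (b + U) ^+ 2.
    rewrite -ler_sqrt ?sqr_ge0// !sqrtr_sqr [X in _ <= X]ger0_norm; last by lra.
    by rewrite ler_norml /b /U; nra.
  have rB : (r ^+ m.+2) ^+ 2 <= (b + U) ^+ 2 by rewrite lerXn2r ?nnegrE//; lra.
  have TD : T + D * dl * (c ^+ m.+1) ^+ 2 <= (b + U) ^+ 2.
    apply: le_trans rB; rewrite /T subrK lerBlDr lerDl; exact: sqr_ge0.
  have h2 : D * dl * (c ^+ m.+1 - 1) ^+ 2 <=
      2 * (D * dl * (c ^+ m.+1) ^+ 2) + 2 * (D * dl).
    have : 0 <= D * dl * (c ^+ m.+1 + 1) ^+ 2.
      by rewrite mulr_ge0 ?sqr_ge0// mulr_ge0//; lra.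
    move: (c ^+ m.+1) => q; nra.
  have h3 : b + U <= (b + U) ^+ 2 by nra.
  move: (D * dl * (c ^+ m.+1) ^+ 2) TD h2 => y TD h2.
  nra.
have cr' : c <= r by rewrite (le_trans (ler_norm _)).
have U0 : 0 <= U by rewrite subr_ge0 lerXn2r ?nnegrE.
have TU : T <= 2 * U ^+ 2.
  have := @exprB_sqr_ge c r m.+1 c0 cr'.
  have : 0 <= D * (r - c) ^+ 2 * (c ^+ m.+1) ^+ 2.
    by rewrite mulr_ge0 ?sqr_ge0// mulr_ge0 ?sqr_ge0//; lra.
  rewrite /T /U /dl -/D [c ^+ m.+2]exprS.
  move: (c ^+ m.+1) (r ^+ m.+2) => q s; nra.
have [c1|c1] := leP 1 c.
  have h2 := bregman_power_ge1 m c1.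
  have h3 := exprB_ge_quadratic m c0 r0.
  rewrite -/D -/dl -/U in h3; rewrite -/D -Db -/b in h2.
  have b0 : 0 <= b.
    have q0 : 0 < 2 * c ^+ m by rewrite mulr_gt0// exprn_gt0// (lt_le_trans ltr01).
    by rewrite -(pmulr_rge0 _ q0) (le_trans (sqr_ge0 _) h2).
  have d0 : 0 <= D * dl by rewrite mulr_ge0//; lra.
  have h4 := ler_wpM2l d0 h2.
  have h5 := ler_wpM2r b0 h3.
  have h6 : D * dl * (c ^+ m.+1 - 1) ^+ 2 <= 4 * (U * b) by lra.
  nra.
have h2 := bregman_power_le1 m c0 (ltW c1).
rewrite -/D -Db -/b in h2.
have b0 : 0 <= b by have := le_trans (sqr_ge0 _) h2; lra.
have h3 : D * dl * (c ^+ m.+1 - 1) ^+ 2 <= 2 * (b + U) * (2 * b).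
  rewrite ler_pM ?sqr_ge0//; first by rewrite mulr_ge0//; lra.
  by rewrite -[X in X ^+ 2]opprB sqrrN.
nra.
Qed.

End scalar.

(** * Inner products of tensor powers *)
Section finite_sums.
Variable R : realType.

Lemma sum_cauchy_schwarz (I : finType) (u v : I -> R) :
  \sum_i u i * v i <=
  Num.sqrt (\sum_i u i ^+ 2) * Num.sqrt (\sum_i v i ^+ 2).
Proof.
set A := \sum_i u i ^+ 2; set B := \sum_i v i ^+ 2.
have ge0 (w : I -> R) : 0 <= \sum_i w i ^+ 2.
  by rewrite sumr_ge0// => i _; exact: sqr_ge0.
have zero (w : I -> R) : \sum_i w i ^+ 2 = 0 -> forall i, w i = 0.
  move=> /eqP; rewrite psumr_eq0 => [/allP h i|i _]; last exact: sqr_ge0.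
  by have := h i; rewrite mem_index_enum sqrf_eq0 => /(_ isT)/eqP.
have [/zero u0|A0] := eqVneq A 0.
  by rewrite big1 ?mulr_ge0// => i _; rewrite u0 mul0r.
have [/zero v0|B0] := eqVneq B 0.
  by rewrite big1 ?mulr_ge0// => i _; rewrite v0 mulr0.
pose a := Num.sqrt A; pose b := Num.sqrt B.
have a0 : 0 < a by rewrite sqrtr_gt0 lt_neqAle eq_sym A0 ge0.
have b0 : 0 < b by rewrite sqrtr_gt0 lt_neqAle eq_sym B0 ge0.
have := ge0 (fun i => b * u i - a * v i).
have -> : \sum_i (b * u i - a * v i) ^+ 2 =
    b ^+ 2 * A - 2 * (a * b) * (\sum_i u i * v i) + a ^+ 2 * B.
  rewrite !mulr_sumr -sumrB -big_split; apply: eq_bigr => i _ /=; ring.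
rewrite /a /b !sqr_sqrtr ?ge0// -/a -/b => h.
have e : A * B = (a * b) ^+ 2 by rewrite exprMn !sqr_sqrtr ?ge0.
have ab : 0 < a * b by rewrite mulr_gt0.
rewrite -(ler_pM2l ab) -/a -/b.
by rewrite -expr2 -e; lra.
Qed.

End finite_sums.

Definition dotr (R : realType) n (x y : 'rV[R]_n) : R :=
  \sum_(k < n) x ord0 k * y ord0 k.

Definition normv (R : realType) n (x : 'rV[R]_n) : R := Num.sqrt (dotr x x).

(** The derivative of [x |-> x^(x)d] at [x] in the direction [h]. *)
Definition tensor_deriv (R : realType) n d (x h : 'rV[R]_n) : tensor_space R n d :=
  \sum_(j < d) tensor_pure (fun l => if l == j then h else x).

Section vectors.
Variables (R : realType) (n : nat).
Implicit Types x y h : 'rV[R]_n.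

Lemma dotrC x y : dotr x y = dotr y x.
Proof. by apply: eq_bigr => k _; rewrite mulrC. Qed.

Lemma dotrDr x y h : dotr x (y + h) = dotr x y + dotr x h.
Proof. by rewrite -big_split; apply: eq_bigr => k _; rewrite mxE mulrDr. Qed.

Lemma dotrZr a x y : dotr x (a *: y) = a * dotr x y.
Proof. by rewrite mulr_sumr; apply: eq_bigr => k _; rewrite mxE mulrCA. Qed.

Lemma dotrBr x y h : dotr x (y - h) = dotr x y - dotr x h.
Proof. by rewrite dotrDr -scaleN1r dotrZr mulN1r. Qed.

Lemma dotr_ge0 x : 0 <= dotr x x.
Proof. by rewrite sumr_ge0// => k _; rewrite -expr2 sqr_ge0. Qed.

Lemma normv_ge0 x : 0 <= normv x. Proof. exact: sqrtr_ge0. Qed.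

Lemma sqr_normv x : normv x ^+ 2 = dotr x x.
Proof. by rewrite sqr_sqrtr// dotr_ge0. Qed.

Lemma normvE x : normv x = Num.sqrt (\sum_k x ord0 k ^+ 2).
Proof. by congr Num.sqrt; apply: eq_bigr => k _; rewrite expr2. Qed.

Lemma dotr_le x y : dotr x y <= normv x * normv y.
Proof. by rewrite !normvE; exact: sum_cauchy_schwarz. Qed.

Lemma normr_dotr_le x y : `|dotr x y| <= normv x * normv y.
Proof.
rewrite ler_norml dotr_le andbT lerNl -mulN1r -dotrZr.
apply: le_trans (dotr_le _ _) _; rewrite ler_wpM2l ?normv_ge0//.
by rewrite /normv dotrZr dotrC dotrZr !mulN1r opprK.
Qed.

End vectors.

Section tensors.
Variables (R : realType) (n d : nat).
Implicit Types u v w : tensor_space R n d.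
Implicit Types x y h : 'rV[R]_n.

Lemma tensor_dotC u v : tensor_dot u v = tensor_dot v u.
Proof. by apply: eq_bigr => k _; rewrite mulrC. Qed.

Lemma tensor_dotDr u v w : tensor_dot u (v + w) = tensor_dot u v + tensor_dot u w.
Proof. by rewrite -big_split; apply: eq_bigr => k _; rewrite ffunE mulrDr. Qed.

Lemma tensor_dotZr a u v : tensor_dot u (a *: v) = a * tensor_dot u v.
Proof. by rewrite mulr_sumr; apply: eq_bigr => k _; rewrite ffunE mulrCA. Qed.

Lemma tensor_dot0r u : tensor_dot u 0 = 0.
Proof. by rewrite -(scale0r 0) tensor_dotZr mul0r. Qed.

Lemma tensor_dotBr u v w : tensor_dot u (v - w) = tensor_dot u v - tensor_dot u w.
Proof. by rewrite tensor_dotDr -scaleN1r tensor_dotZr mulN1r. Qed.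

Lemma tensor_dotDl u v w : tensor_dot (v + w) u = tensor_dot v u + tensor_dot w u.
Proof. by rewrite tensor_dotC tensor_dotDr !(tensor_dotC u). Qed.

Lemma tensor_dotBl u v w : tensor_dot (v - w) u = tensor_dot v u - tensor_dot w u.
Proof. by rewrite tensor_dotC tensor_dotBr !(tensor_dotC u). Qed.

Lemma tensor_dotZl a u v : tensor_dot (a *: v) u = a * tensor_dot v u.
Proof. by rewrite tensor_dotC tensor_dotZr (tensor_dotC u). Qed.

Lemma tensor_dot_sumr (I : finType) u (F : I -> tensor_space R n d) :
  tensor_dot u (\sum_i F i) = \sum_i tensor_dot u (F i).
Proof.
elim/big_ind2 : _ => [|a b c e <- <-|//]; first exact: tensor_dot0r.
by rewrite tensor_dotDr.
Qed.

Lemma tensor_dot_ge0 u : 0 <= tensor_dot u u.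
Proof. by rewrite sumr_ge0// => k _; rewrite -expr2 sqr_ge0. Qed.

Lemma tensor_norm_ge0 u : 0 <= tensor_norm u.
Proof. exact: sqrtr_ge0. Qed.

Lemma sqr_tensor_norm u : tensor_norm u ^+ 2 = tensor_dot u u.
Proof. by rewrite sqr_sqrtr// tensor_dot_ge0. Qed.

Lemma tensor_dot_le u v : tensor_dot u v <= tensor_norm u * tensor_norm v.
Proof.
apply: le_trans (sum_cauchy_schwarz u v) _.
have E w : Num.sqrt (\sum_i w i ^+ 2) = tensor_norm w.
  by congr Num.sqrt; apply: eq_bigr => i _; rewrite expr2.
by rewrite !E.
Qed.

Lemma ler_tensor_normD u v : tensor_norm (u + v) <= tensor_norm u + tensor_norm v.
Proof.
rewrite -(@ler_pXn2r _ 2) ?nnegrE ?addr_ge0 ?tensor_norm_ge0//.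
rewrite sqr_tensor_norm sqrrD !sqr_tensor_norm tensor_dotDr !tensor_dotDl.
by rewrite (tensor_dotC v u); have := tensor_dot_le u v; lra.
Qed.

Lemma tensor_normZ a u : 0 <= a -> tensor_norm (a *: u) = a * tensor_norm u.
Proof.
move=> a0; rewrite /tensor_norm tensor_dotZl tensor_dotZr mulrA.
by rewrite sqrtrM ?mulr_ge0// -expr2 sqrtr_sqr ger0_norm.
Qed.

Lemma tensor_normN u : tensor_norm (- u) = tensor_norm u.
Proof.
by rewrite /tensor_norm -scaleN1r tensor_dotZl tensor_dotZr !mulN1r opprK.
Qed.

Lemma tensor_norm0 : tensor_norm (0 : tensor_space R n d) = 0.
Proof. by rewrite /tensor_norm tensor_dot0r sqrtr0. Qed.

Lemma ler_tensor_norm_sum (I : finType) (nu : I -> R)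
    (F : I -> tensor_space R n d) : (forall i, 0 <= nu i) ->
  tensor_norm (\sum_i nu i *: F i) <= \sum_i nu i * tensor_norm (F i).
Proof.
move=> nu0; elim/big_ind2 : _ => [|a b c e ab ce|i _].
- by rewrite tensor_norm0.
- by apply: le_trans (ler_tensor_normD _ _) _; exact: lerD.
- by rewrite tensor_normZ.
Qed.

Lemma tensor_dot_power x y :
  tensor_dot (tensor_power d x) (tensor_power d y) = dotr x y ^+ d.
Proof. by rewrite tensor_dot_pure prodr_const card_ord. Qed.

Lemma tensor_dot_power_deriv x y h :
  tensor_dot (tensor_power d y) (tensor_deriv d x h) =
  d%:R * dotr y h * dotr y x ^+ d.-1.
Proof.
rewrite tensor_dot_sumr -[X in X%:R]card_ord -mulrA mulr_natl -sumr_const.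
apply: eq_bigr => j _; rewrite tensor_dot_pure (bigD1 j)//= eqxx; congr (_ * _).
rewrite (eq_bigr (fun=> dotr y x)); last by move=> i /negbTE ->.
by rewrite prodr_const cardC1 card_ord.
Qed.

(** Distinct summands of [tensor_deriv] overlap through [dotr x h] only: a
   direction orthogonal to [x] contributes [d], the direction of [x] contributes
   [d^2]. *)
Lemma tensor_dot_deriv x h :
  tensor_dot (tensor_deriv d x h) (tensor_deriv d x h) =
  d%:R * dotr h h * dotr x x ^+ d.-1 +
  d%:R * (d%:R - 1) * dotr x h ^+ 2 * dotr x x ^+ d.-2.
Proof.
pose t (j : 'I_d) := tensor_pure (fun l => if l == j then h else x).
have E i : tensor_dot (t i) (tensor_deriv d x h) =
    dotr h h * dotr x x ^+ d.-1 +
    (d%:R - 1) * (dotr x h ^+ 2 * dotr x x ^+ d.-2).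
  rewrite tensor_dot_sumr (bigD1 i)//=; congr (_ + _).
    rewrite tensor_dot_pure (bigD1 i)//= eqxx; congr (_ * _).
    rewrite (eq_bigr (fun=> dotr x x)); last by move=> l /negbTE ->.
    by rewrite prodr_const cardC1 card_ord.
  rewrite (eq_bigr (fun=> dotr x h ^+ 2 * dotr x x ^+ d.-2)); last first.
    move=> j ji; rewrite tensor_dot_pure (bigD1 i)//= eqxx eq_sym (negbTE ji).
    rewrite (bigD1 j)//= eqxx (negbTE ji) mulrA.
    congr (_ * _); first by rewrite -/(dotr h x) -/(dotr x h) dotrC expr2.
    rewrite (eq_bigr (fun=> dotr x x)); last by move=> l /andP[/negbTE -> /negbTE ->].
    rewrite prodr_const; congr (_ ^+ _).
    have -> : #|[pred l | (l != i) && (l != j)]| = #|[predC pred2 i j]|.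
      by apply: eq_card => l; rewrite !inE negb_or.
    have := cardC (pred2 i j); rewrite card2 eq_sym ji card_ord.
    by move=> /(congr1 (fun k => k.-2)).
  have d0 : (0 < d)%N by apply: leq_ltn_trans (ltn_ord i).
  rewrite sumr_const cardC1 card_ord -[LHS]mulr_natl; congr (_ * _).
  by rewrite -[in RHS](prednK d0) -natr1 addrK.
rewrite {1}/tensor_deriv tensor_dotC tensor_dot_sumr.
under eq_bigr do rewrite tensor_dotC E.
rewrite sumr_const card_ord -mulr_natl; ring.
Qed.

Lemma tensor_deriv_linear x (I : finType) (nu : I -> R) (h : I -> 'rV[R]_n) :
  \sum_i nu i *: tensor_deriv d x (h i) = tensor_deriv d x (\sum_i nu i *: h i).
Proof.
rewrite /tensor_deriv.
under eq_bigr do rewrite scaler_sumr.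
rewrite exchange_big /=; apply: eq_bigr => j _.
apply/ffunP => k; rewrite sum_ffunE !ffunE (bigD1 j)//= eqxx summxE mulr_suml.
apply: eq_bigr => i _; rewrite !ffunE (bigD1 j)//= eqxx mxE.
rewrite /GRing.scale /= mulrA; congr (_ * _).
by apply: eq_bigr => l /negbTE ->.
Qed.

Lemma tensor_derivB x y h :
  tensor_deriv d x (y - h) = tensor_deriv d x y - tensor_deriv d x h.
Proof.
have := tensor_deriv_linear x (fun b : bool => if b then 1 else -1 : R)
  (fun b => if b then y else h).
by rewrite !big_bool /= !scale1r !scaleN1r => <-.
Qed.

Lemma tensor_deriv_self x : tensor_deriv d x x = d%:R *: tensor_power d x.
Proof.
rewrite /tensor_deriv (eq_bigr (fun=> tensor_power d x)); last first.
  by move=> j _; apply/ffunP => k; rewrite !ffunE; apply: eq_bigr => l _; rewrite if_same.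
by rewrite sumr_const card_ord scaler_nat.
Qed.

(** The second-order remainder of [x |-> x^(x)d] at [x]. *)
Definition tensor_taylor2 x y : tensor_space R n d :=
  tensor_power d y - tensor_power d x - tensor_deriv d x (y - x).

Lemma tensor_dot_taylor2 x y :
  tensor_dot (tensor_taylor2 x y) (tensor_taylor2 x y) =
  dotr y y ^+ d + (d%:R - 1) ^+ 2 * dotr x x ^+ d +
  d%:R * dotr y y * dotr x x ^+ d.-1 +
  d%:R * (d%:R - 1) * dotr x y ^+ 2 * dotr x x ^+ d.-2 +
  2 * (d%:R - 1) * dotr x y ^+ d - 2 * d%:R * dotr y y * dotr x y ^+ d.-1
  - 2 * d%:R * (d%:R - 1) * dotr x y * dotr x x ^+ d.-1.
Proof.
have -> : tensor_taylor2 x y =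
    tensor_power d y + (d%:R - 1) *: tensor_power d x - tensor_deriv d x y.
  rewrite /tensor_taylor2 tensor_derivB tensor_deriv_self scalerBl scale1r.
  rewrite opprB addrA; congr (_ - _).
  by rewrite -addrA; congr (_ + _); rewrite addrC.
rewrite tensor_dotBr !tensor_dotBl !tensor_dotDr !tensor_dotDl.
rewrite !(tensor_dotZl, tensor_dotZr) !(tensor_dotC (tensor_deriv d x y)).
rewrite tensor_dot_deriv !tensor_dot_power_deriv !tensor_dot_power !(dotrC y x).
ring.
Qed.

End tensors.

(** * The Taylor remainder of the tensor power *)
Lemma expr_bernoulli (R : realType) (r : R) d : 0 <= r ->
  d%:R * (r - 1) <= r ^+ d - 1.
Proof.
move=> r0; elim: d => [|d IH]; first by rewrite expr0 subrr mul0r.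
have := ler_wpM2l r0 IH; rewrite exprS natr1S.
have : 0 <= (d%:R : R) * (r - 1) ^+ 2 by rewrite mulr_ge0 ?sqr_ge0.
nra.
Qed.

Section taylor.
Variables (R : realType) (n d : nat).
Implicit Types x y h : 'rV[R]_n.

(** The gradient of [x |-> |x|^d] is [norm_slope x *: x]; with the convention
   [a / 0 = 0] the formula is also a subgradient at the origin. *)
Definition norm_slope x : R := d%:R * normv x ^+ d.-1 / normv x.

(** By homogeneity it is enough to take [|x| = 1].  Both sides then depend on
   [|y|] and on the inner product only, and the claim is
   [taylor_remainder_unit]. *)
Lemma tensor_taylor2_le x y : (0 < d)%N ->
  tensor_norm (tensor_taylor2 d x y) <=
  3 * (normv y ^+ d - normv x ^+ d - norm_slope x * dotr x (y - x)).
Proof.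
move=> d0; rewrite /norm_slope dotrBr.
set a := normv x; set c := dotr x y.
have a0 : 0 <= a by exact: normv_ge0.
have Cs : `|c| <= a * normv y by exact: normr_dotr_le.
have N2 := tensor_dot_taylor2 d x y.
rewrite -/c -!(sqr_normv x) -!(sqr_normv y) -/a in N2 *.
suff [B0 B2] : 0 <= normv y ^+ d - a ^+ d - d%:R * a ^+ d.-1 / a * (c - a ^+ 2) /\
    tensor_dot (tensor_taylor2 d x y) (tensor_taylor2 d x y) <=
    9 * (normv y ^+ d - a ^+ d - d%:R * a ^+ d.-1 / a * (c - a ^+ 2)) ^+ 2.
  rewrite -(@ler_pXn2r _ 2) ?nnegrE ?tensor_norm_ge0//; last by rewrite mulr_ge0.
  by rewrite sqr_tensor_norm exprMn (_ : 3 ^+ 2 = 9 :> R)//; ring.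
rewrite {}N2.
have [az|an0] := eqVneq a 0.
  move: Cs; rewrite az mul0r normr_le0 => /eqP c0.
  rewrite c0 invr0 mulr0 mul0r subr0 !expr0n /= (gtn_eqF d0) /= subr0.
  split; first by rewrite exprn_ge0// normv_ge0.
  case: d d0 => [//|[|m]] _ /=.
    by rewrite !expr1; have := sqr_ge0 (normv y); nra.
  rewrite (exprAC _ 2 m.+2); have := sqr_ge0 (normv y ^+ m.+2).
  by move: (normv y ^+ m.+2) => z; nra.
have ap : 0 < a by rewrite lt_neqAle eq_sym an0.
pose r := normv y / a; pose c1 := c / a ^+ 2.
have yr : normv y = a * r by rewrite /r mulrCA divff ?mulr1.
have cc : c = a ^+ 2 * c1 by rewrite /c1 mulrCA divff ?mulr1// expf_neq0.
have c1r : `|c1| <= r.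
  rewrite /c1 /r normrM normfV (ger0_norm (sqr_ge0 a)) ler_pdivrMr ?exprn_gt0//.
  by rewrite expr2 mulrA divfK// mulrC.
have fac : normv y ^+ d - a ^+ d - d%:R * a ^+ d.-1 / a * (c - a ^+ 2) =
    a ^+ d * (r ^+ d + d%:R - 1 - d%:R * c1).
  rewrite yr cc exprMn; case: d d0 => // m _ /=.
  by rewrite exprS; field.
rewrite fac; split.
  rewrite mulr_ge0 ?exprn_ge0//.
  have := expr_bernoulli d (le_trans (normr_ge0 _) c1r).
  have := le_trans (ler_norm _) c1r.
  have : (0 : R) <= d%:R by rewrite ler0n.
  nra.
have := ler_wpM2l (sqr_ge0 (a ^+ d)) (taylor_remainder_unit d0 c1r).
have -> : a ^+ d ^+ 2 * (9 * (r ^+ d + d%:R - 1 - d%:R * c1) ^+ 2) =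
  9 * (a ^+ d * (r ^+ d + d%:R - 1 - d%:R * c1)) ^+ 2 by ring.
apply: le_trans; rewrite le_eqVlt; apply/orP; left; apply/eqP.
rewrite cc yr; case: d d0 => [//|[|m]] _ /=.
  by rewrite !expr1 !expr0; ring.
rewrite !(exprS, expr0, mulr1, exprMn); ring.
Qed.
End taylor.

(** * Convex functions of tensor powers *)
Section jensen.
Variables (R : realType) (E : lmodType R).

Lemma convex_functionP (f : E -> R) (t : R) (x y : E) :
  @convex_function R E setT f -> 0 <= t <= 1 ->
  f (t *: x + (1 - t) *: y) <= t * f x + (1 - t) * f y.
Proof. by move=> cf /andP[t0 t1]; apply: (cf (Itv01 t0 t1)); rewrite inE. Qed.

(** The first weight is positive, so that no partial total vanishes. *)
Lemma jensen_seq (I : Type) (s : seq I) (nu : I -> R) (F : I -> E) (f : E -> R)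
    (w0 : R) (y : E) :
  @convex_function R E setT f -> (forall i, 0 <= nu i) -> 0 < w0 ->
  (w0 + \sum_(i <- s) nu i) *
    f ((w0 + \sum_(i <- s) nu i)^-1 *: (w0 *: y + \sum_(i <- s) nu i *: F i)) <=
  w0 * f y + \sum_(i <- s) nu i * f (F i).
Proof.
move=> cf nu0; elim: s w0 y => [|i s IH] w0 y w00.
  by rewrite !big_nil !addr0 scalerA mulVf ?gt_eqF// scale1r.
rewrite !big_cons !addrA.
have w1 : 0 < w0 + nu i by rewrite ltr_pwDl.
pose z := (w0 / (w0 + nu i)) *: y + (1 - w0 / (w0 + nu i)) *: F i.
have t01 : 0 <= w0 / (w0 + nu i) <= 1.
  by apply/andP; split; [exact: divr_ge0 (ltW _) (ltW _)|rewrite ler_pdivrMr// mul1r lerDl].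
have e : 1 - w0 / (w0 + nu i) = nu i / (w0 + nu i).
  by field; rewrite gt_eqF.
have zE : w0 *: y + nu i *: F i = (w0 + nu i) *: z.
  rewrite /z e scalerDr !scalerA; congr (_ *: _ + _ *: _).
    by rewrite mulrCA divff ?mulr1// gt_eqF.
  by rewrite mulrCA divff ?mulr1// gt_eqF.
rewrite zE; apply: le_trans (IH _ z w1) _; rewrite lerD2r.
have := ler_wpM2l (ltW w1) (convex_functionP y (F i) cf t01); rewrite -/z e.
move=> /le_trans; apply; rewrite le_eqVlt; apply/orP; left; apply/eqP.
by field; rewrite gt_eqF.
Qed.

Lemma jensen_weights (I : finType) (nu : I -> R) (F : I -> E) (f : E -> R) :
  @convex_function R E setT f -> weights nu ->
  f (\sum_i nu i *: F i) <= \sum_i nu i * f (F i).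
Proof.
move=> cf [nu0 nu1].
have [i0 i0p] : exists i0, 0 < nu i0.
  apply/existsP; rewrite -[X in is_true X]negbK; apply/negP => /existsPn h.
  move/eqP: nu1; rewrite big1 ?(eq_sym 0) ?oner_eq0// => i _.
  by apply/eqP; rewrite eq_le nu0 andbT leNgt.
have := jensen_seq [seq i <- index_enum I | i != i0] F (F i0) cf nu0 i0p.
have split (V : zmodType) (G : I -> V) :
    G i0 + \sum_(i <- [seq i <- index_enum I | i != i0]) G i = \sum_i G i.
  by rewrite big_filter [RHS](bigD1 i0).
by rewrite !split nu1 invr1 scale1r mul1r.
Qed.

End jensen.

Definition mixv (R : realType) n (u v : 'rV[R]_n) (e : cube n) : 'rV[R]_n :=
  \row_i (if bit e i then v ord0 i else u ord0 i).

(** A bound, by [(p (p - q))^2 <= 3 (p^4 + q^4)], on the squared entries of a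
   mixture of [u] and [v] multiplied by those of [u - v]. *)
Definition quartic (R : realType) n (u v : 'rV[R]_n) : R :=
  3 * \sum_i (u ord0 i ^+ 4 + v ord0 i ^+ 4).

Section graded.
Variables (R : realType) (n d : nat) (d0 : (0 < d)%N).
Variables (L : R) (f : tensor_space R n d -> R).
Hypotheses (L0 : 0 <= L) (cf : convex_function setT f) (lf : tensor_lipschitz L f).
Implicit Types x y m : 'rV[R]_n.

Let g x := f (tensor_power d x).

(** A bound on the derivatives of both [x |-> x^(x)d] and [|x|^d] in the direction
   [m].  The component of [m] along [x] weighs [d], the orthogonal one [sqrt d]
   only; this is why the logarithm comes with [sqrt d] in the final bounds. *)
Definition slope x m : R :=
  Num.sqrt d%:R * normv x ^+ d.-1 * normv m +
  2 * (d%:R - 1) * normv x ^+ d.-2 * `|dotr x m|.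

Let d1 : (1 : R) <= d%:R. Proof. by rewrite ler1n. Qed.

Lemma tensor_deriv_le x m : tensor_norm (tensor_deriv d x m) <= slope x m.
Proof.
have t1 : 0 <= Num.sqrt d%:R * normv x ^+ d.-1 * normv m.
  by rewrite !mulr_ge0 ?exprn_ge0 ?normv_ge0.
have t2 : 0 <= 2 * (d%:R - 1) * normv x ^+ d.-2 * `|dotr x m|.
  by rewrite !mulr_ge0 ?exprn_ge0 ?normv_ge0// subr_ge0.
rewrite -(@ler_pXn2r _ 2) ?nnegrE ?tensor_norm_ge0 ?addr_ge0//.
rewrite sqr_tensor_norm tensor_dot_deriv sqrrD.
rewrite -2!(sqr_normv _) -(real_normK (num_real (dotr x m))) !exprMn.
rewrite (@sqr_sqrtr _ d%:R)//.
have t3 := mulr_ge0 t1 t2.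
have t4 : 0 <= `|dotr x m| ^+ 2 * normv x ^+ d.-2 ^+ 2 by rewrite mulr_ge0 ?sqr_ge0.
have t5 : d%:R * (d%:R - 1) <= 4 * (d%:R - 1) ^+ 2 :> R.
  case: (d) d0 => [//|[|k]] _; first by rewrite subrr mulr0 expr0n mulr0.
  have : (2 : R) <= k.+2%:R by rewrite ler_nat.
  by move: (k.+2%:R : R) => D D2; nra.
have := ler_wpM2r t4 t5; move: t3; rewrite mulr2n; lra.
Qed.

Lemma slope_ge0 x m : 0 <= slope x m.
Proof.
apply: addr_ge0; first by rewrite !mulr_ge0 ?exprn_ge0 ?normv_ge0.
by rewrite !mulr_ge0 ?exprn_ge0 ?normv_ge0// subr_ge0.
Qed.

Lemma norm_slope_le x m : norm_slope d x * `|dotr x m| <= slope x m.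
Proof.
have [x0|x0] := eqVneq (normv x) 0.
  by rewrite /norm_slope x0 invr0 mulr0 mul0r slope_ge0.
rewrite /slope /norm_slope.
case: (d) d0 => [//|[|k]] _ /=.
  rewrite sqrtr1 !expr0 subrr mulr0 !mul0r addr0 !mul1r.
  have xp : 0 < normv x by rewrite lt_neqAle eq_sym x0 normv_ge0.
  by rewrite mulrC ler_pdivrMr// mulrC normr_dotr_le.
have -> : k.+2%:R * normv x ^+ k.+1 / normv x = k.+2%:R * normv x ^+ k.
  by rewrite exprS mulrCA mulrAC divff// mul1r.
apply: ler_wpDl; first by rewrite !mulr_ge0 ?exprn_ge0 ?normv_ge0.
rewrite -!mulrA [leRHS]mulrA ler_wpM2r ?mulr_ge0 ?exprn_ge0 ?normv_ge0//.
have : (2 : R) <= k.+2%:R by rewrite ler_nat.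
lra.
Qed.

Section barycentre.
Variables (I : finType) (nu : I -> R) (x : I -> 'rV[R]_n) (e : I).
Hypothesis wnu : weights nu.

Let m := \sum_h nu h *: (x h - x e).
Let bregman h :=
  normv (x h) ^+ d - normv (x e) ^+ d - norm_slope d (x e) * dotr (x e) (x h - x e).

Let nu_cst (a : R) : \sum_h nu h * a = a.
Proof. by case: wnu => _ nu1; rewrite -mulr_suml nu1 mul1r. Qed.

Let sum_bregman : \sum_h nu h * bregman h =
  \sum_h nu h * normv (x h) ^+ d - normv (x e) ^+ d
  - norm_slope d (x e) * dotr (x e) m.
Proof.
under eq_bigr do rewrite /bregman !mulrBr.
rewrite !sumrB nu_cst; congr (_ - _).
have -> : dotr (x e) m = \sum_h nu h * dotr (x e) (x h - x e).
  rewrite /m; elim/big_ind2 : _ => [|a b a' b' <- <-|h _]; last exact: dotrZr.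
    by rewrite -(scale0r 0) dotrZr mul0r.
  by rewrite dotrDr.
by rewrite mulr_sumr; apply: eq_bigr => h _; rewrite mulrCA.
Qed.

Let slope_term : - slope (x e) m <= norm_slope d (x e) * dotr (x e) m.
Proof.
rewrite lerNl; apply: le_trans (norm_slope_le _ _).
rewrite -mulrN; apply: ler_wpM2l; last by rewrite -normrN ler_norm.
by rewrite /norm_slope divr_ge0 ?normv_ge0// mulr_ge0// exprn_ge0 ?normv_ge0.
Qed.

(** The convexity of [|x|^d] at [x e], with its linear part estimated by
   [slope]. *)
Lemma graded_norm :
  normv (x e) ^+ d - slope (x e) m <= \sum_h nu h * normv (x h) ^+ d.
Proof.
have : 0 <= \sum_h nu h * bregman h.
  case: wnu => nu0 _; apply: sumr_ge0 => h _; rewrite mulr_ge0//.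
  have := le_trans (tensor_norm_ge0 _) (tensor_taylor2_le (x e) (x h) d0).
  by rewrite pmulr_rge0.
rewrite sum_bregman; have := slope_term; lra.
Qed.

(** Jensen's inequality is applied to the tensors [x_h^(x)d].  Their barycentre is
   not a tensor power; it differs from [x_e^(x)d] by the derivative in the
   direction [m] and by an average of Taylor remainders, and the term
   [3 L |x|^d] pays for the latter by [tensor_taylor2_le]. *)
Lemma graded_convex :
  g (x e) + 3 * L * normv (x e) ^+ d - 4 * L * slope (x e) m <=
  \sum_h nu h * (g (x h) + 3 * L * normv (x h) ^+ d).
Proof.
have [nu0 nu1] := wnu.
pose T h := tensor_power d (x h).
have J := jensen_weights T cf wnu.
have Lip := le_trans (ler_norm _) (lf (T e) (\sum_h nu h *: T h)).
have E : \sum_h nu h *: T h - T e =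
    \sum_h nu h *: tensor_taylor2 d (x e) (x h) + tensor_deriv d (x e) m.
  rewrite -[T e]scale1r -nu1 scaler_suml -sumrB -tensor_deriv_linear -big_split.
  by apply: eq_bigr => h _ /=; rewrite -scalerBr -scalerDr /tensor_taylor2 subrK.
have N : tensor_norm (T e - \sum_h nu h *: T h) <=
    3 * (\sum_h nu h * bregman h) + slope (x e) m.
  rewrite -tensor_normN opprB E; apply: le_trans (ler_tensor_normD _ _) _.
  rewrite lerD ?tensor_deriv_le//.
  apply: le_trans (ler_tensor_norm_sum _ nu0) _.
  rewrite mulr_sumr; apply: ler_sum => h _; rewrite mulrCA ler_wpM2l//.
  exact: tensor_taylor2_le.
have LN := ler_wpM2l L0 N.
have S := ler_wpM2l L0 slope_term.
have -> : \sum_h nu h * (g (x h) + 3 * L * normv (x h) ^+ d) =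
    \sum_h nu h * f (T h) + 3 * L * \sum_h nu h * normv (x h) ^+ d.
  rewrite mulr_sumr -big_split; apply: eq_bigr => h _ /=; rewrite /g /T; ring.
move: LN; rewrite sum_bregman -/(g (x e)) /g -/(T e) => LN.
move: J Lip LN S.
set s1 := \sum_h nu h * f (T h); set s2 := f (\sum_h nu h *: T h).
set s3 := tensor_norm _; set s4 := \sum_h nu h * _ => J Lip LN S.
lra.
Qed.

End barycentre.
End graded.

Section mixing.
Variables (R : realType) (n d : nat) (d0 : (0 < d)%N).
Variables (L : R) (f : tensor_space R n d -> R).
Hypotheses (L0 : 0 <= L) (cf : convex_function setT f) (lf : tensor_lipschitz L f).
Variables (u v : 'rV[R]_n) (M : R).
Hypotheses (M0 : 0 <= M) (uM : forall i, `|u ord0 i| <= M)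
  (vM : forall i, `|v ord0 i| <= M).

(** A bound on the [slope] of a mean displacement per unit of the Euclidean norm of
   the flip masses, multiplied by [4 L].  The displacement has entries at most [2 M] times the flip masses, and
   its inner product with [x] is estimated by the Cauchy-Schwarz inequality. *)
Definition mix_weight (R : realType) (n d : nat) (L M : R) (u v : 'rV[R]_n)
    (x : 'rV[R]_n) : R :=
  4 * L * (Num.sqrt d%:R * normv x ^+ d.-1 * (2 * M) +
    2 * (d%:R - 1) * normv x ^+ d.-2 * Num.sqrt (quartic u v)).

Let x := mixv u v.
Let w e := mix_weight d L M u v (x e).

Lemma slope_mixv (nu : cube n -> R) (e : cube n) :  weights nu ->
  4 * L * slope d (x e) (\sum_h nu h *: (x h - x e)) <=
  w e * Num.sqrt (\sum_(i < n) flip_mass nu e i ^+ 2).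
Proof.
move=> [nu0 nu1]; set m := \sum_h _; set s := Num.sqrt _.
pose b (i : 'I_n) : R := if bit e i then u ord0 i - v ord0 i else v ord0 i - u ord0 i.
have mE i : m ord0 i = b i * flip_mass nu e i.
  rewrite /m summxE /flip_mass mulr_sumr; apply: eq_bigr => h _.
  rewrite /x !mxE /b; case: (bit h i); case: (bit e i) => /=;
    rewrite ?subrr ?mulr0 ?mulr1// mulrC//.
have bM i : b i ^+ 2 <= (2 * M) ^+ 2.
  have : `|b i| <= 2 * M.
    have := uM i; have := vM i; rewrite /b; case: ifP => _;
      rewrite !ler_norml => /andP[? ?] /andP[? ?]; apply/andP; split; lra.
  rewrite -(real_normK (num_real (b i))) => h.
  by apply: lerXn2r => //; rewrite nnegrE ?mulr_ge0.
have sum0 : 0 <= \sum_(i < n) flip_mass nu e i ^+ 2.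
  by rewrite sumr_ge0// => i _; exact: sqr_ge0.
have m_le : normv m <= 2 * M * s.
  rewrite normvE -[2 * M]ger0_norm ?mulr_ge0// -sqrtr_sqr -sqrtrM ?sqr_ge0//.
  rewrite ler_sqrt ?mulr_ge0 ?sqr_ge0// mulr_sumr.
  by apply: ler_sum => i _; rewrite mE exprMn ler_wpM2r ?sqr_ge0.
have quartE i : (x e ord0 i * b i) ^+ 2 <= 3 * (u ord0 i ^+ 4 + v ord0 i ^+ 4).
  rewrite /x mxE /b; move: (u ord0 i) (v ord0 i) => p q.
  have h : (p * (p - q)) ^+ 2 <= 3 * (p ^+ 4 + q ^+ 4).
    have := sqr_ge0 (p ^+ 2 - q ^+ 2); have := sqr_ge0 (p ^+ 2 + p * q).
    have := sqr_ge0 (q ^+ 2); nra.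
  have h' : (q * (q - p)) ^+ 2 <= 3 * (p ^+ 4 + q ^+ 4).
    have := sqr_ge0 (q ^+ 2 - p ^+ 2); have := sqr_ge0 (q ^+ 2 + p * q).
    have := sqr_ge0 (p ^+ 2); nra.
  by case: (bit e i); rewrite -opprB mulrN sqrrN.
have dot_le : `|dotr (x e) m| <= Num.sqrt (quartic u v) * s.
  have dE : dotr (x e) m = \sum_i (x e ord0 i * b i) * flip_mass nu e i.
    by apply: eq_bigr => i _; rewrite mE mulrA.
  have sq : Num.sqrt (\sum_i (x e ord0 i * b i) ^+ 2) <= Num.sqrt (quartic u v).
    rewrite ler_wsqrtr// /quartic mulr_sumr; apply: ler_sum => i _; exact: quartE.
  have s0 : 0 <= s by exact: sqrtr_ge0.
  rewrite ler_norml; apply/andP; split.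
    rewrite lerNl dE -sumrN; under eq_bigr do rewrite -mulNr.
    apply: le_trans (sum_cauchy_schwarz _ _) _; rewrite ler_wpM2r//.
    by under eq_bigr do rewrite sqrrN.
  by rewrite dE; apply: le_trans (sum_cauchy_schwarz _ _) _; rewrite ler_wpM2r.
rewrite /w /mix_weight -[leRHS]mulrA.
apply: ler_wpM2l; first by rewrite mulr_ge0.
rewrite /slope [leRHS]mulrDl; apply: lerD; rewrite -[leRHS]mulrA; apply: ler_wpM2l => //.
  by rewrite mulr_ge0// exprn_ge0// normv_ge0.
by rewrite !mulr_ge0 ?exprn_ge0 ?normv_ge0// subr_ge0 ler1n.
Qed.

Lemma mix_weight_ge0 e : 0 <= w e.
Proof.
rewrite /w /mix_weight mulr_ge0 ?mulr_ge0// addr_ge0//.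
  by rewrite !mulr_ge0 ?exprn_ge0 ?normv_ge0.
by rewrite !mulr_ge0 ?exprn_ge0 ?normv_ge0// subr_ge0 ler1n.
Qed.

(** [f (x^(x)d)] is the difference of [f (x^(x)d) + 3 L |x|^d] and [3 L |x|^d],
   which are both subgraded for the same weight. *)
Theorem mixv_moment (k : nat) (lam : R) : (0 < k)%N -> 0 < lam ->
  \sum_e `|f (tensor_power d (x e)) - f (tensor_power d (x (cubeN e)))| ^+ k <=
  64 ^+ k * ((k%:R / lam) ^+ k * 2 ^+ n + \sum_e (4 * lam * w e ^+ 2) ^+ k).
Proof.
move=> k0 l0.
pose F1 e := f (tensor_power d (x e)) + 3 * L * normv (x e) ^+ d.
pose F2 e := 3 * L * normv (x e) ^+ d.
have F1w : subgraded F1 w.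
  split; first exact: mix_weight_ge0.
  move=> nu e wnu.
  apply: le_trans (graded_convex d0 L0 cf lf x e wnu).
  by rewrite lerD2l lerN2; exact: slope_mixv.
have F2w : subgraded F2 w.
  split; first exact: mix_weight_ge0.
  move=> nu e wnu.
  have := graded_norm d0 x e wnu; have := slope_mixv e wnu.
  set s := slope _ _ _ => h1 h2.
  have L3 : 0 <= 3 * L by rewrite mulr_ge0.
  have -> : \sum_h nu h * F2 h = 3 * L * \sum_h nu h * normv (x h) ^+ d.
    by rewrite mulr_sumr; apply: eq_bigr => h _; rewrite mulrCA.
  apply: le_trans (ler_wpM2l L3 h2).
  rewrite /F2 mulrBr lerD2l lerN2.
  have s0 : 0 <= s by exact: slope_ge0.
  apply: le_trans h1; nra.
have := cube_antipodal_moment k0 l0 F1w F2w.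
apply: le_trans; rewrite le_eqVlt; apply/orP; left; apply/eqP.
by apply: eq_bigr => e _; congr (`|_| ^+ _); rewrite /F1 /F2; ring.
Qed.

End mixing.

(** * Exchanging coordinates between two independent copies *)

Section joint_law.
Context (R : realType) (m : nat).
Local Open Scope ereal_scope.

(** Boxes form a pi-system that generates the measurable sets of tuples. *)
Definition box (A : 'I_m -> set R) : set (m.-tuple R) :=
  [set u | forall i, A i (tnth u i)].

Definition boxes : set (set (m.-tuple R)) :=
  [set box A | A in [set A : 'I_m -> set R | forall i, measurable (A i)]].

Lemma measurable_preimage_box d (T : measurableType d) (Y : T -> m.-tuple R)
    (A : 'I_m -> set R) :
  (forall i, measurable_fun setT (fun w => tnth (Y w) i)) ->
  (forall i, measurable (A i)) -> measurable (Y @^-1` box A).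
Proof.
move=> mY mA.
rewrite (_ : _ @^-1` _ = \bigcap_(i in [set: 'I_m]) ((fun w => tnth (Y w) i) @^-1` A i)).
  by apply: fin_bigcap_measurable => // i _; rewrite -[X in measurable X]setTI; exact: mY.
by apply/seteqP; split => u /= h i; [move=> _|]; exact: h.
Qed.

Lemma measurable_tupleE : (@measurable _ (m.-tuple R)) = <<s boxes >>.
Proof.
apply/seteqP; split; last first.
  apply: smallest_sub; first exact: sigma_algebra_measurable.
  move=> _ [A /= mA <-]; apply: (@measurable_preimage_box _ _ id) => //.
  by move=> i; exact: measurable_tnth.
apply: smallest_sub; first exact: smallest_sigma_algebra.
move=> B; rewrite -bigcup_seq => -[i _ [C mC <-]].
apply: sub_sigma_algebra; exists (fun j => if j == i then C else setT).
  by move=> j /=; case: ifP.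
apply/seteqP; split => u /= h.
  by split => //; have := h i; rewrite eqxx.
by move=> j; case: eqP => // ->; case: h.
Qed.

Lemma setI_closed_boxes : setI_closed boxes.
Proof.
move=> _ _ [A mA <-] [B mB <-]; exists (fun i => A i `&` B i).
  by move=> i; apply: measurableI; [exact: mA|exact: mB].
apply/seteqP; split => u /= => [h|[h1 h2] i]; last by split.
by split => i; have [] := h i.
Qed.

Lemma law_eq d (T : measurableType d) (mu : probability T R)
    (Y1 Y2 : T -> m.-tuple R) (H : m.-tuple R -> \bar R) :
  measurable_fun setT Y1 -> measurable_fun setT Y2 ->
  (forall A, (forall i, measurable (A i)) ->
    mu (Y1 @^-1` box A) = mu (Y2 @^-1` box A)) ->
  measurable_fun [set: m.-tuple R] H -> (forall u, 0 <= H u) ->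
  \int[mu]_w H (Y1 w) = \int[mu]_w H (Y2 w).
Proof.
move=> m1 m2 eqb mH H0.
pose Z1 : {mfun T >-> m.-tuple R} :=
  HB.pack Y1 (isMeasurableFun.Build _ _ _ _ Y1 m1).
pose Z2 : {mfun T >-> m.-tuple R} :=
  HB.pack Y2 (isMeasurableFun.Build _ _ _ _ Y2 m2).
have := @ge0_integral_distribution _ _ _ _ _ mu Z1 H mH H0.
have := @ge0_integral_distribution _ _ _ _ _ mu Z2 H mH H0.
rewrite /comp /= => <- <-.
apply: eq_measure_integral => A mA _.
apply: (measure_unique boxes (fun=> setT)) => //.
- exact: measurable_tupleE.
- exact: setI_closed_boxes.
- by move=> _; exists (fun=> setT) => //; apply/seteqP; split.
- by apply/seteqP; split => // u _; exists 0%N.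
- by move=> _ [B mB <-]; exact: eqb.
- by move=> _; rewrite /= /distribution /pushforward preimage_setT probability_setT ltry.
Qed.

End joint_law.

Section swap.
Context d (T : measurableType d) (R : realType).
Variables (P : probability T R) (n : nat) (X : 'I_n -> {RV P >-> R}).
Hypothesis indep : mutually_independent X.
Local Open Scope ereal_scope.

(** The two independent copies of [X i] are [X i w.1] and [X i w.2]; they are
   exchanged for [i] in [J]. *)
Definition swapped (J : 'I_n -> bool) (w : T * T) : (n + n).-tuple R :=
  [tuple match fintype.split k with
    | inl i => X i (if J i then w.2 else w.1)
    | inr i => X i (if J i then w.1 else w.2) end | k < n + n].

Lemma measurable_swapped J : measurable_fun setT (swapped J).
Proof.
apply/measurable_fun_tnthP => k.
rewrite (_ : _ \o _ = fun w => match fintype.split k with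
    | inl i => X i (if J i then w.2 else w.1)
    | inr i => X i (if J i then w.1 else w.2) end).
  case: (fintype.split k) => i; case: (J i); by apply: measurableT_comp.
by apply/funext => w /=; rewrite tnth_mktuple.
Qed.

Lemma measure_swapped J (A : 'I_(n + n) -> set R) :
  (forall k, measurable (A k)) ->
  (P \x P) (swapped J @^-1` box A) =
  \prod_(i < n) (P (X i @^-1` A (lshift n i)) * P (X i @^-1` A (rshift n i))).
Proof.
move=> mA.
pose B1 i := if J i then A (rshift n i) else A (lshift n i).
pose B2 i := if J i then A (lshift n i) else A (rshift n i).
pose C (B : 'I_n -> set R) := \bigcap_(i in [set` [set: 'I_n]%SET]) (X i @^-1` B i).
have mC B : (forall i, measurable (B i)) -> measurable (C B).
  move=> mB; apply: fin_bigcap_measurable => // i _.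
  by rewrite -[X in measurable X]setTI; exact: (@measurable_funPT _ _ _ _ (X i)).
have mB1 i : measurable (B1 i) by rewrite /B1; case: ifP.
have mB2 i : measurable (B2 i) by rewrite /B2; case: ifP.
have -> : swapped J @^-1` box A = C B1 `*` C B2.
  apply/seteqP; split => -[w1 w2] /=.
    move=> h; split => i _ /=.
      rewrite /B1; have := h (lshift n i); have := h (rshift n i).
      rewrite !tnth_mktuple !(unsplitK (inl i : 'I_n + 'I_n))
        !(unsplitK (inr i : 'I_n + 'I_n)) /=.
      by case: (J i).
    rewrite /B2; have := h (lshift n i); have := h (rshift n i).
    rewrite !tnth_mktuple !(unsplitK (inl i : 'I_n + 'I_n))
      !(unsplitK (inr i : 'I_n + 'I_n)) /=.
    by case: (J i).
  move=> [h1 h2] k; rewrite tnth_mktuple -[k]splitK.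
  case: (fintype.split k) => i; rewrite unsplitK /=.
    have := h1 i; have := h2 i; rewrite /B1 /B2 /= finset.in_setT.
    by case: (J i) => q p; [exact: q|exact: p].
  have := h1 i; have := h2 i; rewrite /B1 /B2 /= finset.in_setT.
  by case: (J i) => q p; [exact: p|exact: q].
have PC B : (forall i, measurable (B i)) ->
    P (C B) = \prod_(i < n) P (X i @^-1` B i).
  move=> mB; transitivity (\prod_(i in [set: 'I_n]%SET) P (X i @^-1` B i)).
    exact: indep.
  by apply: eq_bigl => i; rewrite finset.in_setT.
transitivity (P (C B1) * P (C B2)).
  by apply: product_measure1E; exact: mC.
rewrite !PC// -big_split /=.
apply: eq_bigr => i _; rewrite /B1 /B2; case: (J i) => //.
by rewrite muleC.
Qed.

(** The joint law of the two copies is the product of its marginals, and the two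
   marginals at the same index are equal. *)
Lemma integral_swapped J (H : (n + n).-tuple R -> \bar R) :
  measurable_fun [set: (n + n).-tuple R] H -> (forall u, 0 <= H u) ->
  \int[P \x P]_w H (swapped J w) = \int[P \x P]_w H (swapped (fun=> false) w).
Proof.
move=> mH H0; apply: (law_eq (mu := (P \x P)%E)) => //.
- exact: measurable_swapped.
- exact: measurable_swapped.
- move=> A mA.
  exact: etrans (measure_swapped J mA) (esym (measure_swapped (fun=> false) mA)).
Qed.

End swap.

(** * Means of nonnegative functions *)

(** Measurability and nonnegativity are bundled with the bound so that bounds can
   be composed without integrability conditions. *)
Definition mean_le d (T : measurableType d) (R : realType)
    (mu : {measure set T -> \bar R}) (F : T -> R) (c : R) : Prop :=
  [/\ measurable_fun setT F, forall x, 0 <= F x &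
      (\int[mu]_x (F x)%:E <= c%:E)%E].

Section mean_le.
Context d (T : measurableType d) (R : realType).
Variable mu : probability T R.
Implicit Types F G : T -> R.

Lemma integral_probability_cst (r : \bar R) : (\int[mu]_x r = r)%E.
Proof. by rewrite integral_cst//= probability_setT mule1. Qed.

Lemma mean_le_mono F G a b : measurable_fun setT F -> (forall x, 0 <= F x) ->
  (forall x, F x <= G x) -> a <= b -> mean_le mu G a -> mean_le mu F b.
Proof.
move=> mF F0 FG ab [mG G0 iG]; split => //.
apply: (@le_trans _ _ (\int[mu]_x (G x)%:E)%E).
  apply: ge0_le_integral => //.
  - by move=> x _; rewrite lee_fin.
  - exact/measurable_EFinP.
  - exact/measurable_EFinP.
  - by move=> x _; rewrite lee_fin.
by apply: le_trans iG _; rewrite lee_fin.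
Qed.

Lemma mean_leD F G a b : mean_le mu F a -> mean_le mu G b ->
  mean_le mu (fun x => F x + G x) (a + b).
Proof.
move=> [mF F0 iF] [mG G0 iG]; split.
- exact: measurable_funD.
- by move=> x; rewrite addr_ge0.
- under eq_integral do rewrite EFinD.
  rewrite ge0_integralD//; [|by move=> x _; rewrite lee_fin|exact/measurable_EFinP|
    by move=> x _; rewrite lee_fin|exact/measurable_EFinP].
  by rewrite EFinD leeD.
Qed.

Lemma mean_leZ F a k : 0 <= k -> mean_le mu F a ->
  mean_le mu (fun x => k * F x) (k * a).
Proof.
move=> k0 [mF F0 iF]; split.
- exact: measurable_funM.
- by move=> x; rewrite mulr_ge0.
- under eq_integral do rewrite EFinM.
  rewrite ge0_integralZl_EFin//; [|by move=> x _; rewrite lee_fin|exact/measurable_EFinP].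
  by rewrite EFinM lee_wpmul2l// lee_fin.
Qed.

Lemma mean_le_cst c : 0 <= c -> mean_le mu (fun=> c) c.
Proof.
move=> c0; split => //.
by rewrite integral_probability_cst.
Qed.

Lemma mean_le_sum (I : Type) (s : seq I) (F : I -> T -> R) (a : I -> R) :
  (forall i, mean_le mu (F i) (a i)) ->
  mean_le mu (fun x => \sum_(i <- s) F i x) (\sum_(i <- s) a i).
Proof.
move=> Fa; elim: s => [|i s IH].
  rewrite big_nil (_ : (fun x => _) = fun=> 0); first exact: mean_le_cst.
  by apply/funext => x; rewrite big_nil.
rewrite big_cons (_ : (fun x => _) = fun x => F i x + \sum_(j <- s) F j x).
  exact: mean_leD.
by apply/funext => x; rewrite big_cons.
Qed.

End mean_le.

Section product_mean.
Context d (T : measurableType d) (R : realType).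
Variable P : probability T R.

Lemma mean_le_fst (F : T -> R) c : mean_le P F c ->
  mean_le (P \x P)%E (fun w => F w.1) c.
Proof.
move=> [mF F0 iF]; split => //; first exact: measurableT_comp.
rewrite (fubini_tonelli1 (fun w => (F w.1)%:E)) => [||w]; last by rewrite lee_fin.
  apply: le_trans iF; rewrite le_eqVlt; apply/orP; left; apply/eqP.
  by apply: eq_integral => w _; rewrite /fubini_F /fubini_G /=; exact: (integral_probability_cst P).
by apply/measurable_EFinP; exact: measurableT_comp.
Qed.

Lemma mean_le_snd (F : T -> R) c : mean_le P F c ->
  mean_le (P \x P)%E (fun w => F w.2) c.
Proof.
move=> [mF F0 iF]; split => //; first exact: measurableT_comp.
rewrite (fubini_tonelli2 (fun w => (F w.2)%:E)) => [||w]; last by rewrite lee_fin.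
  apply: le_trans iF; rewrite le_eqVlt; apply/orP; left; apply/eqP.
  by apply: eq_integral => w _; rewrite /fubini_F /fubini_G /=; exact: (integral_probability_cst P).
by apply/measurable_EFinP; exact: measurableT_comp.
Qed.

Variables (n : nat) (X : 'I_n -> {RV P >-> R}).
Hypothesis indep : mutually_independent X.

Lemma mean_le_swapped (J : 'I_n -> bool) (H : (n + n).-tuple R -> R) c :
  measurable_fun [set: (n + n).-tuple R] H -> (forall u, 0 <= H u) ->
  mean_le (P \x P)%E (fun w => H (swapped X (fun=> false) w)) c ->
  mean_le (P \x P)%E (fun w => H (swapped X J w)) c.
Proof.
move=> mH H0 [_ _ iH]; split => //.
  by apply: measurableT_comp => //; exact: measurable_swapped.
by rewrite (integral_swapped indep J (H := EFin \o H))//; exact/measurable_EFinP.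
Qed.

Lemma swapped_lshift J i w :
  tnth (swapped X J w) (lshift n i) = X i (if J i then w.2 else w.1).
Proof. by rewrite tnth_mktuple (unsplitK (inl i : 'I_n + 'I_n)). Qed.

Lemma swapped_rshift J i w :
  tnth (swapped X J w) (rshift n i) = X i (if J i then w.1 else w.2).
Proof. by rewrite tnth_mktuple (unsplitK (inr i : 'I_n + 'I_n)). Qed.

(** A coordinate is exchanged with its independent copy, which preserves the law;
   Tonelli's theorem then splits off its factor. *)
Lemma mean_le_prod (phi : R -> R) c : measurable_fun setT phi ->
  (forall x, 0 <= phi x) -> (forall i, mean_le P (fun w => phi (X i w)) c) ->
  mean_le P (fun w => \prod_(i < n) phi (X i w)) (c ^+ n).
Proof.
move=> mphi phi0 Pc.
have mX i : measurable_fun setT (fun w => phi (X i w)).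
  by apply: measurableT_comp.
suff H (s : seq 'I_n) : uniq s ->
    mean_le P (fun w => \prod_(i <- s) phi (X i w)) (c ^+ size s).
  have := H _ (enum_uniq 'I_n); rewrite size_enum_ord; congr mean_le.
  by apply/funext => w; rewrite big_enum.
elim: s => [_|h s IH /= /andP[hs us]].
  rewrite (_ : (fun w => _) = fun=> 1); first exact: mean_le_cst.
  by apply/funext => w; rewrite big_nil.
have {}IH := IH us.
pose H (u : (n + n).-tuple R) :=
  phi (tnth u (lshift n h)) * \prod_(i <- s) phi (tnth u (lshift n i)).
have mH : measurable_fun [set: (n + n).-tuple R] H.
  apply: measurable_funM.
    by apply: measurableT_comp => //; exact: measurable_tnth.
  apply: measurable_prod => i _.
  by apply: measurableT_comp => //; exact: measurable_tnth.
have H0 u : 0 <= H u by rewrite mulr_ge0// prodr_ge0.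
have F0 w : 0 <= \prod_(i <- s) phi (X i w) by rewrite prodr_ge0.
have mF : measurable_fun setT (fun w => \prod_(i <- s) phi (X i w)).
  by case: IH.
have c0 : 0 <= c.
  have [_ _ ic] := Pc h; rewrite -lee_fin; apply: le_trans ic.
  by apply: integral_ge0 => w _; rewrite lee_fin.
split.
- under eq_fun do rewrite big_cons; exact: measurable_funM.
- by move=> w; rewrite prodr_ge0.
have -> : (\int[P]_w (\prod_(i <- h :: s) phi (X i w))%:E =
    \int[P \x P]_w (H (swapped X (fun=> false) w))%:E)%E.
  transitivity (\int[P \x P]_w (\prod_(i <- h :: s) phi (X i w.1))%:E)%E; last first.
    apply: eq_integral => w _; rewrite /H swapped_lshift /= big_cons; congr (_ * _)%:E.
    by apply: eq_bigr => i _; rewrite swapped_lshift.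
  rewrite (fubini_tonelli1 (fun w => (\prod_(i <- h :: s) phi (X i w.1))%:E)) => [||w].
  - by apply: eq_integral => w _; rewrite /fubini_F /=; apply/esym; exact: (integral_probability_cst P).
  - apply/measurable_EFinP; under eq_fun do rewrite big_cons.
    apply: measurable_funM; first exact: (measurableT_comp (mX h) measurable_fst).
    exact: (measurableT_comp mF measurable_fst).
  - by rewrite lee_fin prodr_ge0.
rewrite -(integral_swapped indep (fun i => i == h) (H := EFin \o H)); last 2 first.
- exact/measurable_EFinP.
- by move=> u; rewrite lee_fin.
have -> : (\int[P \x P]_w (EFin \o H) (swapped X (fun i => i == h) w) =
    \int[P \x P]_w ((phi (X h w.2))%:E * (\prod_(i <- s) phi (X i w.1))%:E))%E.
  apply: eq_integral => w _ /=; rewrite /H swapped_lshift eqxx -EFinM; congr (_ * _)%:E.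
  rewrite !big_seq; apply: eq_bigr => i is_; rewrite swapped_lshift.
  by case: eqP => // ih; rewrite -ih is_ in hs.
rewrite (fubini_tonelli1 (fun w => (phi (X h w.2))%:E *
  (\prod_(i <- s) phi (X i w.1))%:E)%E) => [||w]; last 2 first.
- apply: emeasurable_funM; apply/measurable_EFinP.
    exact: (measurableT_comp (mX h) measurable_snd).
  exact: (measurableT_comp mF measurable_fst).
- by rewrite mule_ge0// lee_fin.
rewrite /fubini_F /=.
apply: (@le_trans _ _ (\int[P]_w (c%:E * (\prod_(i <- s) phi (X i w))%:E))%E).
  apply: ge0_le_integral => //.
  - by move=> w _; apply: integral_ge0 => v _; rewrite mule_ge0// lee_fin.
  - apply: (measurable_fun_fubini_tonelli_F (fun w => (phi (X h w.2))%:E *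
      (\prod_(i <- s) phi (X i w.1))%:E)%E).
    + apply: emeasurable_funM; apply/measurable_EFinP.
        exact: (measurableT_comp (mX h) measurable_snd).
      exact: (measurableT_comp mF measurable_fst).
    + by move=> w /=; rewrite mule_ge0// lee_fin.
  - by apply: emeasurable_funM; apply/measurable_EFinP.
  - move=> w _; rewrite ge0_integralZr//.
    + by rewrite lee_wpmul2r ?lee_fin//; case: (Pc h).
    + exact/measurable_EFinP.
    + by move=> v _; rewrite lee_fin.
    + by rewrite lee_fin.
have := mean_leZ c0 IH; rewrite -exprS => -[_ _].
by under eq_integral do rewrite EFinM.
Qed.

End product_mean.

(** * Measurability *)
Section measurability.
Context disp (T : measurableType disp) (R : realType).

Lemma measurable_sqrt (F : T -> R) :
  measurable_fun setT F -> measurable_fun setT (fun w => Num.sqrt (F w)).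
Proof.
move=> mF; apply: (measurableT_comp _ mF).
by apply: continuous_measurable_fun; exact: sqrt_continuous.
Qed.

Lemma measurable_tensor_norm n d (Y : T -> tensor_space R n d) :
  (forall i, measurable_fun setT (fun w => Y w i)) ->
  measurable_fun setT (fun w => tensor_norm (Y w)).
Proof.
move=> mY; apply: measurable_sqrt.
by apply: measurable_sum => i; exact: measurable_funM.
Qed.

(** McShane's formula: [f] is the infimum of [f q + L |. - q|] over the countably
   many tensors [q] with rational entries. *)
Lemma measurable_lipschitz n d (L : R) (f : tensor_space R n d -> R)
    (Y : T -> tensor_space R n d) :
  0 <= L -> tensor_lipschitz L f ->
  (forall i, measurable_fun setT (fun w => Y w i)) ->
  measurable_fun setT (fun w => f (Y w)).
Proof.
move=> L0 lf mY.
pose I := {ffun 'I_d -> 'I_n}.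
pose r (q : {ffun I -> rat}) : tensor_space R n d := [ffun i => ratr (q i)].
pose q_ (m : nat) : {ffun I -> rat} :=
  if unpickle m is Some q then q else [ffun=> 0].
pose h (m : nat) w := f (r (q_ m)) + L * tensor_norm (Y w - r (q_ m)).
have fh m w : f (Y w) <= h m w.
  rewrite /h -lerBlDl; apply: le_trans (lf _ _); exact: ler_norm.
have lb w : setT w -> has_lbound (range (h ^~ w)).
  by move=> _; exists (f (Y w)) => _ [m _ <-].
have mh m : measurable_fun setT (h m).
  apply: measurable_funD => //; apply: measurable_funM => //.
  apply: measurable_tensor_norm => i.
  rewrite (_ : (fun w => _) = fun w => Y w i - r (q_ m) i).
    exact: measurable_funB.
  by apply/funext => w; rewrite !ffunE.
have := measurable_fun_infs 0%N lb mh.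
congr measurable_fun; apply/funext => w.
apply/eqP; rewrite eq_le; apply/andP; split; last first.
  apply: lb_le_inf; first by exists (h 0%N w), 0%N.
  by move=> _ [m _ <-].
apply/ler_addgt0Pr => e e0.
pose N : R := #|{: I}|%:R + 1.
have N1 : 1 <= N by rewrite /N lerDr.
pose c := e / (2 * L + 1) / N.
have L1 : 0 < 2 * L + 1 by rewrite ltr_wpDl// mulr_ge0.
have c0 : 0 < c by rewrite !divr_gt0// (lt_le_trans ltr01).
have approx i : exists x : rat, `|Y w i - ratr x| <= c.
  have /rat_in_itvoo[x] : Y w i - c < Y w i + c by rewrite ltrBlDr -addrA ltrDl addr_gt0.
  by rewrite in_itv/= => /andP[h1 h2]; exists x; rewrite ler_norml; apply/andP; split; lra.
have /choice[x hx] := approx.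
pose q : {ffun I -> rat} := [ffun i => x i].
have qE : q_ (pickle q) = q by rewrite /q_ pickleK.
have nle : tensor_norm (Y w - r q) <= c * N.
  rewrite -(@ler_pXn2r _ 2) ?nnegrE ?tensor_norm_ge0//; last by rewrite mulr_ge0 ?ltW//; lra.
  rewrite sqr_tensor_norm.
  apply: (@le_trans _ _ (\sum_(i : I) c ^+ 2)).
    apply: ler_sum => i _; rewrite !ffunE -expr2 -(real_normK (num_real _)).
    by rewrite lerXn2r ?nnegrE// ltW.
  rewrite sumr_const -[leLHS]mulr_natl [leLHS]mulrC [leRHS]exprMn ler_wpM2l ?sqr_ge0//.
  by rewrite /N; have : (0 : R) <= #|{: I}|%:R by []; nra.
apply: (@le_trans _ _ (h (pickle q) w)).
  apply: ge_inf; last by exists (pickle q).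
  by exists (f (Y w)) => _ [m _ <-].
rewrite /h qE; have := lf (r q) (Y w).
rewrite -tensor_normN opprB => /(le_trans (ler_norm _)) h1.
have : 2 * L * tensor_norm (Y w - r q) <= e.
  apply: (@le_trans _ _ (2 * L * (c * N))); first by rewrite ler_wpM2l// mulr_ge0.
  have -> : c * N = e / (2 * L + 1) by rewrite /c divfK// gt_eqF//; lra.
  by rewrite mulrA ler_pdivrMr//; nra.
lra.
Qed.

Definition measurable_row n (Y : T -> 'rV[R]_n) :=
  forall i, measurable_fun setT (fun w => Y w ord0 i).

Lemma measurable_tensor_power n d (L : R) (f : tensor_space R n d -> R)
    (Y : T -> 'rV[R]_n) :
  0 <= L -> tensor_lipschitz L f -> measurable_row Y ->
  measurable_fun setT (fun w => f (tensor_power d (Y w))).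
Proof.
move=> L0 lf mY; apply: measurable_lipschitz lf _ => // i.
rewrite (_ : (fun w => _) = fun w => \prod_(j <- index_enum 'I_d) Y w ord0 (i j)).
  by apply: measurable_prod.
by apply/funext => w; rewrite ffunE.
Qed.

Lemma measurable_dotr n (Y : T -> 'rV[R]_n) :
  measurable_row Y -> measurable_fun setT (fun w => dotr (Y w) (Y w)).
Proof. by move=> mY; apply: measurable_sum => i; exact: measurable_funM. Qed.

Lemma measurable_normv n (Y : T -> 'rV[R]_n) :
  measurable_row Y -> measurable_fun setT (fun w => normv (Y w)).
Proof. by move=> mY; apply: measurable_sqrt; exact: measurable_dotr. Qed.

Lemma measurable_quartic n (Y Y' : T -> 'rV[R]_n) :
  measurable_row Y -> measurable_row Y' -> measurable_fun setT (fun w => quartic (Y w) (Y' w)).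
Proof.
move=> mY mY'; apply: measurable_funM => //; apply: measurable_sum => i.
by apply: measurable_funD; exact: measurable_funX.
Qed.

End measurability.

(** * Moments of subgaussian vectors *)

Section expR_bounds.
Variable R : realType.
Implicit Types x y z s : R.

Lemma expR_le_mul y : expR y <= 1 + y * expR y.
Proof.
have := expR_ge1Dx (- y); rewrite expRN => h.
have e0 := expR_gt0 y.
have := ler_wpM2r (ltW e0) h; rewrite mulVf ?gt_eqF//; lra.
Qed.

Lemma expR_le_quadratic y : expR y <= 1 + y + y ^+ 2 * expR `|y|.
Proof.
have h1 := expR_le_mul y; have h2 := expR_ge1Dx y.
have [y0|y0] := leP 0 y.
  by rewrite ger0_norm//; have := ler_wpM2l y0 h1; lra.
have h3 : 1 <= expR `|y| by rewrite -expR0 ler_expR.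
have h4 := ler_wpM2l (sqr_ge0 y) h3.
have ny : 0 <= - y by lra.
have := ler_wpM2l ny h2; lra.
Qed.

Lemma sqr_le_expR z : 0 <= z -> z ^+ 2 <= 16 * expR (z / 2).
Proof.
move=> z0; have z20 : 0 <= z / 2 by rewrite divr_ge0.
have := expR_geX 2 z20; rewrite (expr_div_n z 2 2).
rewrite ler_pdivrMr ?exprn_gt0//; lra.
Qed.

Lemma expR_geX_centred (j : nat) y : 0 <= y -> y ^+ j <= expR (j%:R * (y - 1)).
Proof.
move=> y0; rewrite expRM_natl lerXn2r ?nnegrE ?expR_ge0//.
by have := expR_ge1Dx (y - 1); rewrite addrCA subrr addr0.
Qed.

Lemma exprD_ge (k : nat) x y : (0 < k)%N -> 0 <= x -> 0 <= y ->
  x ^+ k + y ^+ k <= (x + y) ^+ k.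
Proof.
case: k => // k _ x0 y0; rewrite !exprS mulrDl lerD// ler_wpM2l//.
  by rewrite lerXn2r ?nnegrE ?addr_ge0// lerDl.
by rewrite lerXn2r ?nnegrE ?addr_ge0// lerDr.
Qed.

End expR_bounds.

(** Large values are sent to [0], not to the nearest end point, so that a clipped
   vector is orthogonal to what has been removed. *)
Definition clip (R : realType) (M x : R) : R := if `|x| <= M then x else 0.

Section clip.
Variable R : realType.
Implicit Types M x : R.

Lemma normr_clip_le M x : 0 <= M -> `|clip M x| <= M.
Proof. by move=> M0; rewrite /clip; case: ifPn => //; rewrite normr0. Qed.

Lemma measurable_clip M : measurable_fun setT (clip M).
Proof.
apply: measurable_fun_ifT => //.
by apply: measurable_fun_ler.
Qed.

Lemma clip_mul M x : clip M x * (x - clip M x) = 0.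
Proof. by rewrite /clip; case: ifP => _; rewrite ?subrr ?mulr0 ?mul0r. Qed.

End clip.

Section subgaussian.
Context disp (T : measurableType disp) (R : realType).
Variables (P : probability T R) (a : R).
Hypothesis a0 : 0 < a.

Definition square_rate : R := 32 * a ^+ 4 * expR (a ^- 2).

Let a2 : 0 < a ^+ 2. Proof. exact: exprn_gt0. Qed.

Section one_variable.
Variable W : {RV P >-> R}.
Hypothesis psi : mean_le P (fun w => expR (W w ^+ 2 / a ^+ 2)) 2.
Hypothesis var : mean_le P (fun w => W w ^+ 2) 1.

Let mcomp (phi : R -> R) : measurable_fun setT phi ->
  measurable_fun setT (fun w => phi (W w)).
Proof. by move=> mphi; exact: measurableT_comp. Qed.

(** The mean of [W^2 - 1] is at most [0], so that the linear term of the exponential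
   disappears and the bound is quadratic in [s]. *)
Lemma mean_exp_centred_square s : 0 <= s -> s <= 1 -> s <= (2 * a ^+ 2)^-1 ->
  mean_le P (fun w => expR (s * (W w ^+ 2 - 1))) (expR (square_rate * s ^+ 2)).
Proof.
move=> s0 s1 sa.
have bound x : expR (s * (x ^+ 2 - 1)) <=
    (1 - s) + s * x ^+ 2 +
    s ^+ 2 * (16 * a ^+ 4 * expR (a ^- 2)) * expR (x ^+ 2 / a ^+ 2).
  set y := s * (x ^+ 2 - 1); pose z := (x ^+ 2 + 1) / a ^+ 2.
  have x2 := sqr_ge0 x.
  have z0 : 0 <= z by rewrite divr_ge0 ?ltW//; lra.
  have zE : x ^+ 2 + 1 = a ^+ 2 * z by rewrite /z mulrCA divff ?mulr1// gt_eqF.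
  have yz : `|y| <= z / 2.
    rewrite /y normrM (ger0_norm s0).
    apply: (@le_trans _ _ ((2 * a ^+ 2)^-1 * (x ^+ 2 + 1))).
      rewrite ler_pM// ler_norml; apply/andP; split; lra.
    by rewrite /z le_eqVlt; apply/orP; left; apply/eqP; field; rewrite gt_eqF.
  apply: le_trans (expR_le_quadratic y) _.
  have -> : 1 + y = 1 - s + s * x ^+ 2 by rewrite /y; ring.
  rewrite lerD2l -(mulrA (s ^+ 2)).
  have -> : y ^+ 2 = s ^+ 2 * (x ^+ 2 - 1) ^+ 2 by rewrite /y exprMn.
  rewrite -[leLHS]mulrA ler_wpM2l ?sqr_ge0//.
  have h1 : (x ^+ 2 - 1) ^+ 2 <= (a ^+ 2) ^+ 2 * z ^+ 2.
    by rewrite -exprMn -zE; nra.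
  apply: (@le_trans _ _ ((a ^+ 2) ^+ 2 * z ^+ 2 * expR (z / 2))).
    by rewrite ler_pM ?sqr_ge0 ?expR_ge0// ler_expR.
  apply: (@le_trans _ _ ((a ^+ 2) ^+ 2 * (16 * expR (z / 2)) * expR (z / 2))).
    rewrite ler_wpM2r ?expR_ge0// ler_wpM2l ?sqr_ge0//; exact: sqr_le_expR.
  have -> : 16 * a ^+ 4 * expR (a ^- 2) * expR (x ^+ 2 / a ^+ 2) =
      16 * a ^+ 4 * (expR (z / 2) * expR (z / 2)).
    rewrite -(mulrA (16 * _)) -!expRD; congr (_ * expR _).
    by rewrite /z; field; rewrite gt_eqF.
  by rewrite le_eqVlt; apply/orP; left; apply/eqP; ring.
have p1 : 0 <= 1 - s by lra.
have p2 : 0 <= s ^+ 2 * (16 * a ^+ 4 * expR (a ^- 2)).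
  by rewrite !mulr_ge0 ?sqr_ge0 ?exprn_ge0 ?expR_ge0// ltW.
apply: mean_le_mono (mean_leD (mean_leD (mean_le_cst P p1) (mean_leZ s0 var))
  (mean_leZ p2 psi)) => //.
- apply: (mcomp (phi := fun x => expR (s * (x ^+ 2 - 1)))).
  apply: measurableT_comp => //.
  by apply: measurable_funM => //; exact: measurable_funB.
- apply: le_trans (expR_ge1Dx _); rewrite /square_rate; lra.
Qed.

(** The exponent is nonzero only when [M < |W|]; there, half of [W^2 / a^2] is
   given up for the factor [exp (- M^2 / (2 a^2))]. *)
Lemma mean_exp_excess M : 0 <= M ->
  mean_le P (fun w => expR ((W w - clip M (W w)) ^+ 2 / (2 * a ^+ 2)))
    (1 + 2 * expR (- (M ^+ 2 / (2 * a ^+ 2)))).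
Proof.
move=> M0.
have bound x : expR ((x - clip M x) ^+ 2 / (2 * a ^+ 2)) <=
    1 + expR (- (M ^+ 2 / (2 * a ^+ 2))) * expR (x ^+ 2 / a ^+ 2).
  rewrite /clip; case: ifPn => [_|].
    rewrite subrr expr0n mul0r expR0 lerDl mulr_ge0 ?expR_ge0//.
  rewrite -ltNge subr0 -expRD => xM.
  apply: ler_wpDl => //; rewrite ler_expR.
  have M2 : M ^+ 2 <= x ^+ 2.
    by rewrite -(real_normK (num_real x)) lerXn2r ?nnegrE// ltW.
  have -> : x ^+ 2 / a ^+ 2 = 2 * (x ^+ 2 / (2 * a ^+ 2)).
    by field; rewrite gt_eqF.
  have i0 : 0 < (2 * a ^+ 2)^-1 by rewrite invr_gt0 mulr_gt0.
  by have := ler_wpM2r (ltW i0) M2; lra.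
have e0 : 0 <= expR (- (M ^+ 2 / (2 * a ^+ 2))) by exact: expR_ge0.
apply: mean_le_mono (mean_leD (mean_le_cst P ler01) (mean_leZ e0 psi)) => //.
- apply: (mcomp (phi := fun x => expR ((x - clip M x) ^+ 2 / (2 * a ^+ 2)))).
  apply: measurableT_comp => //; apply: measurable_funM => //; apply: measurable_funX.
  by apply: measurable_funB => //; exact: measurable_clip.
- lra.
Qed.

(** On the clipped values [s W^4 <= s M^2 W^2], which the hypothesis on [s] makes
   at most half of [W^2 / a^2]. *)
Lemma mean_exp_clip_fourth M s : 0 <= M -> 0 <= s -> s * M ^+ 2 <= (2 * a ^+ 2)^-1 ->
  mean_le P (fun w => expR (s * clip M (W w) ^+ 4)) (expR (32 * a ^+ 4 * s)).
Proof.
move=> M0 s0 sM.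
have bound x : expR (s * clip M x ^+ 4) <=
    1 + s * (16 * a ^+ 4) * expR (x ^+ 2 / a ^+ 2).
  set y := clip M x.
  have yx : y ^+ 2 <= x ^+ 2.
    by rewrite /y /clip; case: ifP => _ //; rewrite expr0n sqr_ge0.
  have yM : y ^+ 2 <= M ^+ 2.
    by rewrite -(real_normK (num_real y)) lerXn2r ?nnegrE// normr_clip_le.
  pose z := x ^+ 2 / a ^+ 2.
  have z0 : 0 <= z by rewrite divr_ge0 ?sqr_ge0// ltW.
  have zE : x ^+ 2 = a ^+ 2 * z by rewrite /z mulrCA divff ?mulr1// gt_eqF.
  have y4 : s * y ^+ 4 <= z / 2.
    rewrite (_ : y ^+ 4 = y ^+ 2 * y ^+ 2); last by ring.
    rewrite mulrA; apply: (@le_trans _ _ ((2 * a ^+ 2)^-1 * x ^+ 2)).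
      apply: ler_pM yx => //; [exact: mulr_ge0 (sqr_ge0 _)|exact: sqr_ge0|].
      by apply: (le_trans _ sM); rewrite ler_wpM2l.
    by rewrite /z le_eqVlt; apply/orP; left; apply/eqP; field; rewrite gt_eqF.
  apply: le_trans (expR_le_mul _) _; rewrite lerD2l -!(mulrA s) ler_wpM2l//.
  apply: (@le_trans _ _ ((a ^+ 2 * z) ^+ 2 * expR (z / 2))).
    have e4 : y ^+ 4 = (y ^+ 2) ^+ 2 by ring.
    apply: ler_pM; rewrite ?expR_ge0 ?ler_expR//; first by rewrite e4 sqr_ge0.
    by rewrite e4 -zE lerXn2r ?nnegrE ?sqr_ge0.
  rewrite exprMn.
  apply: (@le_trans _ _ ((a ^+ 2) ^+ 2 * (16 * expR (z / 2)) * expR (z / 2))).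
    rewrite ler_wpM2r ?expR_ge0// ler_wpM2l ?sqr_ge0//; exact: sqr_le_expR.
  have -> : 16 * a ^+ 4 * expR z = 16 * a ^+ 4 * (expR (z / 2) * expR (z / 2)).
    by rewrite -expRD; congr (_ * expR _); field.
  by rewrite le_eqVlt; apply/orP; left; apply/eqP; ring.
have e0 : 0 <= s * (16 * a ^+ 4) by rewrite mulr_ge0// mulr_ge0// exprn_ge0// ltW.
apply: mean_le_mono (mean_leD (mean_le_cst P ler01) (mean_leZ e0 psi)) => //.
- apply: (mcomp (phi := fun x => expR (s * clip M x ^+ 4))).
  apply: measurableT_comp => //; apply: measurable_funM => //; apply: measurable_funX.
  exact: measurable_clip.
- apply: le_trans (expR_ge1Dx _); lra.
Qed.

End one_variable.
End subgaussian.

Section vector_moments.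
Context disp (T : measurableType disp) (R : realType).
Variables (P : probability T R) (n : nat) (X : 'I_n -> {RV P >-> R}) (a : R).
Hypothesis n0 : (0 < n)%N.
Hypothesis indep : mutually_independent X.
Hypothesis a0 : 0 < a.
Hypothesis psi : forall i, mean_le P (fun w => expR (X i w ^+ 2 / a ^+ 2)) 2.
Hypothesis var : forall i, mean_le P (fun w => X i w ^+ 2) 1.

Definition rowX (w : T) : 'rV[R]_n := \row_i X i w.
Definition clipX (M : R) (w : T) : 'rV[R]_n := \row_i clip M (X i w).

Lemma measurable_rowX : measurable_row rowX.
Proof. by move=> i; rewrite (_ : (fun w => _) = X i)//; apply/funext => w; rewrite mxE. Qed.

Lemma measurable_clipX M : measurable_row (clipX M).
Proof.
move=> i; rewrite (_ : (fun w => _) = clip M \o X i).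
  by apply: measurableT_comp => //; exact: measurable_clip.
by apply/funext => w; rewrite mxE.
Qed.

Lemma measurable_rowB (Y Y' : T -> 'rV[R]_n) : measurable_row Y -> measurable_row Y' -> measurable_row (fun w => Y w - Y' w).
Proof.
move=> mY mY' i; rewrite (_ : (fun w => _) = fun w => Y w ord0 i - Y' w ord0 i).
  exact: measurable_funB.
by apply/funext => w; rewrite !mxE.
Qed.

Let nR : (0 : R) < n%:R. Proof. by rewrite ltr0n. Qed.

Lemma prod_expR (F : 'I_n -> R) : \prod_i expR (F i) = expR (\sum_i F i).
Proof. by rewrite (big_morph _ (@expRD R) (@expR0 R)). Qed.

(** [y^j <= exp (j (y - 1))] turns a power of the average of the squares into a
   product of independent exponentials. *)
Lemma mean_dotr_rowX (j : nat) : j%:R / n%:R <= 1 :> R ->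
  j%:R / n%:R <= (2 * a ^+ 2)^-1 ->
  mean_le P (fun w => (dotr (rowX w) (rowX w) / n%:R) ^+ j)
    (expR (square_rate a * (j%:R ^+ 2 / n%:R))).
Proof.
move=> j1 ja; set s : R := j%:R / n%:R.
have s0 : 0 <= s by rewrite divr_ge0.
pose phi x := expR (s * (x ^+ 2 - 1)).
have mphi : measurable_fun setT phi.
  apply: measurableT_comp => //.
  by apply: measurable_funM => //; exact: measurable_funB.
have := mean_le_prod indep mphi (fun=> expR_ge0 _)
  (fun i => mean_exp_centred_square a0 (psi i) (var i) s0 j1 ja).
have d0 w : 0 <= dotr (rowX w) (rowX w) / n%:R by rewrite divr_ge0 ?dotr_ge0// ltW.
apply: mean_le_mono.
- apply: measurable_funX; apply: measurable_funM => //.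
  exact: measurable_dotr measurable_rowX.
- by move=> w; rewrite exprn_ge0.
- move=> w; rewrite prod_expR; apply: le_trans (expR_geX_centred _ _) _ => //.
  rewrite ler_expR le_eqVlt; apply/orP; left; apply/eqP.
  rewrite -mulr_sumr sumrB sumr_const card_ord /dotr.
  under eq_bigr do rewrite !mxE -expr2.
  by rewrite /s; field; rewrite gt_eqF.
- rewrite -expRM_natr ler_expR /s le_eqVlt; apply/orP; left; apply/eqP.
  by field; rewrite gt_eqF.
Qed.

Definition excess (M : R) (w : T) : R :=
  dotr (rowX w - clipX M w) (rowX w - clipX M w).

(** Each of the [n] coordinates contributes about [exp (- M^2 / (2 a^2)) <= k / n]
   to the logarithm of the exponential moment, hence [k] in total. *)
Lemma mean_excess (M : R) (k : nat) : (0 < k)%N -> 0 <= M ->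
  expR (- (M ^+ 2 / (2 * a ^+ 2))) <= k%:R / n%:R ->
  mean_le P (fun w => (excess M w / k%:R) ^+ k) ((2 * a ^+ 2 * expR 2) ^+ k).
Proof.
move=> k0 M0 Mk.
have kR : (0 : R) < k%:R by rewrite ltr0n.
pose phi x := expR ((x - clip M x) ^+ 2 / (2 * a ^+ 2)).
have mphi : measurable_fun setT phi.
  apply: measurableT_comp => //; apply: measurable_funM => //; apply: measurable_funX.
  by apply: measurable_funB => //; exact: measurable_clip.
have b0 : 0 <= (2 * a ^+ 2) ^+ k by rewrite exprn_ge0// mulr_ge0// exprn_ge0// ltW.
have b1 : 0 < 2 * a ^+ 2 by rewrite mulr_gt0// exprn_gt0.
have e0 w : 0 <= excess M w by exact: dotr_ge0.
have := mean_leZ b0 (mean_le_prod indep mphi (fun=> expR_ge0 _)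
  (fun i => mean_exp_excess a0 (psi i) M0)).
apply: mean_le_mono.
- apply: measurable_funX; apply: measurable_funM => //.
  by apply: measurable_dotr; apply: measurable_rowB; [exact: measurable_rowX|exact: measurable_clipX].
- by move=> w; rewrite exprn_ge0// divr_ge0// ltW.
- move=> w; rewrite prod_expR.
  have -> : \sum_i (X i w - clip M (X i w)) ^+ 2 / (2 * a ^+ 2) =
      excess M w / (2 * a ^+ 2).
    rewrite -mulr_suml; congr (_ / _).
    by apply: eq_bigr => i _; rewrite !mxE expr2.
  have z0 : 0 <= excess M w / (2 * a ^+ 2) by rewrite divr_ge0// ltW.
  have := expR_geX k z0.
  rewrite (expr_div_n (excess M w)) (expr_div_n (excess M w)).
  rewrite ler_pdivrMr ?exprn_gt0// => h.
  by rewrite ler_pdivrMr ?exprn_gt0//; lra.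
- rewrite [leRHS]exprMn ler_wpM2l// -expRM_natr.
  have p0 : 0 <= 1 + 2 * expR (- (M ^+ 2 / (2 * a ^+ 2))) by rewrite addr_ge0// mulr_ge0// expR_ge0.
  apply: (@le_trans _ _ (expR (2 * (k%:R / n%:R)) ^+ n)).
    rewrite lerXn2r ?nnegrE ?expR_ge0//.
    by apply: le_trans (expR_ge1Dx _); lra.
  rewrite -expRM_natr ler_expR le_eqVlt; apply/orP; left; apply/eqP.
  by field; rewrite gt_eqF.
Qed.

Definition fourth_powers (M : R) (w : T) : R := \sum_i clip M (X i w) ^+ 4.

(** With [s = k / n], [(s Q)^k <= k^k exp (s Q)] for the sum [Q] of the fourth
   powers, and each coordinate contributes a multiple of [s] to the exponent. *)
Lemma mean_fourth (M : R) (k : nat) : 0 <= M ->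
  k%:R / n%:R * M ^+ 2 <= (2 * a ^+ 2)^-1 ->
  mean_le P (fun w => (fourth_powers M w / n%:R) ^+ k) (expR (32 * a ^+ 4 * k%:R)).
Proof.
move=> M0 kM; case: k kM => [_|k kM].
  rewrite mulr0 expR0 (_ : (fun w => _) = fun=> 1); first exact: mean_le_cst.
  by apply/funext => w; rewrite expr0.
set K := k.+1 in kM *.
have kR : (0 : R) < K%:R by rewrite ltr0n.
set s : R := K%:R / n%:R in kM *.
have s0 : 0 <= s by rewrite divr_ge0.
pose phi x := expR (s * clip M x ^+ 4).
have mphi : measurable_fun setT phi.
  apply: measurableT_comp => //; apply: measurable_funM => //; apply: measurable_funX.
  exact: measurable_clip.
have f0 w : 0 <= fourth_powers M w.
  apply: sumr_ge0 => i _; rewrite (_ : 4 = 2 * 2)%N// exprM; exact: sqr_ge0.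
have := mean_le_prod indep mphi (fun=> expR_ge0 _)
  (fun i => mean_exp_clip_fourth a0 (psi i) M0 s0 kM).
apply: mean_le_mono.
- apply: measurable_funX; apply: measurable_funM => //.
  apply: measurable_sum => i; apply: measurable_funX.
  by apply: measurableT_comp => //; exact: measurable_clip.
- by move=> w; rewrite exprn_ge0// divr_ge0// ltW.
- move=> w; rewrite prod_expR -mulr_sumr -/(fourth_powers M w).
  have z0 : 0 <= s * fourth_powers M w by rewrite mulr_ge0.
  have := expR_geX K z0.
  rewrite /s mulrAC -mulrA exprMn ler_pM2l ?exprn_gt0//.
- rewrite -expRM_natr ler_expR /s le_eqVlt; apply/orP; left; apply/eqP.
  by field; rewrite gt_eqF.
Qed.

End vector_moments.

(** * Deviations of the clipped variable *)
Section clipping_error.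
Variable R : realType.

Lemma exprB_le (x y : R) d : 0 <= y -> y <= x ->
  x ^+ d - y ^+ d <= d%:R * x ^+ d.-1 * (x - y).
Proof.
move=> y0 yx; have x0 := le_trans y0 yx.
elim: d => [|[|d] IH]; first by rewrite subrr !mul0r.
  by rewrite !expr1 expr0 !mul1r.
have q0 : y ^+ d.+1 <= x ^+ d.+1 by rewrite lerXn2r ?nnegrE.
have := ler_wpM2l x0 IH.
rewrite /= ![_ ^+ d.+2]exprS [d.+2%:R]natr1S [x ^+ d.+1]exprS in q0 *.
have h : 0 <= x - y by rewrite subr_ge0.
have := ler_wpM2r h q0.
move: (x ^+ d) (y ^+ d.+1) (d.+1%:R : R) => p q D; lra.
Qed.

(** Orthogonality of [y] and [x - y] gives
   [|x^(x)d - y^(x)d|^2 = |x|^(2d) - |y|^(2d)], hence a factor [d] where the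
   triangle inequality gives [d^2]. *)
Lemma tensor_norm_powerB_orth n d (x y : 'rV[R]_n) : dotr y (x - y) = 0 ->
  tensor_norm (tensor_power d x - tensor_power d y) ^+ 2 <=
  d%:R * dotr x x ^+ d.-1 * dotr (x - y) (x - y).
Proof.
move=> o.
have yx : dotr y x = dotr y y by apply/eqP; rewrite -subr_eq0 -dotrBr o.
have hE : dotr (x - y) (x - y) = dotr x x - dotr y y.
  by rewrite dotrBr (dotrC _ y) o subr0 dotrC dotrBr (dotrC x y) yx.
rewrite sqr_tensor_norm tensor_dotBr !tensor_dotBl !tensor_dot_power (dotrC x y) yx.
rewrite hE; apply: le_trans (exprB_le d (dotr_ge0 y) _); last first.
  by rewrite -subr_ge0 -hE dotr_ge0.
lra.
Qed.

End clipping_error.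

Section deviations.
Context disp (T : measurableType disp) (R : realType).
Variables (P : probability T R) (n d : nat) (X : 'I_n -> {RV P >-> R}) (a : R).
Hypothesis n0 : (0 < n)%N.
Hypothesis d0 : (0 < d)%N.
Hypothesis indep : mutually_independent X.
Hypothesis a0 : 0 < a.
Hypothesis psi : forall i, mean_le P (fun w => expR (X i w ^+ 2 / a ^+ 2)) 2.
Hypothesis var : forall i, mean_le P (fun w => X i w ^+ 2) 1.
Variables (L : R) (f : tensor_space R n d -> R).
Hypotheses (L0 : 0 < L) (cf : convex_function setT f) (lf : tensor_lipschitz L f).
Variables (k : nat) (M : R).
Hypotheses (k0 : (0 < k)%N) (M0 : 0 <= M).
Hypothesis dk1 : 2 * d%:R ^+ 2 * (k%:R / n%:R) <= 1 :> R.
Hypothesis dka : 2 * d%:R ^+ 2 * (k%:R / n%:R) <= (2 * a ^+ 2)^-1.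
Hypothesis Mk : expR (- (M ^+ 2 / (2 * a ^+ 2))) <= k%:R / n%:R.
Hypothesis kM : 2 * (k%:R / n%:R) * M ^+ 2 <= (2 * a ^+ 2)^-1.

Let nR : (0 : R) < n%:R. Proof. by rewrite ltr0n. Qed.
Let kR : (0 : R) < k%:R. Proof. by rewrite ltr0n. Qed.
Let dR : (1 : R) <= d%:R. Proof. by rewrite ler1n. Qed.
Let dd2 : d%:R <= d%:R ^+ 2 :> R.
Proof. by rewrite expr2 ler_peMr// ltW// (lt_le_trans ltr01). Qed.
Let r0 : 0 <= k%:R / n%:R :> R. Proof. by rewrite divr_ge0. Qed.
Let A := square_rate a.
Let A0 : 0 <= A.
Proof. by rewrite /A /square_rate mulr_ge0 ?expR_ge0// mulr_ge0// exprn_ge0// ltW. Qed.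

Let rX := rowX X.
Let cX := clipX X M.

Let mean_alpha (j : nat) : (j <= d)%N ->
  mean_le P (fun w => (dotr (rX w) (rX w) / n%:R) ^+ (j * k)) (expR A ^+ k) /\
  mean_le P (fun w => (dotr (rX w) (rX w) / n%:R) ^+ (2 * j * k)) (expR (4 * A) ^+ k).
Proof.
move=> jd.
have jdR : (j%:R : R) <= d%:R by rewrite ler_nat.
have j0 : (0 : R) <= j%:R by [].
have jd2 : 2 * (j%:R * (k%:R / n%:R)) <= 2 * d%:R ^+ 2 * (k%:R / n%:R) :> R.
  rewrite mulrA ler_wpM2r// ler_pM2l//; exact: le_trans jdR dd2.
have j2d2 : j%:R ^+ 2 * (k%:R / n%:R) <= 1 :> R.
  apply: (le_trans _ dk1); rewrite ler_wpM2r//.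
  have : j%:R ^+ 2 <= d%:R ^+ 2 :> R by rewrite lerXn2r ?nnegrE.
  by have := sqr_ge0 (d%:R : R); lra.
have jk : 0 <= j%:R * (k%:R / n%:R) :> R by rewrite mulr_ge0.
have e1 : (j * k)%:R / n%:R = j%:R * (k%:R / n%:R) :> R by rewrite natrM mulrA.
have e2 : (2 * j * k)%:R / n%:R = 2 * (j%:R * (k%:R / n%:R)) :> R.
  by rewrite !natrM !mulrA.
have mo (i : nat) : measurable_fun setT (fun w => (dotr (rX w) (rX w) / n%:R) ^+ i).
  apply: measurable_funX; apply: measurable_funM => //.
  exact: measurable_dotr (measurable_rowX _).
have po (i : nat) w : 0 <= (dotr (rX w) (rX w) / n%:R) ^+ i.
  by rewrite exprn_ge0// divr_ge0 ?dotr_ge0// ltW.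
split.
  have := mean_dotr_rowX n0 indep a0 psi var (j := (j * k)%N).
  have c : j%:R * (k%:R / n%:R) <= 2 * d%:R ^+ 2 * (k%:R / n%:R) :> R by lra.
  rewrite e1 => m; have {}m := m (le_trans c dk1) (le_trans c dka).
  apply: mean_le_mono m => //.
  rewrite -expRM_natr ler_expR -/A ler_wpM2l// natrM.
  rewrite (_ : (j%:R * k%:R) ^+ 2 / n%:R = j%:R ^+ 2 * (k%:R / n%:R) * k%:R); last first.
    by field; rewrite gt_eqF.
  by rewrite -[leRHS]mul1r ler_wpM2r// ltW.
have := mean_dotr_rowX n0 indep a0 psi var (j := (2 * j * k)%N).
rewrite e2 => m; have {}m := m (le_trans jd2 dk1) (le_trans jd2 dka).
apply: mean_le_mono m => //.
rewrite -expRM_natr ler_expR -/A (mulrC 4) -[leRHS]mulrA ler_wpM2l// !natrM.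
rewrite (_ : (2 * j%:R * k%:R) ^+ 2 / n%:R = 4 * (j%:R ^+ 2 * (k%:R / n%:R) * k%:R)); last first.
  by field; rewrite gt_eqF.
by rewrite ler_wpM2l// -[leRHS]mul1r ler_wpM2r// ltW.
Qed.

(** The variance proxy: the deviations of [Z] have [k]-th moments of the order of
   those of a Gaussian variable with this variance. *)
Definition deviation_scale : R := L ^+ 2 * n%:R ^+ d.-1 * (d%:R * M ^+ 2 + d%:R ^+ 2).

(** The squared distance of the two tensor powers is at most
   [d |X|^(2d-2) |X - Y|^2] for the clipped vector [Y].  The first factor has
   moments of the order of [n^(d-1)], and [|X - Y|^2] of the order of [k]. *)
Lemma mean_clip_error :
  mean_le P (fun w => `|f (tensor_power d (rX w)) - f (tensor_power d (cX w))| ^+ k)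
    ((Num.sqrt (k%:R * deviation_scale) * (expR (square_rate a) + 2 * a ^+ 2 * expR 2)) ^+ k).
Proof.
pose S := Num.sqrt (k%:R * deviation_scale).
have sqrS : S ^+ 2 = k%:R * deviation_scale.
  rewrite sqr_sqrtr// mulr_ge0 ?(ltW kR)// mulr_ge0//.
    by rewrite mulr_ge0 ?sqr_ge0// exprn_ge0// ltW.
  by rewrite addr_ge0 ?sqr_ge0// mulr_ge0 ?sqr_ge0.
have s0 : 0 <= S ^+ k by rewrite exprn_ge0// sqrtr_ge0.
have [m1 _] := mean_alpha (leq_pred d).
have m2 := mean_excess n0 indep a0 psi k0 M0 Mk.
have := mean_leZ s0 (mean_leD m1 m2).
apply: mean_le_mono.
- apply: measurable_funX; apply: measurableT_comp => //; apply: measurable_funB.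
    exact: measurable_tensor_power (ltW L0) lf (measurable_rowX _).
  exact: measurable_tensor_power (ltW L0) lf (measurable_clipX _ _).
- by move=> w; rewrite exprn_ge0.
- move=> w.
  have o : dotr (cX w) (rX w - cX w) = 0.
    by rewrite /dotr big1// => i _; rewrite !mxE clip_mul.
  pose u := (dotr (rX w) (rX w) / n%:R) ^+ d.-1; pose v := excess X M w / k%:R.
  have u0 : 0 <= u by rewrite exprn_ge0// divr_ge0 ?dotr_ge0// ltW.
  have v0 : 0 <= v by rewrite divr_ge0 ?dotr_ge0// ltW.
  have le : `|f (tensor_power d (rX w)) - f (tensor_power d (cX w))| <=
      S * Num.sqrt (u * v).
    apply: le_trans (lf _ _) _.
    have p1 : 0 <= L * tensor_norm (tensor_power d (rX w) - tensor_power d (cX w)).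
      by rewrite mulr_ge0 ?tensor_norm_ge0// ltW.
    have p2 : 0 <= S * Num.sqrt (u * v) by rewrite mulr_ge0 ?sqrtr_ge0.
    rewrite -(@ler_pXn2r _ 2) ?nnegrE//.
    rewrite [leLHS]exprMn [leRHS]exprMn sqrS (@sqr_sqrtr _ (u * v) (mulr_ge0 u0 v0)).
    apply: (@le_trans _ _ (L ^+ 2 * (d%:R * dotr (rX w) (rX w) ^+ d.-1 * excess X M w))).
      rewrite ler_wpM2l ?sqr_ge0//; exact: tensor_norm_powerB_orth.
    have -> : dotr (rX w) (rX w) ^+ d.-1 = n%:R ^+ d.-1 * u.
      by rewrite /u -exprMn mulrCA divff ?mulr1// gt_eqF.
    have -> : excess X M w = k%:R * v by rewrite /v mulrCA divff ?mulr1// gt_eqF.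
    rewrite /deviation_scale.
    have c0 : 0 <= L ^+ 2 * n%:R ^+ d.-1 * k%:R * (u * v).
      apply: mulr_ge0; last exact: mulr_ge0.
      apply: mulr_ge0; last exact: ltW.
      by apply: mulr_ge0; [exact: sqr_ge0|rewrite exprn_ge0// ltW].
    have dd : d%:R <= d%:R * M ^+ 2 + d%:R ^+ 2 :> R.
      by apply: le_trans dd2 _; rewrite lerDr mulr_ge0 ?sqr_ge0.
    have := ler_wpM2l c0 dd; lra.
  apply: (@le_trans _ _ ((S * Num.sqrt (u * v)) ^+ k)).
    by apply: lerXn2r => //; rewrite nnegrE ?normr_ge0// mulr_ge0 ?sqrtr_ge0.
  rewrite exprMn ler_wpM2l// -/v exprM -/u sqrtrM// exprMn.
  have -> : u ^+ k = (Num.sqrt u ^+ k) ^+ 2 by rewrite exprAC sqr_sqrtr.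
  have -> : v ^+ k = (Num.sqrt v ^+ k) ^+ 2 by rewrite exprAC sqr_sqrtr.
  have := sqr_ge0 (Num.sqrt u ^+ k - Num.sqrt v ^+ k).
  have := sqr_ge0 (Num.sqrt u ^+ k + Num.sqrt v ^+ k).
  move: (Num.sqrt u ^+ k) (Num.sqrt v ^+ k) => p q; nra.
- rewrite -/S [leRHS]exprMn ler_wpM2l//; apply: exprD_ge; rewrite ?expR_ge0//.
  by rewrite mulr_ge0 ?expR_ge0// mulr_ge0// exprn_ge0// ltW.
Qed.

(** Each exchange of coordinates preserves the mean, hence so does their
   average. *)
Lemma mean_le_average (H : (n + n).-tuple R -> R) c :
  measurable_fun [set: (n + n).-tuple R] H -> (forall u, 0 <= H u) ->
  mean_le (P \x P)%E
    (fun w => (2 ^+ n)^-1 * \sum_(e : cube n) H (swapped X (fun i => bit e i) w)) c ->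
  mean_le (P \x P)%E (fun w => H (swapped X (fun=> false) w)) c.
Proof.
move=> mH H0 [_ _ ic].
have mS J : measurable_fun setT (fun w => H (swapped X J w)).
  by apply: measurableT_comp => //; exact: measurable_swapped.
split => //; apply: le_trans ic; rewrite le_eqVlt; apply/orP; left; apply/eqP.
have c0 : 0 <= (2 ^+ n)^-1 :> R by rewrite invr_ge0 exprn_ge0.
set I := (\int[_]_x _)%E.
under eq_integral do rewrite mulr_sumr -sumEFin.
rewrite ge0_integral_sum//; last 2 first.
- by move=> e; apply/measurable_EFinP; exact: measurable_funM.
- by move=> e w _; rewrite lee_fin mulr_ge0.
transitivity (\sum_(e : cube n) ((2 ^+ n)^-1)%:E * I)%E.
  rewrite -ge0_sume_distrl; last by move=> e _; rewrite lee_fin.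
  by rewrite sumEFin sumr_const card_cube -[X in X%:E]mulr_natl natrX divff ?mul1e//.
apply: eq_bigr => e _.
under eq_integral do rewrite EFinM.
rewrite ge0_integralZl_EFin//; last 2 first.
- by move=> w _; rewrite lee_fin.
- exact/measurable_EFinP.
congr (_ * _)%E; rewrite /I.
rewrite -(integral_swapped indep (fun i => bit e i) (H := EFin \o H))//.
exact/measurable_EFinP.
Qed.

Let lrow (u : (n + n).-tuple R) : 'rV[R]_n := \row_i clip M (tnth u (lshift n i)).
Let rrow (u : (n + n).-tuple R) : 'rV[R]_n := \row_i clip M (tnth u (rshift n i)).

Let measurable_lrow : measurable_row lrow.
Proof.
move=> i; rewrite (_ : (fun w => _) = clip M \o (@tnth _ R ^~ (lshift n i))).
  by apply: measurableT_comp; [exact: measurable_clip|exact: measurable_tnth].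
by apply/funext => w; rewrite mxE.
Qed.

Let measurable_rrow : measurable_row rrow.
Proof.
move=> i; rewrite (_ : (fun w => _) = clip M \o (@tnth _ R ^~ (rshift n i))).
  by apply: measurableT_comp; [exact: measurable_clip|exact: measurable_tnth].
by apply/funext => w; rewrite mxE.
Qed.

Let lrow_swapped (e : cube n) w :
  lrow (swapped X (fun i => bit e i) w) = mixv (cX w.1) (cX w.2) e.
Proof.
by apply/rowP => i; rewrite !mxE swapped_lshift; case: (bit e i).
Qed.

Let rrow_swapped (e : cube n) w :
  rrow (swapped X (fun i => bit e i) w) = mixv (cX w.1) (cX w.2) (cubeN e).
Proof.
by apply/rowP => i; rewrite !mxE swapped_rshift bit_cubeN; case: (bit e i).
Qed.

Let lrow_id w : lrow (swapped X (fun=> false) w) = cX w.1.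
Proof. by apply/rowP => i; rewrite !mxE swapped_lshift. Qed.

Let rrow_id w : rrow (swapped X (fun=> false) w) = cX w.2.
Proof. by apply/rowP => i; rewrite !mxE swapped_rshift. Qed.

Let quartic_swapped (e : cube n) (u v : 'rV[R]_n) :
  quartic (mixv u v e) (mixv u v (cubeN e)) = quartic u v.
Proof.
congr (_ * _); apply: eq_bigr => i _; rewrite !mxE bit_cubeN.
by case: (bit e i) => //=; rewrite addrC.
Qed.

Definition weight_const : R := 2 * (expR (square_rate a) + expR (4 * square_rate a) + 2 * 36 * expR (64 * a ^+ 4)).

Let scale_gt0 : 0 < deviation_scale.
Proof.
rewrite /deviation_scale mulr_gt0 ?mulr_gt0 ?exprn_gt0//.
by rewrite ltr_wpDl ?mulr_ge0 ?sqr_ge0// exprn_gt0// (lt_le_trans ltr01).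
Qed.

Let sqr_mix_weight_le w :
  mix_weight d L M (cX w.1) (cX w.2) (cX w.1) ^+ 2 <=
  128 * deviation_scale * ((dotr (rX w.1) (rX w.1) / n%:R) ^+ d.-1 +
    (dotr (rX w.1) (rX w.1) / n%:R) ^+ d.-2 *
      (quartic (cX w.1) (cX w.2) / n%:R)).
Proof.
set alpha := dotr (rX _) _ / _; set Q := quartic _ _; set x := cX w.1; set N := normv x.
have Q0 : 0 <= Q.
  rewrite mulr_ge0// sumr_ge0// => i _.
  by rewrite addr_ge0// (_ : 4 = 2 * 2)%N// exprM sqr_ge0.
have al0 : 0 <= alpha by rewrite divr_ge0 ?dotr_ge0// ltW.
have N2 : N ^+ 2 <= n%:R * alpha.
  rewrite /alpha mulrCA divff ?gt_eqF// mulr1 sqr_normv.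
  apply: ler_sum => i _; rewrite !mxE -!expr2 /clip; case: ifP => _ //.
  by rewrite expr0n sqr_ge0.
have Npow j : (N ^+ j) ^+ 2 <= n%:R ^+ j * alpha ^+ j.
  by rewrite exprAC -exprMn lerXn2r ?nnegrE ?sqr_ge0// mulr_ge0// ltW.
pose s := Num.sqrt d%:R * N ^+ d.-1 * (2 * M).
pose t := 2 * (d%:R - 1) * N ^+ d.-2 * Num.sqrt Q.
have e1 : mix_weight d L M (cX w.1) (cX w.2) x ^+ 2 <= 32 * L ^+ 2 * (s ^+ 2 + t ^+ 2).
  rewrite /mix_weight -/s -/t exprMn.
  have h : (s + t) ^+ 2 <= 2 * (s ^+ 2 + t ^+ 2).
    by have := sqr_ge0 (s - t); nra.
  have := ler_wpM2l (sqr_ge0 (4 * L)) h; rewrite exprMn; lra.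
have e2 : s ^+ 2 <= 4 * (d%:R * M ^+ 2) * (n%:R ^+ d.-1 * alpha ^+ d.-1).
  have -> : s ^+ 2 = 4 * (d%:R * M ^+ 2) * (N ^+ d.-1) ^+ 2.
    have sd : Num.sqrt d%:R ^+ 2 = d%:R :> R by rewrite sqr_sqrtr.
    by rewrite /s -[in RHS]sd; ring.
  by rewrite ler_wpM2l// mulr_ge0// mulr_ge0// sqr_ge0.
have p1 : 0 <= alpha ^+ d.-1 by rewrite exprn_ge0.
have p2 : 0 <= alpha ^+ d.-2 * (Q / n%:R).
  by rewrite mulr_ge0 ?exprn_ge0// divr_ge0// ltW.
have p3 : 0 <= n%:R ^+ d.-1 :> R by rewrite exprn_ge0// ltW.
have e3 : t ^+ 2 <= 4 * d%:R ^+ 2 * (n%:R ^+ d.-1 * (alpha ^+ d.-2 * (Q / n%:R))).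
  have -> : t ^+ 2 = 4 * (d%:R - 1) ^+ 2 * ((N ^+ d.-2) ^+ 2 * Q).
    have sQ : Num.sqrt Q ^+ 2 = Q by rewrite sqr_sqrtr.
    by rewrite /t -[in RHS]sQ; ring.
  have [d1|d2] : d = 1%N \/ (2 <= d)%N by case: (d) d0 => [//|[|j]] _; [left|right].
    have -> : d%:R - 1 = 0 :> R by rewrite d1 subrr.
    rewrite expr0n mulr0 mul0r; apply: mulr_ge0; last exact: mulr_ge0 p3 p2.
    by rewrite mulr_ge0// sqr_ge0.
  have -> : n%:R ^+ d.-1 * (alpha ^+ d.-2 * (Q / n%:R)) = n%:R ^+ d.-2 * alpha ^+ d.-2 * Q :> R.
    have -> : d.-1 = d.-2.+1 by rewrite prednK// -ltnS prednK.
    by rewrite exprS; field; rewrite gt_eqF.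
  apply: ler_pM.
  - by rewrite mulr_ge0// sqr_ge0.
  - by rewrite mulr_ge0// sqr_ge0.
  - by rewrite ler_pM2l// lerXn2r ?nnegrE ?subr_ge0//; lra.
  - by rewrite ler_wpM2r.
have p4 : 0 <= d%:R * M ^+ 2 by rewrite mulr_ge0// sqr_ge0.
have p5 : 0 <= d%:R ^+ 2 :> R by rewrite sqr_ge0.
have e4 : s ^+ 2 + t ^+ 2 <= 4 * (n%:R ^+ d.-1 * (d%:R * M ^+ 2 + d%:R ^+ 2)) *
    (alpha ^+ d.-1 + alpha ^+ d.-2 * (Q / n%:R)).
  apply: le_trans (lerD e2 e3) _.
  move: p1 p2 p3 p4 p5.
  move: (alpha ^+ d.-1) (alpha ^+ d.-2 * _) (n%:R ^+ d.-1 : R) (d%:R * M ^+ 2)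
    (d%:R ^+ 2 : R) => p q r y z p1 p2 p3 p4 p5.
  have h1 := mulr_ge0 p3 (mulr_ge0 p4 p2).
  have h2 := mulr_ge0 p3 (mulr_ge0 p5 p1).
  lra.
apply: (le_trans e1); have L2 : 0 <= 32 * L ^+ 2 by rewrite mulr_ge0// sqr_ge0.
have := ler_wpM2l L2 e4; rewrite /deviation_scale; lra.
Qed.

Let measurable_mix_weight d1 (T1 : measurableType d1) (Y Y' : T1 -> 'rV[R]_n) :
  measurable_row Y -> measurable_row Y' ->
  measurable_fun setT (fun w => mix_weight d L M (Y w) (Y' w) (Y w)).
Proof.
move=> mY mY'; have mN := measurable_normv mY.
apply: measurable_funM => //; apply: measurable_funD; apply: measurable_funM => //.
- by apply: measurable_funM => //; exact: measurable_funX.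
- by apply: measurable_funM => //; exact: measurable_funX.
- by apply: measurable_sqrt; exact: measurable_quartic.
Qed.

Let measurable_fst (Y : T -> 'rV[R]_n) : measurable_row Y -> measurable_row (fun w : T * T => Y w.1).
Proof. by move=> mY i; exact: (measurableT_comp (mY i) measurable_fst). Qed.

Let measurable_snd (Y : T -> 'rV[R]_n) : measurable_row Y -> measurable_row (fun w : T * T => Y w.2).
Proof. by move=> mY i; exact: (measurableT_comp (mY i) measurable_snd). Qed.

(** The squared weight is at most a sum of a power of [|X|^2 / n] and of such a power
   times an average of fourth powers; all of them have bounded [k]-th moments. *)
Let mean_weight (lam : R) : 0 < lam ->
  mean_le (P \x P)%E (fun w => (4 * lam *
    mix_weight d L M (cX w.1) (cX w.2) (cX w.1) ^+ 2) ^+ k)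
    ((512 * lam * deviation_scale * weight_const) ^+ k).
Proof.
move=> l0; pose c := 512 * lam * deviation_scale.
have l512 : 0 < 512 * lam by rewrite mulr_gt0.
have c0 : 0 <= c by exact: ltW (mulr_gt0 l512 scale_gt0).
have l40 : 0 <= 4 * lam by rewrite mulr_ge0// ltW.
have [m1 _] := mean_alpha (leq_pred d).
have [_ m2] := mean_alpha (leq_trans (leq_pred _) (leq_pred d)).
have kM2 : (2 * k)%:R / n%:R * M ^+ 2 <= (2 * a ^+ 2)^-1.
  by apply: le_trans kM; rewrite natrM -(mulrA 2).
have m3 := mean_fourth n0 indep a0 psi M0 kM2.
have q0 : 0 <= 36 ^+ k :> R by rewrite exprn_ge0.
have ck : 0 <= c ^+ k * 2 ^+ k by rewrite mulr_ge0 ?exprn_ge0.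
have := mean_leZ ck (mean_leD (mean_leD (mean_le_fst m1) (mean_le_fst m2))
  (mean_leZ q0 (mean_leD (mean_le_fst m3) (mean_le_snd m3)))).
apply: mean_le_mono.
- apply: measurable_funX; apply: measurable_funM => //; apply: measurable_funX.
  by apply: measurable_mix_weight; [apply: measurable_fst|apply: measurable_snd]; exact: measurable_clipX.
- by move=> w; rewrite exprn_ge0// mulr_ge0 ?sqr_ge0.
- move=> w; have := sqr_mix_weight_le w.
  set al := dotr _ _ / _; set y := quartic _ _ / _ => h.
  have al0 : 0 <= al by rewrite divr_ge0 ?dotr_ge0// ltW.
  have four0 v : 0 <= fourth_powers X M v / n%:R.
    rewrite divr_ge0 ?(ltW nR)// sumr_ge0// => i _.
    by rewrite (_ : 4 = 2 * 2)%N// exprM sqr_ge0.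
  have yE : y = 3 * (fourth_powers X M w.1 / n%:R + fourth_powers X M w.2 / n%:R).
    rewrite /y /quartic /fourth_powers -mulrDl -big_split mulrA; congr (_ * _ / _).
    by apply: eq_bigr => i _; rewrite !mxE.
  have y0 : 0 <= y by rewrite yE mulr_ge0// addr_ge0.
  have p0 : 0 <= al ^+ d.-1 by rewrite exprn_ge0.
  have r0' : 0 <= al ^+ d.-2 by rewrite exprn_ge0.
  have h' := ler_wpM2l l40 h.
  have {}h' : 4 * lam * mix_weight d L M (cX w.1) (cX w.2) (cX w.1) ^+ 2 <=
      c * (al ^+ d.-1 + al ^+ d.-2 * y) by rewrite /c; lra.
  apply: (@le_trans _ _ ((c * (al ^+ d.-1 + al ^+ d.-2 * y)) ^+ k)).
    apply: lerXn2r h'; rewrite nnegrE; first exact: mulr_ge0 (sqr_ge0 _).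
    exact: mulr_ge0 c0 (addr_ge0 p0 (mulr_ge0 r0' y0)).
  rewrite exprMn -mulrA ler_wpM2l ?exprn_ge0//.
  apply: le_trans (exprD_le k p0 (mulr_ge0 r0' y0)) _.
  rewrite ler_wpM2l ?exprn_ge0// -addrA [X in _ <= X + _]exprM lerD2l.
  rewrite exprMn.
  have y2k : (y ^+ k) ^+ 2 <= 36 ^+ k * ((fourth_powers X M w.1 / n%:R) ^+ (2 * k) +
      (fourth_powers X M w.2 / n%:R) ^+ (2 * k)).
    have := exprD_le (2 * k) (four0 w.1) (four0 w.2).
    have p3 : 0 <= 3 ^+ (2 * k) :> R by rewrite exprn_ge0.
    move=> /(ler_wpM2l p3); rewrite -exprMn -yE mulrA -exprMn.
    have -> : (y ^+ k) ^+ 2 = y ^+ (2 * k) by rewrite -exprM mulnC.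
    by have -> : 36 ^+ k = (3 * 2) ^+ (2 * k) :> R by rewrite exprM; congr (_ ^+ _); ring.
  have -> : al ^+ (2 * d.-2 * k) = ((al ^+ d.-2) ^+ k) ^+ 2.
    have E : (2 * d.-2 * k = d.-2 * k * 2)%N by rewrite -mulnA mulnC.
    by rewrite E exprM exprM.
  apply: le_trans (lerD (lexx _) y2k).
  have := sqr_ge0 ((al ^+ d.-2) ^+ k - y ^+ k).
  have := sqr_ge0 ((al ^+ d.-2) ^+ k + y ^+ k).
  by move: ((al ^+ d.-2) ^+ k) (y ^+ k) => p q; nra.
- rewrite -/c [leRHS]exprMn -[leLHS]mulrA ler_wpM2l ?exprn_ge0// /weight_const [leRHS]exprMn.
  rewrite ler_wpM2l ?exprn_ge0//.
  have e1 := expR_ge0 A; have e2 := expR_ge0 (4 * A).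
  have e3 := expR_ge0 (64 * a ^+ 4).
  have -> : expR (32 * a ^+ 4 * (2 * k)%:R) = expR (64 * a ^+ 4) ^+ k.
    by rewrite -expRM_natr natrM; congr expR; ring.
  apply: le_trans (exprD_ge k0 (addr_ge0 e1 e2) _); last by rewrite !mulr_ge0.
  apply: lerD; first exact: exprD_ge.
  have h2 : 2 <= 2 ^+ k :> R by rewrite -[leLHS]expr1 ler_eXn2l ?ltr1n.
  have h3 : 0 <= 36 ^+ k * expR (64 * a ^+ 4) ^+ k by rewrite mulr_ge0 ?exprn_ge0.
  rewrite [leRHS](_ : _ = 2 ^+ k * (36 ^+ k * expR (64 * a ^+ 4) ^+ k)); last first.
    by rewrite !exprMn mulrA.
  by have := ler_wpM2r h3 h2; lra.
Qed.

(** Conditionally on the two copies, the average over the exchanges of coordinates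
   is the left-hand side of [mixv_moment]. *)
Lemma mean_clipped :
  mean_le (P \x P)%E
    (fun w => `|f (tensor_power d (cX w.1)) - f (tensor_power d (cX w.2))| ^+ k)
    ((64 * (1 + 512 * weight_const) * Num.sqrt (k%:R * deviation_scale)) ^+ k).
Proof.
have B0 : 0 <= weight_const by rewrite mulr_ge0// !addr_ge0 ?expR_ge0// mulr_ge0 ?expR_ge0.
move: mean_weight scale_gt0 B0.
move: deviation_scale weight_const => V B mean_weightV V0 B0.
pose S := Num.sqrt (k%:R * V).
pose sk : R := Num.sqrt k%:R; pose sv := Num.sqrt V.
have sk0 : 0 < sk by rewrite sqrtr_gt0.
have sv0 : 0 < sv by rewrite sqrtr_gt0.
have SE : S = sk * sv by rewrite /S sqrtrM// ltW.
have sk2 : sk ^+ 2 = k%:R by rewrite sqr_sqrtr// ltW.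
have sv2 : sv ^+ 2 = V by rewrite sqr_sqrtr// ltW.
(* Balances the two terms of [mixv_moment]: [k / lam = lam V = S]. *)
pose lam := sk / sv.
have l0 : 0 < lam by rewrite divr_gt0.
have l1 : k%:R / lam = S.
  by rewrite SE -sk2 /lam; field; rewrite !gt_eqF.
have l2 : lam * V = S.
  by rewrite SE -sv2 /lam; field; rewrite gt_eqF.
have S0 : 0 <= S by exact: sqrtr_ge0.
pose H1 (u : (n + n).-tuple R) :=
  `|f (tensor_power d (lrow u)) - f (tensor_power d (rrow u))| ^+ k.
pose H2 (u : (n + n).-tuple R) :=
  (4 * lam * mix_weight d L M (lrow u) (rrow u) (lrow u) ^+ 2) ^+ k.
have H10 u : 0 <= H1 u by rewrite exprn_ge0.
have H20 u : 0 <= H2 u.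
  by rewrite exprn_ge0// mulr_ge0 ?sqr_ge0// mulr_ge0// ltW.
have mH1 : measurable_fun [set: (n + n).-tuple R] H1.
  apply: measurable_funX; apply: measurableT_comp => //; apply: measurable_funB.
    exact: measurable_tensor_power (ltW L0) lf measurable_lrow.
  exact: measurable_tensor_power (ltW L0) lf measurable_rrow.
have mH2 : measurable_fun [set: (n + n).-tuple R] H2.
  have m2 := measurable_funX 2 (measurable_mix_weight measurable_lrow measurable_rrow).
  apply: measurable_funX; apply: measurable_funM m2; exact: measurable_cst.
have [W WE] : exists W, W = 512 * S * B by exists (512 * S * B).
have W0 : 0 <= W by rewrite WE; exact: mulr_ge0 (mulr_ge0 (ler0n R 512) S0) B0.
have mW (e : cube n) : mean_le (P \x P)%E
    (fun w => H2 (swapped X (fun i => bit e i) w)) (W ^+ k).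
  apply: (mean_le_swapped indep) => //; rewrite WE.
  have -> : 512 * S * B = 512 * lam * V * B.
    by rewrite -l2 (mulrA 512 lam).
  rewrite (_ : (fun w => _) = fun w => (4 * lam *
    mix_weight d L M (cX w.1) (cX w.2) (cX w.1) ^+ 2) ^+ k); first exact: mean_weightV.
  by apply/funext => w; rewrite /H2 lrow_id rrow_id.
have c0 : 0 <= (2 ^+ n)^-1 :> R by rewrite invr_ge0 exprn_ge0.
have s0 : 0 <= S ^+ k by rewrite exprn_ge0.
have c64 : 0 <= 64 ^+ k :> R by rewrite exprn_ge0.
have mS := mean_leZ c64 (mean_leD (mean_le_cst (P \x P)%E s0)
  (mean_leZ c0 (mean_le_sum (index_enum (cube n)) mW))).
rewrite (_ : (fun w => _) = fun w => H1 (swapped X (fun=> false) w)); last first.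
  by apply/funext => w; rewrite /H1 lrow_id rrow_id.
apply: mean_le_average => //.
have clipM v : forall i, `|cX v ord0 i| <= M.
  by move=> i; rewrite mxE normr_clip_le.
apply: mean_le_mono mS => //.
- apply: measurable_funM => //; apply: measurable_sum => e.
  by apply: measurableT_comp => //; exact: measurable_swapped.
- by move=> w; rewrite mulr_ge0// sumr_ge0.
- move=> w.
  have := mixv_moment d0 (ltW L0) cf lf M0 (clipM w.1) (clipM w.2) k0 l0.
  rewrite l1 => h.
  rewrite (eq_bigr (fun e : cube n =>
      `|f (tensor_power d (mixv (cX w.1) (cX w.2) e)) -
        f (tensor_power d (mixv (cX w.1) (cX w.2) (cubeN e)))| ^+ k)); last first.
    by move=> e _; rewrite /H1 lrow_swapped rrow_swapped.
  have E2 (e : cube n) : H2 (swapped X (fun i => bit e i) w) =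
      (4 * lam * mix_weight d L M (cX w.1) (cX w.2) (mixv (cX w.1) (cX w.2) e) ^+ 2) ^+ k.
    by rewrite /H2 lrow_swapped rrow_swapped /mix_weight quartic_swapped.
  rewrite (eq_bigr _ (fun e _ => E2 e)).
  apply: (le_trans (ler_wpM2l c0 h)).
  have p2 : 2 ^+ n != 0 :> R by rewrite expf_neq0.
  have E (Y p q s : R) : p != 0 -> p^-1 * (q * (s * p + Y)) <= q * (s + p^-1 * Y).
    by move=> p0; rewrite le_eqVlt; apply/orP; left; apply/eqP; field.
  exact: E p2.
- have -> : \sum_(e : cube n) W ^+ k = 2 ^+ n * W ^+ k.
    by rewrite sumr_const card_cube -[LHS]mulr_natl natrX.
  rewrite mulKf ?expf_neq0// -/S.
  have -> : 64 * (1 + 512 * B) * S = 64 * (S + W).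
    by rewrite WE; ring.
  rewrite [leRHS]exprMn ler_wpM2l//; exact: exprD_ge.
Qed.

End deviations.

(** * From two independent copies to the mean *)

Section centering.
Context disp (T : measurableType disp) (R : realType).
Variables (P : probability T R) (Z : T -> R) (k : nat) (D : R).
Hypotheses (k0 : (0 < k)%N) (D0 : 0 < D) (mZ : measurable_fun setT Z).

Lemma le1DX (t : R) (j : nat) : (0 < j)%N -> 0 <= t -> t <= 1 + t ^+ j.
Proof.
case: j => // j _ t0; have [t1|t1] := leP t 1.
  by apply: (le_trans t1); rewrite lerDl exprn_ge0.
apply: (@le_trans _ _ (t ^+ j.+1)); last by rewrite lerDr.
by rewrite exprS ler_peMr// exprn_ege1// ltW.
Qed.

(** The mean over the second copy is not below all of its sections: some value
   [Z v] of that copy serves as centre. *)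
Lemma exists_centre :
  mean_le (P \x P)%E (fun w => `|Z w.1 - Z w.2| ^+ k) (D ^+ k) ->
  exists m, mean_le P (fun w => `|Z w - m| ^+ k) ((2 * D) ^+ k).
Proof.
move=> [mF F0 iF].
have mc m : measurable_fun setT (fun w => `|Z w - m| ^+ k).
  apply: measurable_funX; apply: measurableT_comp => //; exact: measurable_funB.
have Dk : 0 < D ^+ k by rewrite exprn_gt0.
have [[v hv]|no] := pselect (exists v, (\int[P]_w (`|Z w - Z v| ^+ k)%:E <= ((2 * D) ^+ k)%:E)%E).
  by exists (Z v); split.
exfalso; have {}no v : (((2 * D) ^+ k)%:E <= \int[P]_w (`|Z w - Z v| ^+ k)%:E)%E.
  by apply/ltW; rewrite ltNge; apply/negP => h; apply: no; exists v.
have : (((2 * D) ^+ k)%:E <= (D ^+ k)%:E)%E.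
  apply: le_trans iF.
  rewrite (fubini_tonelli2 (fun w : T * T => (`|Z w.1 - Z w.2| ^+ k)%:E)) => [||w].
  - rewrite -(integral_probability_cst P ((2 * D) ^+ k)%:E).
    apply: ge0_le_integral => //.
    + by move=> w _; rewrite lee_fin exprn_ge0// mulr_ge0// ltW.
    + apply: (measurable_fun_fubini_tonelli_G (fun w : T * T => (`|Z w.1 - Z w.2| ^+ k)%:E)).
        exact/measurable_EFinP.
      by move=> w; rewrite lee_fin.
    + by move=> v _; exact: no.
  - exact/measurable_EFinP.
  - by rewrite lee_fin.
rewrite lee_fin exprMn ger_pMl// leNgt => /negP; apply.
by rewrite exprn_egt1// ?ltr1n// -lt0n.
Qed.

(** The mean of [Z] is within the mean of [|Z - m|] of any centre [m]. *)
Lemma mean_centred m :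
  mean_le P (fun w => `|Z w - m| ^+ k) (D ^+ k) ->
  exists z, ('E_P[Z] = z%:E)%E /\ mean_le P (fun w => `|Z w - z| ^+ k) ((6 * D) ^+ k).
Proof.
move=> mD; have Dk : 0 < D ^+ k by rewrite exprn_gt0.
have mZm : measurable_fun setT (fun w => Z w - m) by exact: measurable_funB.
have i1 : mean_le P (fun w => `|Z w - m|) (2 * D).
  have Di : 0 <= (D ^+ k)^-1 by rewrite invr_ge0 ltW.
  apply: mean_le_mono (mean_leZ (ltW D0) (mean_leD (mean_le_cst P ler01) (mean_leZ Di mD))) => //.
  - exact: measurableT_comp.
  - move=> w; have t0 : 0 <= `|Z w - m| / D by rewrite divr_ge0// ltW.
    have := le1DX k0 t0; rewrite (expr_div_n `|Z w - m|) ler_pdivrMr//.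
    by rewrite mulrC [X in _ * (1 + X)]mulrC.
  - by rewrite mulVf ?gt_eqF//; lra.
have int1 : P.-integrable setT (EFin \o (fun w => Z w - m)).
  apply/integrableP; split; first exact/measurable_EFinP.
  by case: i1 => _ _ h; apply: le_lt_trans h _; rewrite ltry.
have int2 : P.-integrable setT (EFin \o (fun=> m)).
  by apply: finite_measure_integrable_cst.
pose I := fine (\int[P]_w (Z w - m)%:E).
have IE : (\int[P]_w (Z w - m)%:E = I%:E)%E.
  by rewrite fineK//; exact: integrable_fin_num.
have Ile : `|I| <= 2 * D.
  rewrite -lee_fin; case: i1 => _ _; apply: le_trans.
  rewrite -abse_EFin -IE; apply: le_abse_integral => //; exact/measurable_EFinP.
exists (I + m); split.
  rewrite unlock.
  have -> : (\int[P]_w (Z w)%:E = \int[P]_w ((Z w - m)%:E + m%:E))%E.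
    by apply: eq_integral => w _; rewrite -EFinD subrK.
  rewrite (integralD measurableT int1 int2) /=.
  have -> : (\int[P]_w m%:E = m%:E)%E by exact: integral_probability_cst.
  by rewrite IE.
have p2 : 0 <= 2 ^+ k :> R by rewrite exprn_ge0.
have pI : 0 <= (2 * D) ^+ k by rewrite exprn_ge0// mulr_ge0// ltW.
apply: mean_le_mono (mean_leZ p2 (mean_leD mD (mean_le_cst P pI))) => //.
- apply: measurable_funX; apply: measurableT_comp => //; exact: measurable_funB.
- move=> w; apply: le_trans (exprD_le k _ _) => //; last by rewrite mulr_ge0// ltW.
  have e : Z w - (I + m) = (Z w - m) - I by ring.
  apply: lerXn2r; rewrite ?nnegrE ?addr_ge0// ?mulr_ge0 ?(ltW D0)//.
  by rewrite e; apply: le_trans (ler_normB _ _) _; rewrite lerD2l.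
- have D2 : 0 <= 2 * D by rewrite mulr_ge0// ltW.
  have := exprD_ge k0 (ltW D0) D2 => h.
  have := ler_wpM2l p2 h; rewrite -exprMn => /le_trans; apply.
  by rewrite le_eqVlt; apply/orP; left; apply/eqP; congr (_ ^+ _); ring.
Qed.

End centering.


Lemma exprD3_le (R : realType) k (p q r : R) : 0 <= p -> 0 <= q -> 0 <= r ->
  (p + q + r) ^+ k <= 4 ^+ k * (p ^+ k + q ^+ k + r ^+ k).
Proof.
move=> p0 q0 r0.
have t0 : 0 <= 2 ^+ k :> R by rewrite exprn_ge0.
have h1 := exprD_le k (addr_ge0 p0 q0) r0.
have h2 := ler_wpM2l (mulr_ge0 t0 t0) (lexx (p ^+ k + q ^+ k)).
have h3 := ler_wpM2l t0 (exprD_le k p0 q0).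
have -> : 4 ^+ k = 2 ^+ k * 2 ^+ k :> R by rewrite -exprMn; congr (_ ^+ _); ring.
apply: (le_trans h1).
have h4 : 1 <= 2 ^+ k :> R by rewrite exprn_ege1// ler1n.
have h5 : 2 ^+ k * r ^+ k <= 2 ^+ k * 2 ^+ k * r ^+ k.
  by rewrite -mulrA ler_wpM2l// ler_peMl// exprn_ge0.
by rewrite mulrDr [leRHS]mulrDr; apply: lerD => //; rewrite -mulrA.
Qed.

Section moments.
Variables (R : realType) (a : R).
Hypothesis a0 : 0 < a.

(** [Z - Z'] is the sum of two clipping errors and of the difference of the clipped
   variables; [exists_centre] and [mean_centred] replace [Z'] by the mean. *)
Lemma deviation_moment : exists2 C : R, 0 < C &
  forall disp (T : measurableType disp) (P : probability T R) (n d : nat)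
    (X : 'I_n -> {RV P >-> R}) (L : R) (f : tensor_space R n d -> R) (k : nat) (M : R),
  (0 < n)%N -> (0 < d)%N -> mutually_independent X ->
  (forall i, mean_le P (fun w => expR (X i w ^+ 2 / a ^+ 2)) 2) ->
  (forall i, mean_le P (fun w => X i w ^+ 2) 1) ->
  0 < L -> convex_function setT f -> tensor_lipschitz L f ->
  (0 < k)%N -> 0 <= M ->
  2 * d%:R ^+ 2 * (k%:R / n%:R) <= 1 :> R ->
  2 * d%:R ^+ 2 * (k%:R / n%:R) <= (2 * a ^+ 2)^-1 ->
  expR (- (M ^+ 2 / (2 * a ^+ 2))) <= k%:R / n%:R ->
  2 * (k%:R / n%:R) * M ^+ 2 <= (2 * a ^+ 2)^-1 ->
  exists z, ('E_P[fun w => f (tensor_power d (rowX X w))] = z%:E)%E /\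
    mean_le P (fun w => `|f (tensor_power d (rowX X w)) - z| ^+ k)
      ((C * Num.sqrt (k%:R * deviation_scale n d L M)) ^+ k).
Proof.
have c10 : 0 < expR (square_rate a) + 2 * a ^+ 2 * expR 2.
  by rewrite addr_gt0 ?expR_gt0// mulr_gt0 ?expR_gt0// mulr_gt0// exprn_gt0.
have W0 : 0 < weight_const a.
  have e1 := expR_gt0 (square_rate a); have e2 := expR_gt0 (4 * square_rate a).
  have e3 := expR_gt0 (64 * a ^+ 4).
  rewrite /weight_const; move: (expR _) (expR _) (expR _) e1 e2 e3 => x y z; lra.
have c20 : 0 < 64 * (1 + 512 * weight_const a).
  by move: (weight_const a) W0 => W W0; lra.
move: mean_clip_error mean_clipped.
have [c1 c1E] : exists c, c = expR (square_rate a) + 2 * a ^+ 2 * expR 2.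
  by exists (expR (square_rate a) + 2 * a ^+ 2 * expR 2).
have [c2 c2E] : exists c, c = 64 * (1 + 512 * weight_const a).
  by exists (64 * (1 + 512 * weight_const a)).
rewrite -c1E in c10; rewrite -c2E in c20.
move=> clip_error clipped.
have C0 : 0 < 4 * (2 * c1 + c2) by lra.
exists (6 * (2 * (4 * (2 * c1 + c2)))); first by lra.
move=> disp T P n d X L f k M n0 d0 indep psi var L0 cf lf k0 M0 dk1 dka Mk kM.
have m1 := clip_error _ _ _ _ _ _ _ _ n0 d0 indep a0 psi var _ _ L0 lf _ _ k0 M0 dk1 dka Mk.
have m2 : mean_le (P \x P)%E (fun w => `|f (tensor_power d (clipX X M w.1)) -
    f (tensor_power d (clipX X M w.2))| ^+ k)
    ((c2 * Num.sqrt (k%:R * deviation_scale n d L M)) ^+ k).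
  by rewrite c2E; apply: clipped.
rewrite -c1E in m1.
have S0 : 0 < Num.sqrt (k%:R * deviation_scale n d L M).
  rewrite sqrtr_gt0 mulr_gt0 ?ltr0n// mulr_gt0 ?mulr_gt0 ?exprn_gt0 ?ltr0n//.
  by rewrite ltr_wpDl ?mulr_ge0 ?sqr_ge0// exprn_gt0// ltr0n.
move: (Num.sqrt _) S0 m1 m2 => S S0 m1 m2.
pose Z w := f (tensor_power d (rowX X w)).
pose Y w := f (tensor_power d (clipX X M w)).
have mZ : measurable_fun setT Z.
  exact: measurable_tensor_power (ltW L0) lf (measurable_rowX _).
have q0 : 0 <= 4 ^+ k :> R by rewrite exprn_ge0.
have m3 : mean_le (P \x P)%E (fun w => `|Z w.1 - Z w.2| ^+ k)
    ((4 * (2 * c1 + c2) * S) ^+ k).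
  have := mean_leZ q0 (mean_leD (mean_leD (mean_le_fst m1) (mean_le_snd m1)) m2).
  apply: mean_le_mono.
  - apply: measurable_funX; apply: measurableT_comp => //; apply: measurable_funB.
      exact: (measurableT_comp mZ measurable_fst).
    exact: (measurableT_comp mZ measurable_snd).
  - by move=> w; rewrite exprn_ge0.
  - move=> w; rewrite -/(Z w.1) -/(Z w.2) -/(Y w.1) -/(Y w.2).
    have tri : `|Z w.1 - Z w.2| <= (`|Z w.1 - Y w.1| + `|Z w.2 - Y w.2|) + `|Y w.1 - Y w.2|.
      have -> : Z w.1 - Z w.2 = ((Z w.1 - Y w.1) - (Z w.2 - Y w.2)) + (Y w.1 - Y w.2) by ring.
      by apply: (le_trans (ler_normD _ _)); rewrite lerD2r ler_normB.
    apply: le_trans (exprD3_le k (normr_ge0 _) (normr_ge0 _) (normr_ge0 _)).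
    by apply: lerXn2r tri; rewrite nnegrE// !addr_ge0.
  - rewrite -[4 * _ * S]mulrA [leRHS]exprMn ler_wpM2l//.
    have p1 : 0 <= S * c1 by rewrite mulr_ge0// ltW.
    have p2 : 0 <= c2 * S by rewrite mulr_ge0// ltW.
    rewrite (_ : (2 * c1 + c2) * S = (S * c1 + S * c1) + c2 * S); last by ring.
    apply: le_trans (exprD_ge k0 (addr_ge0 p1 p1) p2).
    by rewrite lerD2r; exact: exprD_ge.
have [m mZm] := exists_centre k0 (mulr_gt0 C0 S0) mZ m3.
have D0 : 0 < 2 * (4 * (2 * c1 + c2) * S) by rewrite mulr_gt0// mulr_gt0.
have [z [zE mz]] := mean_centred k0 D0 mZ mZm.
exists z; split => //.
by rewrite -[_ * S]mulrA -[2 * _ * S]mulrA.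
Qed.

End moments.

(** * From a moment to tails and Lebesgue norms *)

Section from_moment.
Context disp (T : measurableType disp) (R : realType).
Variables (P : probability T R) (Y : T -> R) (k : nat) (D : R).
Hypotheses (D0 : 0 < D) (mY : measurable_fun setT Y).
Hypothesis mD : mean_le P (fun w => `|Y w| ^+ k) (D ^+ k).

Let Di : 0 < (D ^+ k)^-1. Proof. by rewrite invr_gt0 exprn_gt0. Qed.

Let mnY : measurable_fun setT (fun w => `|Y w|).
Proof. exact: measurableT_comp. Qed.

(** Markov's inequality for the [k]-th power, at [e] times the moment bound. *)
Lemma tail_of_moment (t : R) : expR 1 * D <= t ->
  (P [set w | t < `|Y w|]%R <= (expR (- k%:R))%:E)%E.
Proof.
move=> Dt; set A := [set w | _].
have mA : measurable A.
  rewrite (_ : A = (fun w => `|Y w|) @^-1` `]t, +oo[).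
    by rewrite -[_ @^-1` _]setTI; exact: mnY.
  by apply/seteqP; split => w /=; rewrite in_itv/= andbT.
have c0 : 0 <= expR (- k%:R) * (D ^+ k)^-1 by rewrite mulr_ge0 ?expR_ge0// ltW.
have mI : measurable_fun setT (\1_A : T -> R) by exact: measurable_indic.
have I0 w : 0 <= (\1_A w : R) by rewrite indicE.
have mi : mean_le P (\1_A : T -> R) (expR (- k%:R)).
  apply: mean_le_mono (mean_leZ c0 mD) => //.
  - move=> w; rewrite indicE; case: (boolP (w \in A)) => [|_]; last first.
      by rewrite mulr_ge0// exprn_ge0.
    rewrite inE => tY.
    have eD : 0 <= expR 1 * D by rewrite mulr_ge0 ?expR_ge0// ltW.
    have h : (expR 1 * D) ^+ k <= `|Y w| ^+ k.
      by apply: lerXn2r; rewrite ?nnegrE//; exact: le_trans Dt (ltW tY).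
    apply: le_trans (ler_wpM2l c0 h).
    rewrite exprMn -expRM_natr mul1r mulrACA -expRD addNr expR0 mul1r.
    by rewrite mulVf// gt_eqF// exprn_gt0.
  - by rewrite -mulrA mulVf ?mulr1// gt_eqF// exprn_gt0.
by case: mi => _ _; rewrite integral_indic// setIT.
Qed.

Lemma Lnorm_of_moment (p : R) : 1 <= p -> p <= k%:R ->
  ('N[P]_p%:E[(fun w => (Y w)%:E)] <= (2 * D)%:E)%E.
Proof.
move=> p1 pk; have p0 : 0 < p by exact: lt_le_trans p1.
have Dp : 0 <= D `^ p by exact: powR_ge0.
have mp : mean_le P (fun w => `|Y w| `^ p) ((2 * D) `^ p).
  apply: mean_le_mono (mean_leZ Dp (mean_leD (mean_le_cst P ler01) (mean_leZ (ltW Di) mD))).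
  - apply: (measurableT_comp (f := fun t : R => t `^ p)); [exact: measurable_powR|exact: mnY].
  - by move=> w; exact: powR_ge0.
  - move=> w; pose t := `|Y w| / D.
    have t0 : 0 <= t by rewrite divr_ge0// ltW.
    have -> : `|Y w| = D * t by rewrite /t mulrCA divff ?mulr1// gt_eqF.
    rewrite (powRM _ (ltW D0) t0) ler_wpM2l// exprMn mulKf ?gt_eqF ?exprn_gt0//.
    have [t1|t1] := leP t 1.
      apply: (@le_trans _ _ (1 `^ p)); last by rewrite powR1 lerDl exprn_ge0.
      by apply: ge0_ler_powR; rewrite ?nnegrE// ltW.
    apply: (@le_trans _ _ (t `^ k%:R)); last by rewrite powR_mulrn// lerDr.
    by apply: ler_powR => //; exact: ltW.
  - rewrite mulVf ?gt_eqF ?exprn_gt0// powRM ?(ltW D0)// mulrC ler_wpM2r//.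
    rewrite -[leLHS](@powRr1 _ (1 + 1)) ?addr_ge0//.
    by rewrite -[1 + 1]/2; apply: ler_powR => //; rewrite ler1n.
rewrite unlock.
have -> : (2 * D)%:E = (((2 * D) `^ p)%:E `^ p^-1)%E :> \bar R.
  by rewrite poweR_EFin -powRrM divff ?gt_eqF// powRr1// mulr_ge0// ltW.
have ip : 0 <= p^-1 by rewrite invr_ge0 ltW.
have I (x : \bar R) : (0 <= x)%E -> x \in `[0%E, +oo%E] by move=> x0; rewrite in_itv/= x0 leey.
have [_ _ hp] := mp.
refine (gt0_ler_poweR ip (I _ _) (I _ _) hp); last by rewrite lee_fin powR_ge0.
by apply: integral_ge0 => w _; rewrite lee_fin powR_ge0.
Qed.

End from_moment.

(** * Choice of the constants *)

Section constants.
Variable R : realType.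
Implicit Types (a p y L : R).

(** For [s = sqrt y >= 1], both [e] and [s^2] are at most powers of [exp s >= 1 + s]. *)
Lemma ln_expR1D_le y : 1 <= y -> ln (expR 1 + y) <= 4 * Num.sqrt y.
Proof.
move=> y1; have y0 : 0 <= y by exact: le_trans y1.
pose s := Num.sqrt y; have sE : y = s ^+ 2 by rewrite sqr_sqrtr.
have s1 : 1 <= s by rewrite -sqrtr1 ler_wsqrtr.
have e1 : 1 <= expR 1 :> R by rewrite -[leLHS]expR0 ler_expR.
have p0 : 0 < expR 1 + y by rewrite ltr_pwDl ?expR_gt0.
rewrite -/s -ler_expR lnK ?posrE//.
have h1 : 1 + s <= expR s by exact: expR_ge1Dx.
have h2 : expR 1 <= expR s by rewrite ler_expR.
have h3 : (1 + s) ^+ 2 <= expR s ^+ 2 by rewrite lerXn2r ?nnegrE// ?expR_ge0//; lra.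
have es : 1 <= expR s by lra.
have -> : 4 * s = s + (s + (s + s)) by ring.
rewrite !expRD; move: (expR s) (expR 1 : R) sE h1 h2 h3 es e1 => q e -> h1 h2 h3 q1 e1.
have q2 : q <= q * (q * (q * q)) / 1.
  rewrite divr1 ler_peMr//; first by lra.
  by rewrite !mulr_ege1//.
have q3 : q ^+ 2 <= q * (q * (q * q)) by nra.
nra.
Qed.

(** Each summand is what one of the conditions of [admissible_rateP] asks for:
   [4] and [8 a^2] bound [2 d^2 k / n] by [1] and by [1 / (2 a^2)], and
   [2048 a^8 = 2 (32 a^4)^2] lets [n / k] dominate [8 a^4 ln (e + n / k)]. *)
Definition admissible_rate a : R := (4 + 8 * a ^+ 2 + 2048 * a ^+ 8)^-1.

(** Chosen so that [exp (- M^2 / (2 a^2)) = 1 / (e + y)], with [y = n / k]. *)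
Definition clip_level a y : R := Num.sqrt (2 * a ^+ 2 * ln (expR 1 + y)).

Lemma admissible_rate_gt0 a : 0 < a -> 0 < admissible_rate a.
Proof.
move=> a0; rewrite invr_gt0.
by have := exprn_gt0 2 a0; have := exprn_gt0 8 a0; lra.
Qed.

Lemma admissible_rate_le1 a : 0 < a -> admissible_rate a <= 1.
Proof.
move=> a0; have q1 : 1 <= 4 + 8 * a ^+ 2 + 2048 * a ^+ 8.
  by have := exprn_gt0 2 a0; have := exprn_gt0 8 a0; lra.
rewrite /admissible_rate; move: (4 + _ + _) q1 => q q1.
by rewrite invf_le1// (lt_le_trans ltr01).
Qed.

Lemma ln_expR1D_ge1 y : 0 <= y -> 1 <= ln (expR 1 + y).
Proof.
move=> y0; rewrite -ler_expR lnK ?lerDl//.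
by rewrite posrE ltr_pwDl ?expR_gt0.
Qed.

Lemma sqr_clip_level a y : 0 <= y ->
  clip_level a y ^+ 2 = 2 * a ^+ 2 * ln (expR 1 + y).
Proof.
move=> y0; rewrite sqr_sqrtr// mulr_ge0//; first by rewrite mulr_ge0 ?sqr_ge0.
exact: le_trans ler01 (ln_expR1D_ge1 y0).
Qed.

Lemma admissible_rateP a p (n d k : nat) : 0 < a -> (0 < n)%N -> (0 < d)%N -> (0 < k)%N ->
  k%:R <= 2 * p -> p <= admissible_rate a * n%:R / d%:R ^+ 2 ->
  let r : R := k%:R / n%:R in let M := clip_level a (n%:R / k%:R) in
  [/\ 2 * d%:R ^+ 2 * r <= 1, 2 * d%:R ^+ 2 * r <= (2 * a ^+ 2)^-1,
      expR (- (M ^+ 2 / (2 * a ^+ 2))) <= r & 2 * r * M ^+ 2 <= (2 * a ^+ 2)^-1].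
Proof.
move=> a0 n0 d0 k0 kp pn /=; set r : R := k%:R / n%:R.
have nR : (0 : R) < n%:R by rewrite ltr0n.
have kR : (0 : R) < k%:R by rewrite ltr0n.
have d2 : 1 <= d%:R ^+ 2 :> R by rewrite exprn_ege1// ler1n.
have d2p : 0 < d%:R ^+ 2 :> R by exact: lt_le_trans d2.
have r0 : 0 < r by rewrite divr_gt0.
have yE : n%:R / k%:R = r^-1 by rewrite /r invf_div.
have c0 := admissible_rate_gt0 a0.
have a2 : 0 < a ^+ 2 by rewrite exprn_gt0.
have a8 : 0 < a ^+ 8 by rewrite exprn_gt0.
have cE : admissible_rate a * (4 + 8 * a ^+ 2 + 2048 * a ^+ 8) = 1.
  move: c0; rewrite /admissible_rate; move: (4 + _ + _) => q; rewrite invr_gt0 => q0.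
  by rewrite mulVf// gt_eqF.
move: (admissible_rate a) c0 cE pn => c c0 cE pn.
have dr : d%:R ^+ 2 * r <= 2 * c.
  rewrite /r mulrA ler_pdivrMr// -ler_pdivlMl//; apply: (le_trans kp).
  by have := ler_wpM2l (ler0n R 2) pn; move=> /le_trans; apply; rewrite le_eqVlt; apply/orP; left; apply/eqP; field; rewrite gt_eqF ?ltr0n.
have rc : r <= 2 * c by apply: le_trans dr; rewrite ler_peMl// ltW.
have ca2 : 0 < c * a ^+ 2 by rewrite mulr_gt0.
have ca8 : 0 < c * a ^+ 8 by rewrite mulr_gt0.
have i0 : 0 <= r^-1 by rewrite invr_ge0 ltW.
have c4 : 4 * c <= 1 by lra.
have c4a : 4 * c <= (2 * a ^+ 2)^-1.
  by rewrite -[leRHS]mul1r ler_pdivlMr ?mulr_gt0//; lra.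
have dr2 : 2 * d%:R ^+ 2 * r <= 4 * c by rewrite -mulrA; lra.
rewrite yE sqr_clip_level//; set l := ln _.
split.
- exact: le_trans dr2 c4.
- exact: le_trans dr2 c4a.
- rewrite mulrAC divff ?mul1r ?gt_eqF ?mulr_gt0// expRN lnK; last first.
    by rewrite posrE ltr_pwDl ?expR_gt0.
  rewrite -[leRHS]invrK lef_pV2 ?posrE ?invr_gt0//; first by rewrite lerDr expR_ge0.
  by rewrite ltr_pwDl ?expR_gt0.
- have y1 : 1 <= r^-1 by rewrite invf_ge1//; lra.
  have le := ln_expR1D_le y1; rewrite -/l in le.
  pose s := Num.sqrt r^-1.
  have s0 : 0 < s by rewrite sqrtr_gt0 invr_gt0.
  have sE : s ^+ 2 = r^-1 by rewrite (@sqr_sqrtr _ r^-1).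
  have rs : r * s ^+ 2 = 1 by rewrite sE divff// gt_eqF.
  have as_ : 32 * a ^+ 4 <= s.
    rewrite -(@ler_pXn2r _ 2) ?nnegrE ?(ltW s0)//; last by rewrite mulr_ge0// exprn_ge0// ltW.
    rewrite sE -[leRHS]mul1r ler_pdivlMr// exprMn -exprM.
    have := ler_wpM2l (ltW a8) rc; lra.
  rewrite -[leRHS]mul1r ler_pdivlMr ?mulr_gt0//.
  have h1 : 8 * a ^+ 4 * r * l <= 8 * a ^+ 4 * r * (4 * s).
    by rewrite ler_wpM2l// mulr_ge0 ?(ltW r0)// mulr_ge0// exprn_ge0// ltW.
  have h2 : r * s * (32 * a ^+ 4) <= r * s * s.
    by rewrite ler_wpM2l// mulr_ge0// ltW.
  have -> : 2 * r * (2 * a ^+ 2 * l) * (2 * a ^+ 2) = 8 * a ^+ 4 * r * l by ring.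
  have e : r * s * s = 1 by rewrite -rs; ring.
  rewrite e in h2; apply: (le_trans h1).
  by apply: le_trans h2; rewrite le_eqVlt; apply/orP; left; apply/eqP; ring.
Qed.

(** The passage from the integer [k] back to [p]: the logarithm decreases in [k],
   and [k] is at most twice [p]. *)
Lemma deviation_scale_le a p L (n d k : nat) : 0 < a -> 0 < L -> (0 < n)%N -> (0 < d)%N ->
  (0 < k)%N -> p <= k%:R -> k%:R <= 2 * p ->
  Num.sqrt (k%:R * deviation_scale n d L (clip_level a (n%:R / k%:R))) <=
  (2 + 2 * a) * (L * n%:R `^ ((d%:R - 1) / 2) *
    (d%:R * Num.sqrt p + Num.sqrt (d%:R * p * ln (expR 1 + n%:R / p)))).
Proof.
move=> a0 L0 n0 d0 k0 pk kp.
have nR : (0 : R) < n%:R by rewrite ltr0n.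
have kR : (0 : R) < k%:R by rewrite ltr0n.
have p0 : 0 < p by lra.
have dR : (0 : R) < d%:R by rewrite ltr0n.
set N := n%:R `^ _; have N0 : 0 < N by exact: powR_gt0.
have N2 : n%:R ^+ d.-1 = N ^+ 2.
  rewrite -[RHS]powR_mulrn ?powR_ge0// /N -powRrM -[LHS]powR_mulrn ?(ltW nR)//; congr (_ `^ _).
  by rewrite -mulrA mulVf// mulr1 -[in RHS](prednK d0) -natr1 addrK.
set l := ln (expR 1 + n%:R / p).
have y0 : 0 <= n%:R / k%:R :> R by rewrite divr_ge0.
have l1 : 1 <= l by rewrite ln_expR1D_ge1// divr_ge0// ltW.
have l0 : 0 <= l by exact: le_trans l1.
have ll : ln (expR 1 + n%:R / k%:R) <= l.
  rewrite ler_ln ?posrE ?lerD2l; first by rewrite ler_wpM2l ?(ltW nR)// lef_pV2 ?posrE.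
    by rewrite ltr_pwDl ?expR_gt0.
  by rewrite ltr_pwDl ?expR_gt0// divr_ge0// ltW.
set u := d%:R * Num.sqrt p; set v := Num.sqrt (d%:R * p * l).
have u0 : 0 <= u by rewrite mulr_ge0 ?sqrtr_ge0// ltW.
have v0 : 0 <= v by exact: sqrtr_ge0.
have u2 : u ^+ 2 = d%:R ^+ 2 * p by rewrite exprMn sqr_sqrtr// ltW.
have v2 : v ^+ 2 = d%:R * p * l.
  have dp : 0 <= d%:R * p by rewrite mulr_ge0// ltW.
  by rewrite (@sqr_sqrtr _ (d%:R * p * l))//; exact: mulr_ge0.
have R0 : 0 <= (2 + 2 * a) * (L * N * (u + v)).
  apply: mulr_ge0; first lra.
  by apply: mulr_ge0; [rewrite ltW// mulr_gt0|exact: addr_ge0].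
rewrite -[leRHS](@ger0_norm R)// -sqrtr_sqr; apply: ler_wsqrtr.
rewrite /deviation_scale sqr_clip_level// N2.
have LN : 0 <= L ^+ 2 * N ^+ 2 by rewrite mulr_ge0 ?sqr_ge0.
rewrite !exprMn.
have -> : k%:R * (L ^+ 2 * N ^+ 2 * (d%:R * (2 * a ^+ 2 * ln (expR 1 + n%:R / k%:R)) + d%:R ^+ 2)) =
  L ^+ 2 * N ^+ 2 * (k%:R * (d%:R * (2 * a ^+ 2 * ln (expR 1 + n%:R / k%:R)) + d%:R ^+ 2)) by ring.
rewrite [leRHS]mulrCA ler_wpM2l//.
apply: (@le_trans _ _ (2 * p * (d%:R * (2 * a ^+ 2 * l) + d%:R ^+ 2))).
  apply: ler_pM => //.
    have lk0 : 0 <= ln (expR 1 + n%:R / k%:R) :> R.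
      by apply: le_trans (ln_expR1D_ge1 y0).
    apply: addr_ge0 (sqr_ge0 _); apply: mulr_ge0 (ltW dR) _; apply: mulr_ge0 lk0.
    by rewrite mulr_ge0// sqr_ge0.
  by rewrite lerD2r ler_wpM2l ?(ltW dR)// ler_wpM2l// mulr_ge0// sqr_ge0.
have -> : 2 * p * (d%:R * (2 * a ^+ 2 * l) + d%:R ^+ 2) = 4 * a ^+ 2 * v ^+ 2 + 2 * u ^+ 2.
  by rewrite u2 v2; ring.
have h1 : 4 * a ^+ 2 <= (2 + 2 * a) ^+ 2 by nra.
have h2 : 2 <= (2 + 2 * a) ^+ 2 by nra.
have h3 := ler_wpM2r (sqr_ge0 v) h1; have h4 := ler_wpM2r (sqr_ge0 u) h2.
apply: le_trans (lerD h3 h4) _; rewrite -mulrDr ler_wpM2l ?sqr_ge0//.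
by have := mulr_ge0 u0 v0; lra.
Qed.

End constants.

(** * Concentration of convex functions of tensor powers *)

Section hypotheses.
Context disp (T : measurableType disp) (R : realType).
Variables (P : probability T R) (W : T -> R).
Hypothesis mW : measurable_fun setT W.

(** The norm is an infimum below [2 K], hence some admissible value is below
   [2 K] too. *)
Lemma mean_le_psi2 (K : R) : 0 < K -> (psi2_norm P W <= K%:E)%E ->
  mean_le P (fun w => expR (W w ^+ 2 / (2 * K) ^+ 2)) 2.
Proof.
move=> K0 WK; have : (psi2_norm P W < (2 * K)%:E)%E.
  by apply: (le_lt_trans WK); rewrite lte_fin; lra.
move=> /ereal_inf_lt[_ [b [b0 Wb] <-]]; rewrite lte_fin => bK.
have me (r : R) : measurable_fun setT (fun w => expR (W w ^+ 2 / r)).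
  apply: (measurableT_comp (f := @expR R)); first exact: measurable_expR.
  by apply: measurable_funM => //; exact: measurable_funX.
have mb : mean_le P (fun w => expR (W w ^+ 2 / b ^+ 2)) 2.
  by split => //; rewrite unlock in Wb.
apply: mean_le_mono mb => //.
move=> w; rewrite ler_expR ler_wpM2l ?sqr_ge0// lef_pV2 ?posrE ?exprn_gt0 ?mulr_gt0//.
by rewrite lerXn2r ?nnegrE// ltW// mulr_gt0.
Qed.

Lemma mean_le_sqr : ('E_P[fun w => (W w ^+ 2)%R] = 1)%E -> mean_le P (fun w => W w ^+ 2) 1.
Proof.
move=> W1; split; [exact: measurable_funX|by move=> w; exact: sqr_ge0|].
by rewrite unlock in W1; rewrite W1.
Qed.

End hypotheses.

Theorem theorem2p1 (R : realType) :
  exists C : R, 0 < C /\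
  forall K : R, 0 < K ->
  exists cK CK : R, [/\ 0 < cK, 0 < CK &
  forall (n d : nat) (disp : measure_display) (T : measurableType disp)
    (P : probability T R) (X : 'I_n -> {RV P >-> R}) (L : R)
    (f : tensor_space R n d -> R),
  (1 <= n)%N -> (1 <= d)%N ->
  mutually_independent X ->
  (forall i, 'E_P[X i] = 0)%E ->
  (forall i, 'E_P[fun w => (X i w ^+ 2)%R] = 1)%E ->
  (forall i, psi2_norm P (X i) <= K%:E)%E ->
  0 < L ->
  convex_function setT f ->
  tensor_lipschitz L f ->
  let Z : T -> R := fun w => f (tensor_power d (\row_i X i w)) in
  (forall u : R, 1 <= u -> u <= cK * n%:R / d%:R ^+ 2 ->
    (P [set w | (CK * L * n%:R `^ ((d%:R - 1) / 2) *
                 (d%:R * Num.sqrt u +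
                  Num.sqrt (d%:R * u * ln (expR 1 + n%:R / u))))%:E
                < `| (Z w)%:E - 'E_P[Z] |]
     <= (C * expR (- (cK * u)))%:E)%E)
  /\
  (d%:R <= cK * Num.sqrt n%:R ->
    forall p : R, 1 <= p -> p <= cK * n%:R / d%:R ^+ 2 ->
    ('N[P]_p%:E[(fun w => (Z w)%:E - 'E_P[Z])]
     <= (CK * L * n%:R `^ ((d%:R - 1) / 2) *
         (d%:R * Num.sqrt p +
          Num.sqrt (d%:R * p * ln (expR 1 + n%:R / p))))%:E)%E)].
Proof.
exists 1; split => // K K0; pose a := 2 * K.
have a0 : 0 < a by rewrite mulr_gt0.
have [C C0 deviation] := deviation_moment a0.
have e0 := expR_gt0 (1 : R).
have b0 : 0 < 2 + 2 * a by lra.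
(* [2] is the factor of [Lnorm_of_moment], and [expR 1] the one of
   [tail_of_moment]. *)
exists (admissible_rate a), ((2 + expR 1) * (C * (2 + 2 * a))); split.
- exact: admissible_rate_gt0.
- by rewrite mulr_gt0 ?mulr_gt0// addr_gt0.
move=> n d disp T P X L f n0 d0 indep _ var psi L0 cf lf Z.
pose B p := L * n%:R `^ ((d%:R - 1) / 2) *
  (d%:R * Num.sqrt p + Num.sqrt (d%:R * p * ln (expR 1 + n%:R / p))).
have B0 p : 1 <= p -> 0 < B p.
  move=> p1; have p0 : 0 < p by exact: lt_le_trans p1.
  apply: mulr_gt0; first by rewrite mulr_gt0// powR_gt0// ltr0n.
  by rewrite ltr_wpDr ?sqrtr_ge0// mulr_gt0 ?ltr0n// sqrtr_gt0.
have mZ : measurable_fun setT Z.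
  exact: measurable_tensor_power (ltW L0) lf (measurable_rowX _).
have key p : 1 <= p -> p <= admissible_rate a * n%:R / d%:R ^+ 2 ->
    exists (k : nat) (z : R), [/\ (0 < k)%N, p <= k%:R, ('E_P[Z] = z%:E)%E &
      mean_le P (fun w => `|Z w - z| ^+ k) ((C * (2 + 2 * a) * B p) ^+ k)].
  (* The integer [k] satisfies [p <= k <= 2 p]. *)
  move=> p1 pn; pose k := (Num.trunc p).+1.
  have p0 : 0 <= p by exact: le_trans p1.
  have /andP[k1 /ltW k2] := truncn_itv p0.
  have kp : k%:R <= 2 * p.
    have -> : k%:R = (Num.trunc p)%:R + 1 :> R by rewrite natr1.
    lra.
  have [dk1 dka Mk kM] := admissible_rateP a0 n0 d0 (ltn0Sn _) kp pn.
  have psi' i := mean_le_psi2 (measurable_funPT (X i)) K0 (psi i).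
  have var' i := mean_le_sqr (measurable_funPT (X i)) (var i).
  have [z [zE mz]] := deviation _ _ _ _ _ _ _ _ _ _ n0 d0 indep psi' var' L0 cf lf
    (ltn0Sn _) (sqrtr_ge0 _) dk1 dka Mk kM.
  exists k, z; split => //.
  have le := deviation_scale_le a0 L0 n0 d0 (ltn0Sn _) k2 kp.
  apply: mean_le_mono mz => //.
  - apply: measurable_funX; apply: measurableT_comp => //; exact: measurable_funB.
  - apply: lerXn2r; rewrite ?nnegrE.
    + by rewrite mulr_ge0 ?sqrtr_ge0// ltW.
    + by rewrite ltW// mulr_gt0 ?B0// mulr_gt0.
    + by rewrite -[leRHS](mulrA C); apply: ler_wpM2l le; exact: ltW.
have BE p : (2 + expR 1) * (C * (2 + 2 * a)) * L * n%:R `^ ((d%:R - 1) / 2) *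
    (d%:R * Num.sqrt p + Num.sqrt (d%:R * p * ln (expR 1 + n%:R / p))) =
    (2 + expR 1) * (C * (2 + 2 * a) * B p) by rewrite /B; ring.
split=> [u u1 un|_ p p1 pn].
- have [k [z [k0 uk zE mz]]] := key _ u1 un.
  have D0 : 0 < C * (2 + 2 * a) * B u by rewrite mulr_gt0 ?B0// mulr_gt0.
  rewrite zE BE.
  have mY : measurable_fun setT (fun w => Z w - z) by exact: measurable_funB.
  pose t := (2 + expR 1) * (C * (2 + 2 * a) * B u).
  have tD : expR 1 * (C * (2 + 2 * a) * B u) <= t by rewrite ler_wpM2r ?(ltW D0)// lerDr.
  rewrite (_ : [set _ | _] = [set w | t < `|Z w - z|]); last first.
    by apply/seteqP; split => w /=; rewrite lte_fin.
  apply: le_trans (tail_of_moment D0 mY mz tD) _; rewrite lee_fin mul1r ler_expR lerN2.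
  apply: le_trans uk; rewrite ler_piMl ?admissible_rate_le1//.
  exact: le_trans u1.
- have [k [z [k0 pk zE mz]]] := key _ p1 pn.
  have D0 : 0 < C * (2 + 2 * a) * B p by rewrite mulr_gt0 ?B0// mulr_gt0.
  rewrite zE BE.
  have mY : measurable_fun setT (fun w => Z w - z) by exact: measurable_funB.
  have := Lnorm_of_moment D0 mY mz p1 pk.
  move=> /le_trans; apply; rewrite lee_fin ler_wpM2r ?(ltW D0)// lerDl ltW//.
Qed.
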